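(* Let $\mathbb{K}$ be a field of characteristic $0$ and let $s_\bullet$ be a gauge. If $f:\mathfrak{g}\to\mathfrak{h}$ is a surjective morphism of nilpotent $L_\infty$-algebras over $\mathbb{K}$, then the induced morphism $\gamma_\bullet(f):\gamma_\bullet(\mathfrak g)\to\gamma_\bullet(\mathfrak h)$ is a (Kan) fibration of simplicial sets.
   Context: $L_\infty$-algebras. An $L_\infty$-algebra is a graded $\mathbb{K}$-vector space $\mathfrak{g}$ with multilinear operations $[x_1,\dots,x_k]$, $k\ge1$, of degree $2-k$, graded antisymmetric, i.e. $[x_1,\dots,x_i,x_{i+1},\dots,x_k]+(-1)^{|x_i||x_{i+1}|}[x_1,\dots,x_{i+1},x_i,\dots,x_k]=0$, such that for each $n\ge1$ $$\sum_{k=1}^n(-1)^k\sum(-1)^{\varepsilon}[[x_{i_1},\dots,x_{i_k}],x_{j_1},\dots,x_{j_{n-k}}]=0,$$ the inner sum being over $i_1<\dots<i_k$, $j_1<\dots<j_{n-k}$ with $\{i_1,\dots,i_k\}\cup\{j_1,\dots,j_{n-k}\}=\{1,\dots,n\}$, and $(-1)^\varepsilon$ being the product of the sign of the permutation $(1,\dots,n)\mapsto(i_1,\dots,i_k,j_1,\dots,j_{n-k})$ with the Koszul sign of its action on $(x_1,\dots,x_n)$. Write $\delta x=[x]$. A morphism is a degree-$0$ linear map commuting with all brackets. Put $F^1\mathfrak g=\mathfrak g$ and, for $i>1$, $F^i\mathfrak g=\sum_{k\ge2}\sum_{i_1+\dots+i_k=i}[F^{i_1}\mathfrak g,\dots,F^{i_k}\mathfrak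 g]$; $\mathfrak g$ is nilpotent if $F^i\mathfrak g=0$ for all sufficiently large $i$. For nilpotent $\mathfrak g$, $\mathrm{MC}(\mathfrak g)$ is the set of $\alpha\in\mathfrak g^1$ with $\delta\alpha+\sum_{\ell\ge2}\frac1{\ell!}[\alpha,\dots,\alpha]=0$ ($\ell$ entries $\alpha$). Forms. $\Omega_n=\mathbb K[t_0,\dots,t_n,dt_0,\dots,dt_n]/(t_0+\dots+t_n-1,\,dt_0+\dots+dt_n)$ is the differential graded (dg) commutative algebra of polynomial forms on the $n$-simplex ($|t_i|=0$, $|dt_i|=1$); these form a simplicial dg algebra $\Omega_\bullet$, where $f:[k]\to[n]$ acts by $f^*t_i=\sum_{f(j)=i}t_j$. For an $L_\infty$-algebra $\mathfrak g$, $\mathfrak g\otimes\Omega_n$ is an $L_\infty$-algebra with $[x\otimes a]=[x]\otimes a+(-1)^{|x|}x\otimes da$ and, for $k\ge2$, $[x_1\otimes a_1,\dots,x_k\otimes a_k]=(-1)^{\sum_{i<j}|a_i||x_j|}[x_1,\dots,x_k]\otimes a_1\cdots a_k$. Set $\mathrm{MC}_\bullet(\mathfrak g)=\mathrm{MC}(\mathfrak g\otimes\Omega_\bullet)$, a simplicial set. Gauges. For $i_0,\dots,i_k\in\{0,\dots,n\}$, $I_{i_0\dots i_k}:\Omega_n\to\mathbb K$ is integration over the $k$-chain spanned by the vertices $(e_{i_0},\dots,e_{i_k})$: pull back to $\Omega_k$ along the affine map sending the $p$-th vertex to $e_{i_p}$, then apply $t_1^{a_1}\cdots t_k^{a_k}dt_1\cdots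 dt_k\mapsto a_1!\cdots a_k!/(a_1+\dots+a_k+k)!$ (zero on forms of degree $\ne k$). Put $\omega_{i_0\dots i_k}=k!\sum_{j=0}^k(-1)^jt_{i_j}dt_{i_0}\cdots\widehat{dt_{i_j}}\cdots dt_{i_k}$ and $P_n\omega=\sum_{k=0}^n\sum_{i_0<\dots<i_k}\omega_{i_0\dots i_k}I_{i_0\dots i_k}(\omega)$. A contraction is a family of $\mathbb K$-linear maps $s_n:\Omega_n^*\to\Omega_n^{*-1}$, compatible with all simplicial operators, with $\mathrm{id}-P_n=ds_n+s_nd$. A gauge is a contraction with $s_n^2=0$ for all $n$. The maps $s_n$ are extended to $\mathfrak g\otimes\Omega_n$ by acting on the second factor. Definition of $\gamma_\bullet$. $\gamma_n(\mathfrak g)=\{\alpha\in\mathrm{MC}_n(\mathfrak g)\mid s_n\alpha=0\}$, a simplicial subset of $\mathrm{MC}_\bullet(\mathfrak g)$, functorial in $\mathfrak g$. A map $X_\bullet\to Y_\bullet$ of simplicial sets is a fibration if for all $n>0$, $0\le i\le n$, every horn $\Lambda^n_i\to X_\bullet$ together with an $n$-simplex of $Y_\bullet$ extending its image lifts to an $n$-simplex of $X_\bullet$ filling the horn and mapping to the given $n$-simplex. *)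

(* Defs.v *)
From HB Require Import structures.
From mathcomp Require Import all_boot all_order all_algebra.
From mathcomp Require Import freeg mpoly.
From mathcomp Require Import boolp.

Set Implicit Arguments.
Unset Strict Implicit.
Unset Printing Implicit Defensive.

Import GRing.Theory.

Local Open Scope ring_scope.
Local Open Scope quotient_scope.

Section LinearFun.
Context (K : fieldType) (U V : lmodType K) (F : U -> V) (FL : linear F).

Lemma lin0 : F 0 = 0.
Proof. by have := FL (-1) 0 0; rewrite !scaleN1r oppr0 add0r addNr. Qed.

Lemma linB x y : F (x - y) = F x - F y.
Proof. by rewrite addrC -scaleN1r FL scaleN1r addrC. Qed.

Lemma linZ c x : F (c *: x) = c *: F x.
Proof. by rewrite -[c *: x]addr0 FL lin0 addr0. Qed.

Lemma lin_sum (I : Type) (r : seq I) (E : I -> U) :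
  F (\sum_(i <- r) E i) = \sum_(i <- r) F (E i).
Proof.
elim: r => [|i r IHr]; first by rewrite !big_nil lin0.
by rewrite !big_cons -[E i]scale1r FL !scale1r IHr.
Qed.

End LinearFun.

Inductive span (K : fieldType) (V : lmodType K) (G : V -> Prop) : V -> Prop :=
| span_0 : span G 0
| span_gen x : G x -> span G x
| span_lin c x y : span G x -> span G y -> span G (c *: x + y).

Section Quot.
Context (K : fieldType) (V : lmodType K) (G : V -> Prop).
Implicit Types x y z : V.

Lemma spanD x y : span G x -> span G y -> span G (x + y).
Proof. by move=> gx gy; rewrite -[x]scale1r; apply: span_lin. Qed.

Lemma spanZ c x : span G x -> span G (c *: x).
Proof.
by move=> gx; rewrite -[_ *: _]addr0; apply: span_lin => //; apply: span_0.
Qed.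

Definition span_eq x y : bool := `[< span G (x - y) >].

Lemma span_eq_refl : reflexive span_eq.
Proof. by move=> x; apply/asboolP; rewrite subrr; apply: span_0. Qed.

Lemma span_eq_sym : ssrbool.symmetric span_eq.
Proof.
have sub x y : span_eq x y -> span_eq y x.
  by move/asboolP/(spanZ (-1)); rewrite scaleN1r opprB => ?; apply/asboolP.
by move=> x y; apply/idP/idP; apply: sub.
Qed.

Lemma span_eq_trans : transitive span_eq.
Proof.
move=> y x z /asboolP xy /asboolP yz; apply/asboolP.
by have := spanD xy yz; rewrite addrA subrK.
Qed.

Canonical span_equiv := EquivRel span_eq span_eq_refl span_eq_sym span_eq_trans.

Definition quot := {eq_quot span_eq}.

HB.instance Definition _ := Choice.on quot.
HB.instance Definition _ := Quotient.on quot.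
HB.instance Definition _ := EqQuotient.on quot.

Definition cls (x : V) : quot := \pi_quot x.
Definition rep (q : quot) : V := repr q.

Lemma repK : cancel rep cls.
Proof. exact: reprK. Qed.

Lemma clsP x y : cls x = cls y <-> span G (x - y).
Proof.
split; first by move=> /eqmodP/asboolP.
by move=> xy; apply/eqmodP/asboolP.
Qed.

Lemma rep_cls x : span G (rep (cls x) - x).
Proof. by apply/clsP; rewrite repK. Qed.

Definition quot_add (p q : quot) : quot := cls (rep p + rep q).
Definition quot_opp (p : quot) : quot := cls (- rep p).
Definition quot_scale (c : K) (p : quot) : quot := cls (c *: rep p).

Lemma clsD x y : cls (x + y) = quot_add (cls x) (cls y).
Proof.
apply/esym/clsP; rewrite opprD addrACA.
by apply: spanD; apply: rep_cls.
Qed.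

Lemma clsN x : cls (- x) = quot_opp (cls x).
Proof.
apply/esym/clsP; rewrite opprK -[x in _ + x]opprK -opprD -scaleN1r.
exact/spanZ/rep_cls.
Qed.

Lemma clsZ c x : cls (c *: x) = quot_scale c (cls x).
Proof. by apply/esym/clsP; rewrite -scalerBr; apply/spanZ/rep_cls. Qed.

Lemma quot_ind (P : quot -> Prop) : (forall x, P (cls x)) -> forall q, P q.
Proof. by move=> Pcls q; rewrite -[q]repK. Qed.

Fact quot_addA : associative quot_add.
Proof.
elim/quot_ind=> x; elim/quot_ind=> y; elim/quot_ind=> z.
by rewrite -!clsD addrA.
Qed.

Fact quot_addC : commutative quot_add.
Proof. by move=> p q; rewrite /quot_add addrC. Qed.

Fact quot_add0 : left_id (cls 0) quot_add.
Proof. by elim/quot_ind=> x; rewrite -clsD add0r. Qed.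

Fact quot_addN : left_inverse (cls 0) quot_opp quot_add.
Proof. by elim/quot_ind=> x; rewrite -clsN -clsD addNr. Qed.

HB.instance Definition _ :=
  GRing.isZmodule.Build quot quot_addA quot_addC quot_add0 quot_addN.

Fact quot_scaleA a b q : quot_scale a (quot_scale b q) = quot_scale (a * b) q.
Proof. by elim/quot_ind: q => x; rewrite -!clsZ scalerA. Qed.

Fact quot_scale1 : left_id 1 quot_scale.
Proof. by elim/quot_ind=> x; rewrite -clsZ scale1r. Qed.

Fact quot_scaleDr : right_distributive quot_scale +%R.
Proof.
move=> c; elim/quot_ind=> x; elim/quot_ind=> y.
by rewrite -[cls x + cls y]clsD -!clsZ scalerDr clsD.
Qed.

Fact quot_scaleDl q : {morph quot_scale^~ q : a b / a + b}.
Proof. by elim/quot_ind: q => x a b; rewrite -!clsZ scalerDl clsD. Qed.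

HB.instance Definition _ := GRing.Zmodule_isLmodule.Build K quot
  quot_scaleA quot_scale1 quot_scaleDr quot_scaleDl.

Fact cls_is_linear : linear cls.
Proof. by move=> c x y; rewrite clsD clsZ. Qed.

HB.instance Definition _ := GRing.isLinear.Build K V quot *:%R cls cls_is_linear.

Lemma rep_lift (U : lmodType K) (F : V -> U) :
    linear F -> (forall x, G x -> F x = 0) -> forall x, F (rep (cls x)) = F x.
Proof.
move=> FL FG x; have Fspan y : span G y -> F y = 0.
  elim=> [|//|c u v _ Fu _ Fv]; first exact: lin0.
  by rewrite FL Fu Fv scaler0 addr0.
by have := Fspan _ (rep_cls x); rewrite linB // => /eqP; rewrite subr_eq0 => /eqP.
Qed.

End Quot.

(* A graded vector space is given by its total space and the projections onto
   its homogeneous components; [graded] states that these define a direct sum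
   decomposition indexed by the integers. *)
Record gvect (K : fieldType) := GVect {
  gsort :> lmodType K;
  gpr : int -> gsort -> gsort }.

Definition graded (K : fieldType) (V : gvect K) : Prop :=
  [/\ forall (i : int) c (x y : V), gpr i (c *: x + y) = c *: gpr i x + gpr i y,
      forall (i j : int) (x : V), gpr i (gpr j x) = if i == j then gpr j x else 0
    & forall x : V, exists s : seq int, uniq s /\ x = \sum_(i <- s) gpr i x].

Definition of_degree (K : fieldType) (V : gvect K) (i : int) (x : V) : Prop :=
  gpr i x = x.

(* A finite list of degrees outside of which the components of x vanish. *)
Definition gsupp (K : fieldType) (V : gvect K) (x : V) : seq int :=
  if pselect (exists s : seq int, uniq s /\ x = \sum_(i <- s) gpr i x)
  is left e then sval (cid e) else [::].

Section Tensor.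
Context (K : fieldType).

Section TensorSpace.
Context (V W : lmodType K).

Notation pure v w := (<< (v, w) >> : {freeg (V * W) / K}).

Inductive bilin_rel : {freeg (V * W) / K} -> Prop :=
| bilin_l c v v' w :
    bilin_rel (pure (c *: v + v') w - (c *: pure v w + pure v' w))
| bilin_r c v w w' :
    bilin_rel (pure v (c *: w + w') - (c *: pure v w + pure v w')).

Definition tens : lmodType K := quot bilin_rel.

Definition tpure (v : V) (w : W) : tens := cls bilin_rel (pure v w).

Lemma tpure_linl c v v' w :
  tpure (c *: v + v') w = c *: tpure v w + tpure v' w.
Proof. by rewrite /tpure -linearP; apply/clsP/span_gen/bilin_l. Qed.

Lemma tpure_linr c v w w' :
  tpure v (c *: w + w') = c *: tpure v w + tpure v w'.
Proof. by rewrite /tpure -linearP; apply/clsP/span_gen/bilin_r. Qed.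

Lemma tens_sum (z : tens) :
  z = \sum_(vw <- dom (rep z)) coeff vw (rep z) *: tpure vw.1 vw.2.
Proof.
rewrite -{1}[z]repK -{1}[rep z]freeg_sumE linear_sum; apply: eq_bigr => -[v w] _.
rewrite /tpure -linearZ; congr (cls _ _).
by apply/eqP/freeg_eqP=> k; rewrite coeffZ !coeffU mul1r.
Qed.

End TensorSpace.

Lemma fglift_linear (T : choiceType) (U : lmodType K) (F : T -> U) :
  linear (fglift F : {freeg T / K} -> U).
Proof.
have FB := lift_is_additive F.
have F0 : fglift F 0 = 0 by have := FB 0 0; rewrite !subrr.
have FD x y : fglift F (x + y) = fglift F x + fglift F y.
  by rewrite -{1}[y]opprK FB -[- y]add0r FB F0 add0r opprK.
have FS (r : seq T) (E : T -> {freeg T / K}) :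
    fglift F (\sum_(t <- r) E t) = \sum_(t <- r) fglift F (E t).
  by elim: r => [|t r IHr]; rewrite ?big_nil ?big_cons // FD IHr.
move=> c x y; rewrite FD; congr (_ + _).
rewrite -{2}[x]freeg_sumE FS scaler_sumr [c *: x]/(fgscale c x) FS.
by apply: eq_bigr => t _; rewrite !liftU scalerA.
Qed.

(* For f and g linear, the map f (x) g. *)
Definition tmap (V W V' W' : lmodType K) (f : V -> V') (g : W -> W')
    (z : tens V W) : tens V' W' :=
  fglift (fun vw : V * W => tpure (f vw.1) (g vw.2)) (rep z).

Lemma tmap_tpure (V W V' W' : lmodType K) (f : {linear V -> V'})
    (g : {linear W -> W'}) v w :
  tmap f g (tpure v w) = tpure (f v) (g w).
Proof.
rewrite {2}/tpure /tmap (rep_lift (fglift_linear _)) ?liftU ?scale1r //.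
by move=> _ [c x x' y|c x y y']; rewrite (linB (fglift_linear _)) fglift_linear
  !liftU !scale1r /= linearP ?tpure_linl ?tpure_linr subrr.
Qed.

Record hpair (V W : gvect K) := HPair {
  hdeg1 : int; hfst : V; hdeg2 : int; hsnd : W }.

(* An expression of a tensor as a sum of x (x) a with x and a homogeneous,
   listed with their degrees. *)
Definition hdecomp (V W : gvect K) (z : tens V W) : seq (hpair V W) :=
  flatten
    [seq [seq HPair i (coeff vw (rep z) *: gpr i vw.1) p (gpr p vw.2)
         | i <- gsupp vw.1, p <- gsupp vw.2]
    | vw <- dom (rep z)].

Lemma gsuppE (V : gvect K) (x : V) :
  graded V -> x = \sum_(i <- gsupp x) gpr i x.
Proof.
case=> _ _ /(_ x) ex; rewrite /gsupp; case: pselect => // e.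
by case: (cid e) => s /= [].
Qed.

Lemma hdecompE (V W : gvect K) (z : tens V W) : graded V -> graded W ->
  z = \sum_(h <- hdecomp z) tpure (hfst h) (hsnd h).
Proof.
move=> gV gW; rewrite {1}[z]tens_sum big_flatten big_map; apply: eq_bigr => -[v w] _.
have tr (v0 : V) : linear (fun w0 : W => tpure v0 w0) by move=> c x y; apply: tpure_linr.
have tl (w0 : W) : linear (fun v0 : V => tpure v0 w0) by move=> c x y; apply: tpure_linl.
rewrite big_allpairs_dep /=; set c := coeff _ _.
rewrite {1}(gsuppE v gV) (lin_sum (tl _)) scaler_sumr; apply: eq_bigr => i _.
rewrite {1}(gsuppE w gW) (lin_sum (tr _)) scaler_sumr; apply: eq_bigr => p _.
by rewrite (linZ (tl _)).
Qed.

Definition gtens (V W : gvect K) : gvect K :=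
  @GVect K (tens V W) (fun m z =>
    \sum_(h <- hdecomp z | hdeg1 h + hdeg2 h == m) tpure (hfst h) (hsnd h)).

End Tensor.

(* The list [:: x1; ...; xk] is sent to the bracket [x1,...,xk].  There is no
   bracket of arity 0: [br [::]] is a dummy value, normalised to 0 below. *)
Record brvect (K : fieldType) := BrVect {
  brsort :> gvect K;
  br : seq brsort -> brsort }.

Section Linf.
Context (K : fieldType).

Definition sgnz (i : int) : K := (-1) ^ i.

Section Brackets.
Context (g : brvect K).

Definition br_multilinear : Prop :=
  forall (s1 s2 : seq g) c (x y : g),
    br (s1 ++ (c *: x + y) :: s2) = c *: br (s1 ++ x :: s2) + br (s1 ++ y :: s2).

Definition br_degree : Prop :=
  forall (k : nat) (d : 'I_k -> int) (x : 'I_k -> g), (0 < k)%N ->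
    (forall i, of_degree (d i) (x i)) ->
    of_degree (\sum_i d i + 2 - k%:Z) (br [seq x i | i <- enum 'I_k]).

Definition br_antisym : Prop :=
  forall (s1 s2 : seq g) (i j : int) (x y : g), of_degree i x -> of_degree j y ->
    br (s1 ++ x :: y :: s2) + sgnz (i * j) *: br (s1 ++ y :: x :: s2) = 0.

(* Sign of the permutation (1..n) |-> (I, complement of I), both listed in
   increasing order, times its Koszul sign on elements of degrees d: every
   inversion contributes -1 to the former and (-1)^(d i * d j) to the latter. *)
Definition shuffle_sign (n : nat) (d : 'I_n -> int) (I : {set 'I_n}) : K :=
  \prod_(i in I) \prod_(j in ~: I | (j < i)%N) (- sgnz (d i * d j)).

Definition br_jacobi : Prop :=
  forall (n : nat) (d : 'I_n -> int) (x : 'I_n -> g), (0 < n)%N ->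
    (forall i, of_degree (d i) (x i)) ->
    \sum_(1 <= k < n.+1) (-1) ^+ k *:
      \sum_(I : {set 'I_n} | #|I| == k) shuffle_sign d I *:
        br (br [seq x i | i <- enum I] :: [seq x j | j <- enum (~: I)]) = 0.

Definition Linf_axioms : Prop :=
  graded g /\
  [/\ br [::] = 0 :> g, br_multilinear, br_degree, br_antisym & br_jacobi].

(* [Fil i] is F^i g; it is empty (rather than zero) for i = 0, so that the
   indices i_1, ..., i_k in [Fil_br] are all positive. *)
Inductive Fil : nat -> g -> Prop :=
| Fil_1 x : Fil 1 x
| Fil_0 i : (0 < i)%N -> Fil i 0
| Fil_lin i c x y : Fil i x -> Fil i y -> Fil i (c *: x + y)
| Fil_br k (i : 'I_k -> nat) (x : 'I_k -> g) : (2 <= k)%N ->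
    (forall j, Fil (i j) (x j)) ->
    Fil (\sum_j i j)%N (br [seq x j | j <- enum 'I_k]).

Definition nilpotent : Prop :=
  exists N : nat, forall i, (N <= i)%N -> forall x, Fil i x -> x = 0.

(* The curvature is a sum whose terms eventually vanish in the nilpotent case:
   the Maurer-Cartan equation says that its partial sums are eventually 0. *)
Definition MC (a : g) : Prop :=
  of_degree 1 a /\
  exists N0 : nat, forall N : nat, (N0 <= N)%N ->
    br [:: a] + \sum_(2 <= l < N) (l`!%:R)^-1 *: br (nseq l a) = 0.

End Brackets.

Record Linf := MkLinf {
  Linf_sort :> brvect K;
  Linf_ax : Linf_axioms Linf_sort }.

Definition Linf_morphism (g h : Linf) (f : g -> h) : Prop :=
  [/\ forall c (x y : g), f (c *: x + y) = c *: f x + f y,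
      forall (i : int) (x : g), of_degree i x -> of_degree i (f x)
    & forall s : seq g, (0 < size s)%N -> f (br s) = br [seq f x | x <- s]].

Record dga := DGA {
  dga_sort :> gvect K;
  dga_mul : dga_sort -> dga_sort -> dga_sort;
  dga_one : dga_sort;
  dga_d : dga_sort -> dga_sort }.

Section TensorLinf.
Context (g : brvect K) (A : dga).

(* sum_(i < j) |a_i| |x_j| *)
Fixpoint cross_degree (hs : seq (hpair g A)) : int :=
  if hs is h :: hs' then
    hdeg2 h * (\sum_(h' <- hs') hdeg1 h') + cross_degree hs'
  else 0.

Definition tbr_pure (hs : seq (hpair g A)) : tens g A :=
  match hs with
  | [::] => 0
  | [:: h] => tpure (br [:: hfst h]) (hsnd h) +
              sgnz (hdeg1 h) *: tpure (hfst h) (dga_d (hsnd h))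
  | _ => sgnz (cross_degree hs) *:
         tpure (br [seq hfst h | h <- hs])
               (\big[@dga_mul A/dga_one A]_(h <- hs) hsnd h)
  end.

Fixpoint selections (T : Type) (ss : seq (seq T)) : seq (seq T) :=
  if ss is s :: ss' then [seq x :: t | x <- s, t <- selections ss'] else [:: [::]].

Definition tbr (zs : seq (gtens g A)) : gtens g A :=
  \sum_(hs <- selections [seq hdecomp z | z <- zs]) tbr_pure hs.

Definition tensor_Linf : brvect K := @BrVect K (gtens g A) tbr.

End TensorLinf.

End Linf.

Section Forms.
Context (K : fieldType).

(* K[t_0,..,t_n,dt_0,..,dt_n]: the form a is the sum over S of (a S) dt_S, where
   dt_S is the product of the dt_i for i in S in increasing order. *)
Definition pform (n : nat) := {ffun {set 'I_n.+1} -> {mpoly K[n.+1]}}.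

Definition inversions (n : nat) (S T : {set 'I_n}) : nat :=
  (\sum_(s in S) #|[set t in T | t < s]|)%N.

Definition pform_poly n (p : {mpoly K[n.+1]}) : pform n :=
  [ffun S : {set 'I_n.+1} => if S == set0 then p else 0].

Definition pform_dt n (i : 'I_n.+1) : pform n :=
  [ffun S : {set 'I_n.+1} => if S == [set i] then 1 else 0].

Definition pform_mul n (a b : pform n) : pform n :=
  [ffun U : {set 'I_n.+1} => \sum_(S : {set 'I_n.+1} | S \subset U)
     (-1) ^+ inversions S (U :\: S) * (a S * b (U :\: S))].

Definition pform_d n (a : pform n) : pform n :=
  [ffun U : {set 'I_n.+1} => \sum_(i in U)
     (-1) ^+ #|[set j in U | (j < i)%N]| * mderiv i (a (U :\ i))].

Definition pform_pr n (p : int) (a : pform n) : pform n :=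
  [ffun S : {set 'I_n.+1} => if (#|S| : int) == p then a S else 0].

(* The morphism of dg algebras with t_i |-> theta i (and dt_i |-> d (theta i)). *)
Definition pform_subst m n (theta : 'I_m.+1 -> {mpoly K[n.+1]}) (a : pform m) :
    pform n :=
  \sum_(S : {set 'I_m.+1})
    pform_mul (pform_poly (a S \mPo [tuple theta i | i < m.+1]))
      (\big[@pform_mul n/pform_poly 1]_(i <- enum S) pform_d (pform_poly (theta i))).

(* Generators of the two-sided ideal (t_0 + ... + t_n - 1, dt_0 + ... + dt_n). *)
Inductive simplex_rel n : pform n -> Prop :=
| simplex_rel_t a b :
    simplex_rel (pform_mul a (pform_mul (pform_poly (\sum_i 'X_i - 1)) b))
| simplex_rel_dt a b :
    simplex_rel (pform_mul a (pform_mul (\sum_i pform_dt i) b)).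

Definition form (n : nat) : lmodType K := quot (@simplex_rel n).

Definition to_form n (a : pform n) : form n := cls (@simplex_rel n) a.

(* This and the operations below are computed on representatives; they respect
   the differential graded ideal of the relations. *)
Definition form_mul n (a b : form n) : form n :=
  to_form (pform_mul (rep a) (rep b)).

Definition form_t n (i : 'I_n.+1) : form n := to_form (pform_poly 'X_i).
Definition form_dt n (i : 'I_n.+1) : form n := to_form (pform_dt i).

Definition Omega (n : nat) : dga K :=
  @DGA K (@GVect K (form n) (fun p a => to_form (pform_pr p (rep a))))
    (@form_mul n) (to_form (pform_poly 1)) (fun a => to_form (pform_d (rep a))).

(* Pullback along the affine map of simplices which sends vertex j to f j. *)
Definition form_pull k n (f : 'I_k.+1 -> 'I_n.+1) (a : Omega n) : Omega k :=
  to_form (pform_subst (fun i => \sum_(j | f j == i) 'X_j) (rep a)).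

(* Substituting 1 - t_1 - ... - t_k for t_0 puts a form in its normal form as a
   polynomial in t_1, .., t_k, dt_1, .., dt_k. *)
Definition pform_elim k (a : pform k) : pform k :=
  pform_subst
    (fun i => if i == ord0 then 1 - \sum_(j | j != ord0) 'X_j else 'X_i) a.

Definition simplex_int k (a : Omega k) : K :=
  let p := pform_elim (rep a) [set~ ord0] in
  \sum_(m <- msupp p) p@_m * (\prod_i (m i)`!)%N%:R / ((mdeg m + k)`!)%:R.

Definition chain_int k n (i : 'I_k.+1 -> 'I_n.+1) (a : Omega n) : K :=
  simplex_int (form_pull i a).

Definition elem_form k n (i : 'I_k.+1 -> 'I_n.+1) : Omega n :=
  k`!%:R *: \sum_(j < k.+1) (-1) ^+ j *:
    form_mul (form_t (i j))
      (\big[@form_mul n/dga_one (Omega n)]_(l <- enum 'I_k.+1 | l != j)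
         form_dt (i l)).

Definition increasing k n (i : {ffun 'I_k.+1 -> 'I_n.+1}) : bool :=
  [forall a : 'I_k.+1, forall b : 'I_k.+1, (a < b)%N ==> (i a < i b)%N].

Definition Whitney_proj n (a : Omega n) : Omega n :=
  \sum_(k < n.+1) \sum_(i : {ffun 'I_k.+1 -> 'I_n.+1} | increasing i)
    chain_int i a *: elem_form i.

End Forms.

(* The operators [m] -> [n] of the simplex category are the monotone ones. *)
Definition ordmap (m n : nat) := {ffun 'I_m.+1 -> 'I_n.+1}.

Definition monotone m n (f : ordmap m n) : Prop :=
  {homo f : i j / (i <= j)%N}.

Definition ocomp l m n (f : ordmap m n) (e : ordmap l m) : ordmap l n :=
  [ffun j => f (e j)].

(* The simplicial set whose n-simplices are the x with [smem x], described by
   operators on an ambient family of types. *)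
Record sdata := SData {
  ssort :> nat -> Type;
  smem : forall n, ssort n -> Prop;
  sop : forall m n, ordmap m n -> ssort n -> ssort m }.

Definition simplicial (X : sdata) : Prop :=
  [/\ forall m n (f : ordmap m n) (x : X n), monotone f -> smem x ->
        smem (sop f x),
      forall n (x : X n), smem x -> sop [ffun i => i] x = x
    & forall l m n (f : ordmap m n) (e : ordmap l m) (x : X n),
        monotone f -> monotone e -> smem x ->
        sop (ocomp f e) x = sop e (sop f x)].

Definition simplicial_map (X Y : sdata) (p : forall n, X n -> Y n) : Prop :=
  (forall n (x : X n), smem x -> smem (p n x)) /\
  (forall m n (f : ordmap m n) (x : X n), monotone f -> smem x ->
     p m (sop f x) = sop f (p n x)).

(* m-simplices of the horn Lambda^n_i: the m-simplices of Delta^n lying in a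
   face opposite to some vertex j different from i. *)
Definition in_horn m n (i : 'I_n.+1) (f : ordmap m n) : Prop :=
  monotone f /\ exists2 j, j != i & forall a, f a != j.

Definition horn_map (X : sdata) n (i : 'I_n.+1)
    (x : forall m, ordmap m n -> X m) : Prop :=
  (forall m (f : ordmap m n), in_horn i f -> smem (x m f)) /\
  (forall l m (f : ordmap m n) (e : ordmap l m), in_horn i f -> monotone e ->
     x l (ocomp f e) = sop e (x m f)).

Definition kan_fibration (X Y : sdata) (p : forall n, X n -> Y n) : Prop :=
  [/\ simplicial X, simplicial Y, simplicial_map p
    & forall (n : nat) (i : 'I_n.+1), (0 < n)%N ->
      forall x : (forall m, ordmap m n -> X m), horn_map i x ->
      forall y : Y n, smem y ->
      (forall m (f : ordmap m n), in_horn i f -> sop f y = p m (x m f)) ->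
      exists z : X n,
        [/\ smem z, forall m (f : ordmap m n), in_horn i f -> sop f z = x m f
          & p n z = y]].

Section Gauge.
Context (K : fieldType) (s : forall n, Omega K n -> Omega K n).

Definition contraction : Prop :=
  [/\ forall n c (a b : Omega K n), s (c *: a + b) = c *: s a + s b,
      forall n (p : int) (a : Omega K n), of_degree p a -> of_degree (p - 1) (s a),
      forall m n (f : ordmap m n) (a : Omega K n), monotone f ->
        form_pull f (s a) = s (form_pull f a)
    & forall n (a : Omega K n),
        a - Whitney_proj a = dga_d (s a) + s (dga_d a)].

Definition gauge : Prop :=
  contraction /\ forall n (a : Omega K n), s (s a) = 0.

Definition gamma (g : brvect K) : sdata :=
  @SData (fun n => tensor_Linf g (Omega K n))
    (fun n a => MC a /\ tmap idfun (@s n) a = 0)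
    (fun m n f => tmap idfun (@form_pull K m n f)).

Definition gamma_map (g h : brvect K) (f : g -> h) (n : nat) :
    gamma g n -> gamma h n := tmap f idfun.

End Gauge.

(* Main.v *)
(* Write a gauge as id - P = ds + sd.  Then s P = P s = 0, and with the Euler homotopy h_i centred
   at the i-th vertex, k = s + P h_i contracts the forms onto their value at that vertex; k is
   compatible with the faces containing the vertex, and s k = 0.  On g (x) Omega_n, k gives a
   homotopy for the total differential D, so a Maurer-Cartan element a with s a = 0 satisfies
     a = a(e_i) - D r - k Q(a),   r = P h_i a,
   where Q is the non-linear part of the curvature.  By nilpotency this equation has a unique
   solution for every r; when a(e_i) is Maurer-Cartan so is the solution, by the Bianchi identity,
   and it is killed by s.  Given a horn based at i in gamma(g) and a simplex y of gamma(h), linear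
   algebra yields some b in (g (x) Omega_n)^1 with the prescribed faces and image y.  The solution
   with r = P h_i b fills the horn and maps to y, since on each face and in h it solves the same
   equation as the prescribed element. *)

From HB Require Import structures.
From mathcomp Require Import all_boot all_order all_algebra.
From mathcomp Require Import freeg mpoly boolp.
From mathcomp Require Import zify ring.
Require Import Defs.

Set Implicit Arguments.
Unset Strict Implicit.
Unset Printing Implicit Defensive.

Import GRing.Theory.
Local Open Scope ring_scope.

(** * The exterior algebra of polynomial forms *)

(** The gauge [s] alone contracts only onto the Whitney forms, so its equation would leave the
    Whitney part of a solution undetermined. Adding P h_i contracts that part as well, down to one
    vertex; the vertex is i because every face of the horn contains it. All properties of P come
    from id - P = ds + sd, except P s = 0, where the integrals are used: on the k-simplex [s] has no
    nonzero value of degree k, as it would come from degree k + 1. Then s = s d s, hence s P = 0.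
    The homotopy h_i descends to the quotient because moving the vertex i to the origin makes the
    relations homogeneous, so that the Euler field preserves them. Two obstacles shape the
    development. Forms, gradings of tensors and brackets are computed on chosen representatives or
    decompositions, so independence of the choice precedes every computation. And g (x) Omega_n
    comes with no proof of the Jacobi identity: it is established on elements of total degree 1,
    where the Koszul signs of the forms become the shuffle signs of g; this suffices for the Bianchi
    identity. *)

Section ExteriorSigns.
Context (n : nat).
Implicit Types (i j : 'I_n) (S T U : {set 'I_n}).

(** The exponent of the sign produced when [dt_i], written in front of [dt_S], is moved to its place
    in increasing order. *)
Definition below S i : nat := #|[set j in S | (j < i)%N]|.

Lemma belowU1 i j S : j \notin S -> below (j |: S) i = ((j < i) + below S i)%N.
Proof.
move=> jS; rewrite /below; case: (ltnP j i) => ji /=.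
  have -> : [set k in j |: S | (k < i)%N] = j |: [set k in S | (k < i)%N].
    by apply/setP=> k; rewrite !inE; case: eqVneq => [->|//]; rewrite ji.
  by rewrite cardsU1 inE (negPf jS).
congr #|pred_of_set _|; apply/setP=> k; rewrite !inE.
by case: eqVneq => [->|//]; rewrite (negPf jS) ltnNge ji.
Qed.

Lemma below0 i : below set0 i = 0%N.
Proof. by rewrite /below; apply: eq_card0 => k; rewrite !inE. Qed.

Lemma belowU S T i : [disjoint S & T] -> below (S :|: T) i = (below S i + below T i)%N.
Proof.
move=> dST; rewrite /below; have -> : [set j in S :|: T | (j < i)%N] =
   [set j in S | (j < i)%N] :|: [set j in T | (j < i)%N].
  by apply/setP=> k; rewrite !inE andb_orl.
rewrite cardsU; have -> : [set j in S | (j < i)%N] :&: [set j in T | (j < i)%N] = set0.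
  apply/setP=> k; rewrite !inE; case kS: (k \in S) => //=.
  by rewrite (disjointFr dST kS) andbF.
by rewrite cards0 subn0.
Qed.

Lemma disjoints_Ul S T U : [disjoint S :|: T & U] = [disjoint S & U] && [disjoint T & U].
Proof. by rewrite -!setI_eq0 setIUl setU_eq0. Qed.

Lemma disjoints_Ur S T U : [disjoint S & T :|: U] = [disjoint S & T] && [disjoint S & U].
Proof. by rewrite -!setI_eq0 setIUr setU_eq0. Qed.

Lemma inversionsE S T : inversions S T = (\sum_(s in S) below T s)%N.
Proof. by []. Qed.

Lemma inversionsUl S T U : [disjoint S & T] ->
  inversions (S :|: T) U = (inversions S U + inversions T U)%N.
Proof.
move=> dST; rewrite !inversionsE (eq_bigl [predU S & T]) ?bigU // => x.
by rewrite !inE.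
Qed.

Lemma inversionsUr S T U : [disjoint T & U] ->
  inversions S (T :|: U) = (inversions S T + inversions S U)%N.
Proof.
by move=> dTU; rewrite !inversionsE -big_split; apply: eq_bigr => s _; rewrite /= belowU.
Qed.

Lemma inversions1l i T : inversions [set i] T = below T i.
Proof. by rewrite inversionsE big_set1. Qed.

Lemma inversions0l T : inversions set0 T = 0%N.
Proof. by rewrite inversionsE big_set0. Qed.

Lemma inversions0r S : inversions S set0 = 0%N.
Proof. by rewrite inversionsE big1 // => s _; rewrite below0. Qed.

(** Two distinct indices s and t form an inversion in exactly one of the two orders. The sign
    relating [dt_S dt_T] to [dt_T dt_S] is read off from this count. *)
Lemma inversions_sym S T : [disjoint S & T] ->
  (inversions S T + inversions T S = #|S| * #|T|)%N.
Proof.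
move=> dST; rewrite !inversionsE.
have bE A s : below A s = (\sum_(t in A) (t < s)%N)%N.
  by rewrite /below -sum1_card big_mkcond [RHS]big_mkcond /=; apply: eq_bigr => t _;
     rewrite inE; case: (t \in A); case: (t < s)%N.
under eq_bigr do rewrite bE; under [X in (_ + X)%N]eq_bigr do rewrite bE.
rewrite [X in (_ + X)%N]exchange_big -big_split /= -sum_nat_const; apply: eq_bigr => s sS.
rewrite -big_split /= -sum1_card; apply: eq_bigr => t tT.
have: (t : nat) != s by apply: contraTneq sS => /val_inj <-; rewrite (disjointFl dST).
by case: ltngtP.
Qed.

Lemma sorted_enum_ord (A : {set 'I_n}) : sorted (fun i j : 'I_n => (i < j)%N) (enum A).
Proof.
have -> : enum A = filter (mem A) (enum 'I_n) by rewrite [in RHS]enumT.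
apply: sorted_filter => [a b c|]; first exact: ltn_trans.
by rewrite -(@sorted_map _ _ (@nat_of_ord n) ltn) val_enum_ord iota_ltn_sorted.
Qed.

Lemma enum_setU1_min i S : i \notin S -> {in S, forall j, (i < j)%N} ->
  enum (i |: S) = i :: enum S.
Proof.
move=> iS imin.
have lt_tr : transitive (fun a b : 'I_n => (a < b)%N).
  by move=> a b c; apply: ltn_trans.
apply: (irr_sorted_eq lt_tr (fun a => ltnn a)); first exact: sorted_enum_ord.
- rewrite /= path_min_sorted ?sorted_enum_ord //.
  by apply/allP => j; rewrite mem_enum; apply: imin.
by move=> j; rewrite inE !mem_enum !inE.
Qed.

Lemma set_min_decomp S : S != set0 ->
  exists2 i, i \in S & {in S :\ i, forall j, (i < j)%N}.
Proof.
case/set0Pn=> i0 i0S; case: (arg_minnP (fun i : 'I_n => i : nat) i0S) => i iS imin.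
exists i => // j; rewrite !inE => /andP[ji jS].
by rewrite ltn_neqAle imin // andbT eq_sym.
Qed.

(** Inserting a new minimum creates no inversion and puts it at the head of [enum]; inductions along
    this principle build [dt_S] factor by factor without signs. *)
Lemma set_min_ind (P : {set 'I_n} -> Prop) : P set0 ->
  (forall i S, i \notin S -> {in S, forall j, (i < j)%N} -> P S -> P (i |: S)) ->
  forall S, P S.
Proof.
move=> P0 PS S; have [m] := ubnP #|S|; elim: m S => // m IHm S Sm.
have [->//|/set_min_decomp[i iS imin]] := eqVneq S set0.
rewrite -(setD1K iS); apply: PS; rewrite ?setD11 //; apply: IHm.
by move: Sm; rewrite (cardsD1 i S) iS.
Qed.

End ExteriorSigns.

(** The term at (i, j) cancels the one at (j, i). Both d^2 = 0 and the vanishing of the square of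
    dp, for a polynomial p, are instances. *)
Lemma sum_alternating (V : zmodType) (I : Type) (r : seq I) (F : I -> I -> V) :
  (forall i, F i i = 0) -> (forall i j, F i j + F j i = 0) ->
  \sum_(i <- r) \sum_(j <- r) F i j = 0.
Proof.
move=> F0 FN; elim: r => [|k r IHr]; first by rewrite big_nil.
rewrite !big_cons F0 add0r; under [X in _ + X]eq_bigr => i _ do rewrite big_cons.
by rewrite big_split /= IHr addr0 -big_split big1 // => j _ /=; rewrite FN.
Qed.

Local Notation "a ⋏ b" := (pform_mul a b) (at level 40, left associativity).

Section PolynomialForms.
Context (K : fieldType) (n : nat).
Notation N := n.+1.
Notation pf := (pform K n).
Notation poly := (@pform_poly K n).
Notation dt := (@pform_dt K n).
Implicit Types (S T U : {set 'I_N}) (i j : 'I_N) (p q : {mpoly K[N]}) (a b c : pf).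

(** The form [p dt_S]. Additive identities between forms are checked on these. *)
Definition pmono S p : pf := [ffun U => if U == S then p else 0].

Lemma pmono_sum a : a = \sum_S pmono S (a S).
Proof.
apply/ffunP=> U; rewrite sum_ffunE (bigD1 U) //= ffunE eqxx big1 ?addr0 // => S SU.
by rewrite ffunE eq_sym (negPf SU).
Qed.

Lemma pmonoD S p q : pmono S (p + q) = pmono S p + pmono S q.
Proof. by apply/ffunP=> U; rewrite !ffunE; case: ifP; rewrite ?addr0. Qed.

Lemma pmonoZ S (k : K) p : pmono S (k *: p) = k *: pmono S p.
Proof. by apply/ffunP=> U; rewrite !ffunE; case: ifP; rewrite ?scaler0. Qed.

Lemma pmono0 S : pmono S 0 = 0.
Proof. by apply/ffunP=> U; rewrite !ffunE; case: ifP. Qed.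

Lemma pform_poly0 : poly 0 = 0.
Proof. exact: pmono0. Qed.

Lemma pform_polyE p : poly p = pmono set0 p.
Proof. by []. Qed.

Lemma pform_dtE i : dt i = pmono [set i] 1.
Proof. by []. Qed.

Fact pform_mulDl a b c : (a + b) ⋏ c = a ⋏ c + b ⋏ c.
Proof.
apply/ffunP=> U; rewrite !ffunE -big_split; apply: eq_bigr => S _.
by rewrite ffunE mulrDl mulrDr.
Qed.

Fact pform_mulDr a b c : a ⋏ (b + c) = a ⋏ b + a ⋏ c.
Proof.
apply/ffunP=> U; rewrite !ffunE -big_split; apply: eq_bigr => S _.
by rewrite ffunE !mulrDr.
Qed.

Fact pform_mulZl (k : K) a b : (k *: a) ⋏ b = k *: (a ⋏ b).
Proof.
apply/ffunP=> U; rewrite !ffunE scaler_sumr; apply: eq_bigr => S _.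
by rewrite ffunE -scalerAl -scalerAr.
Qed.

Fact pform_mulZr (k : K) a b : a ⋏ (k *: b) = k *: (a ⋏ b).
Proof.
apply/ffunP=> U; rewrite !ffunE scaler_sumr; apply: eq_bigr => S _.
by rewrite ffunE -!scalerAr.
Qed.

Fact pform_mul0l a : 0 ⋏ a = 0.
Proof. by rewrite -[0 in LHS](scale0r (0 : pf)) pform_mulZl scale0r. Qed.

Fact pform_mul0r a : a ⋏ 0 = 0.
Proof. by rewrite -[0 in LHS](scale0r (0 : pf)) pform_mulZr scale0r. Qed.

Fact pform_mulNl a b : (- a) ⋏ b = - (a ⋏ b).
Proof. by rewrite -scaleN1r pform_mulZl scaleN1r. Qed.

Fact pform_mulNr a b : a ⋏ (- b) = - (a ⋏ b).
Proof. by rewrite -scaleN1r pform_mulZr scaleN1r. Qed.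

Fact pform_mul_suml I (r : seq I) (Q : pred I) (F : I -> pf) b :
  (\sum_(x <- r | Q x) F x) ⋏ b = \sum_(x <- r | Q x) F x ⋏ b.
Proof.
by apply: (big_morph (fun a => a ⋏ b)) => [x y|]; rewrite ?pform_mulDl ?pform_mul0l.
Qed.

Fact pform_mul_sumr I (r : seq I) (Q : pred I) (F : I -> pf) b :
  b ⋏ (\sum_(x <- r | Q x) F x) = \sum_(x <- r | Q x) b ⋏ F x.
Proof.
by apply: (big_morph (fun a => b ⋏ a)) => [x y|]; rewrite ?pform_mulDr ?pform_mul0r.
Qed.

Lemma pmono_mul S T p q : pmono S p ⋏ pmono T q =
  if [disjoint S & T] then pmono (S :|: T) ((-1) ^+ inversions S T * (p * q)) else 0.
Proof.
apply/ffunP=> U; rewrite !ffunE.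
under eq_bigr => V _ do rewrite !ffunE.
case: (boolP (S \subset U)) => SU; last first.
  rewrite big1 => [|V VU]; last first.
    by case: eqVneq VU SU => [-> ->//|_ _ _]; rewrite mul0r mulr0.
  case: ifP => _; rewrite ?ffunE //; case: eqP => // UE.
  by case/negP: SU; rewrite UE subsetUl.
rewrite (bigD1 S) //= eqxx big1 ?addr0; last first.
  by move=> V /andP[_ /negPf->]; rewrite mul0r mulr0.
case: eqVneq => [UST|UST].
  have dST : [disjoint S & T] by rewrite -UST disjoints_subset setCD subsetUr.
  have -> : S :|: T = U.
      by apply/setP=> x; rewrite -UST !inE; case xS: (x \in S); rewrite //= (subsetP SU).
  by rewrite dST ffunE eqxx UST.
rewrite !mulr0; case: ifP => dST; rewrite ffunE //; case: eqP => // UE.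
case/negP: UST; rewrite UE setDUl setDv set0U; apply/eqP/setDidPl.
by rewrite disjoint_sym.
Qed.

Lemma pform_mono_ext (V : zmodType) (F G : pf -> V) :
  (forall a b, F (a + b) = F a + F b) -> (forall a b, G (a + b) = G a + G b) ->
  (forall S p, F (pmono S p) = G (pmono S p)) -> forall a, F a = G a.
Proof.
move=> FD GD FG a.
have F0 : F 0 = 0 by apply: (addrI (F 0)); rewrite -FD !addr0.
have G0 : G 0 = 0 by apply: (addrI (G 0)); rewrite -GD !addr0.
rewrite (pmono_sum a) (big_morph F FD F0) (big_morph G GD G0).
by apply: eq_bigr => S _.
Qed.

Fact pform_mulA : associative (@pform_mul K n).
Proof.
move=> a b c; move: a; apply: pform_mono_ext => [x y|x y|S p]; rewrite ?pform_mulDl //.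
move: b; apply: pform_mono_ext => [x y|x y|T q]; rewrite ?(pform_mulDl, pform_mulDr) //.
move: c; apply: pform_mono_ext => [x y|x y|R r]; rewrite ?pform_mulDr //.
rewrite !pmono_mul; case: (boolP [disjoint S & T]) => dST;
  case: (boolP [disjoint T & R]) => dTR; rewrite ?pform_mul0l ?pform_mul0r ?pmono_mul //
  ?disjoints_Ul ?disjoints_Ur ?(negPf dST) ?(negPf dTR) ?andbF // dST dTR andbT /=.
case: ifP => // dSR; rewrite setUA inversionsUr // inversionsUl //; congr pmono.
by rewrite !exprD; ring.
Qed.

Fact pform_mul1l : left_id (poly 1) (@pform_mul K n).
Proof.
apply: pform_mono_ext => [x y|x y|S p]; rewrite ?pform_mulDr //.
by rewrite pform_polyE pmono_mul disjoints_subset sub0set set0U inversions0l !mul1r.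
Qed.

Fact pform_mul1r : right_id (poly 1) (@pform_mul K n).
Proof.
apply: pform_mono_ext => [x y|x y|S p]; rewrite ?pform_mulDl //.
by rewrite pform_polyE pmono_mul disjoint_sym disjoints_subset sub0set setU0
  inversions0r mulr1 mul1r.
Qed.

HB.instance Definition _ :=
  Monoid.isLaw.Build pf (poly 1) (@pform_mul K n) pform_mulA pform_mul1l pform_mul1r.

Lemma pform_polyM p q : poly (p * q) = poly p ⋏ poly q.
Proof.
by rewrite !pform_polyE pmono_mul disjoints_subset sub0set setU0 inversions0l mul1r.
Qed.

Lemma pform_polyD p q : poly (p + q) = poly p + poly q.
Proof. exact: pmonoD. Qed.

Lemma pform_polyZ (k : K) p : poly (k *: p) = k *: poly p.
Proof. exact: pmonoZ. Qed.

Lemma pform_poly_mono S p q : poly p ⋏ pmono S q = pmono S (p * q).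
Proof.
by rewrite pform_polyE pmono_mul disjoints_subset sub0set set0U inversions0l mul1r.
Qed.

Lemma pform_mul_polyC p a : poly p ⋏ a = a ⋏ poly p.
Proof.
move: a; apply: pform_mono_ext => [x y|x y|S q]; rewrite ?(pform_mulDl, pform_mulDr) //.
rewrite pform_poly_mono pform_polyE pmono_mul disjoint_sym disjoints_subset sub0set setU0.
by rewrite inversions0r mul1r mulrC.
Qed.

Lemma pform_dt_mono i S p : dt i ⋏ pmono S p =
  if i \in S then 0 else pmono (i |: S) ((-1) ^+ below S i * p).
Proof.
rewrite pform_dtE pmono_mul disjoints1 inversions1l mul1r; by case: (i \in S).
Qed.

Lemma pform_dt_mulE i a U :
  (dt i ⋏ a) U = if i \in U then (-1) ^+ below (U :\ i) i * a (U :\ i) else 0.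
Proof.
rewrite ffunE; under eq_bigr => V _ do rewrite ffunE.
case: ifP => iU.
  rewrite (bigD1 [set i]) ?sub1set //= eqxx mul1r inversions1l big1 ?addr0 //.
  by move=> V /andP[_ /negPf->]; rewrite mul0r mulr0.
rewrite big1 // => V VU; case: eqP => [VE|]; last by rewrite mul0r mulr0.
by rewrite VE sub1set iU in VU.
Qed.

(** Polynomials and left multiplication by the [dt_i] generate all forms, since [dt_S] is rebuilt by
    prepending its smallest index. *)
Lemma pform_ind (P : pf -> Prop) : (forall a b, P a -> P b -> P (a + b)) ->
  (forall p, P (poly p)) -> (forall i a, P a -> P (dt i ⋏ a)) -> forall a, P a.
Proof.
move=> PD Pp Pdt a; rewrite (pmono_sum a).
have P0 : P 0 by rewrite -pform_poly0.
elim/big_ind: _ => // S _; move: (a S); elim/set_min_ind: S => [|i S iS imin IH] p.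
  exact: Pp.
have := Pdt i _ (IH p); rewrite pform_dt_mono (negPf iS) /below.
rewrite (_ : [set _ in _ | _] = set0) ?cards0 ?mul1r //.
apply/setP=> j; rewrite !inE; case jS: (j \in S) => //=.
by rewrite ltnNge ltnW // imin.
Qed.

Lemma pform_ind_mono (P : pf -> Prop) : (forall a b, P a -> P b -> P (a + b)) ->
  (forall (k : K) S m, P (k *: pmono S 'X_[m])) -> forall a, P a.
Proof.
move=> PD Pm a; rewrite (pmono_sum a).
have P0 : P 0 by have := Pm 0 set0 0%MM; rewrite scale0r.
elim/big_ind: _ => // S _; elim/mpolyind: (a S) => [|k m p _ _ Pp].
  by have := Pm 0 S 0%MM; rewrite -pmonoZ scale0r.
by rewrite pmonoD pmonoZ; apply: PD.
Qed.

Lemma pform_dt_anti i j : dt i ⋏ dt j = - (dt j ⋏ dt i).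
Proof.
rewrite !pform_dtE !pmono_mul !disjoints1 !inE !inversions1l !mulr1.
rewrite [j == i]eq_sym; case: eqVneq => [_|ij]; first by rewrite oppr0.
rewrite setUC /below; apply/ffunP=> U; rewrite !ffunE; case: ifP; rewrite ?oppr0 // => _.
have E (x y : 'I_N) : [set k in [set x] | (k < y)%N] = if (x < y)%N then [set x] else set0.
  apply/setP=> k; rewrite !inE; case: ifP => xy; rewrite !inE;
  by case: eqVneq => [->|].
rewrite !E; have: (i : nat) != j by [].
by case: ltngtP; rewrite ?cards1 ?cards0 ?opprK.
Qed.

Lemma pform_dt_sq i : dt i ⋏ dt i = 0.
Proof. by rewrite pform_dtE pmono_mul disjoints1 inE eqxx. Qed.

(** The parity involution. Used in place of Koszul signs, it lets the Leibniz and commutation rules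
    be stated for inhomogeneous forms. *)
Definition pform_sgn a : pf := [ffun S : {set 'I_N} => (-1) ^+ #|S| * a S].

Lemma pform_sgn_is_linear : linear pform_sgn.
Proof. by move=> k a b; apply/ffunP=> S; rewrite !ffunE mulrDr -scalerAr. Qed.

HB.instance Definition _ := GRing.isLinear.Build K pf pf *:%R pform_sgn
  pform_sgn_is_linear.

Lemma pform_sgnD a b : pform_sgn (a + b) = pform_sgn a + pform_sgn b.
Proof. exact: linearD. Qed.

Lemma pform_sgnB a b : pform_sgn (a - b) = pform_sgn a - pform_sgn b.
Proof. exact: linearB. Qed.

Lemma mpoly_signZ k p : (-1) ^+ k * p = (-1) ^+ k *: p.
Proof.
by elim: k => [|k IHk]; rewrite ?expr0 ?mul1r ?scale1r // !exprS -mulrA IHk mulN1r -scaleN1r scalerA.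
Qed.

Lemma pform_sgn_mono S p : pform_sgn (pmono S p) = (-1) ^+ #|S| *: pmono S p.
Proof.
apply/ffunP=> U; rewrite !ffunE; case: eqVneq => [->|]; last by rewrite mulr0 scaler0.
exact: mpoly_signZ.
Qed.

Lemma pform_sgn_poly p : pform_sgn (poly p) = poly p.
Proof. by rewrite pform_polyE pform_sgn_mono cards0 scale1r. Qed.

Lemma pform_sgn_dt i : pform_sgn (dt i) = - dt i.
Proof. by rewrite pform_dtE pform_sgn_mono cards1 scaleN1r. Qed.

Lemma pform_sgnK : involutive pform_sgn.
Proof. by move=> a; apply/ffunP=> S; rewrite !ffunE mulrA -expr2 sqrr_sign mul1r. Qed.

Lemma pform_sgnM a b : pform_sgn (a ⋏ b) = pform_sgn a ⋏ pform_sgn b.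
Proof.
move: a; apply: pform_mono_ext => [x y|x y|S p].
- by rewrite pform_mulDl linearD.
- by rewrite linearD pform_mulDl.
move: b; apply: pform_mono_ext => [x y|x y|T q].
- by rewrite pform_mulDr linearD.
- by rewrite linearD pform_mulDr.
rewrite !pform_sgn_mono pform_mulZl pform_mulZr pmono_mul scalerA.
case: ifP => dST; last by rewrite linear0 scaler0.
rewrite pform_sgn_mono cardsU -exprD; congr (_ ^+ _ *: _).
by move: dST; rewrite -setI_eq0 => /eqP->; rewrite cards0 subn0.
Qed.

Lemma pform_dt_comm i a : dt i ⋏ a = pform_sgn a ⋏ dt i.
Proof.
elim/pform_ind: a => [a b IHa IHb|p|j a IHa].
- by rewrite pform_mulDr IHa IHb linearD pform_mulDl.
- by rewrite pform_sgn_poly pform_mul_polyC.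
- rewrite pform_sgnM pform_sgn_dt -pform_mulA -IHa !pform_mulA pform_mulNl.
  by rewrite pform_dt_anti !pform_mulNl.
Qed.

Lemma pform_dE a : pform_d a = \sum_i dt i ⋏ [ffun S : {set 'I_N} => mderiv i (a S)].
Proof.
apply/ffunP=> U; rewrite ffunE sum_ffunE [LHS]big_mkcond; apply: eq_bigr => i _.
rewrite pform_dt_mulE ffunE; case: ifP => // iU; rewrite /below.
congr ((-1) ^+ #|pred_of_set _| * _); apply/setP=> j; rewrite !inE.
by case: eqVneq => [->|//]; rewrite ltnn andbF.
Qed.

Definition pderiv i a : pf := [ffun S : {set 'I_N} => mderiv i (a S)].

Lemma pderiv_is_linear i : linear (pderiv i).
Proof. by move=> k a b; apply/ffunP=> S; rewrite !ffunE linearP. Qed.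

HB.instance Definition _ i := GRing.isLinear.Build K pf pf *:%R (pderiv i)
  (pderiv_is_linear i).

Lemma pderiv_mono i S p : pderiv i (pmono S p) = pmono S (mderiv i p).
Proof. by apply/ffunP=> U; rewrite !ffunE; case: ifP; rewrite ?mderiv0. Qed.

Lemma mderiv_sign i k p : mderiv i ((-1) ^+ k * p) = (-1) ^+ k * mderiv i p.
Proof. by rewrite !mpoly_signZ mderivZ. Qed.

Lemma pderivM i a b : pderiv i (a ⋏ b) = pderiv i a ⋏ b + a ⋏ pderiv i b.
Proof.
apply/ffunP=> U; rewrite !ffunE raddf_sum -big_split; apply: eq_bigr => S _ /=.
by rewrite !ffunE mderiv_sign mderivM mulrDr.
Qed.

Lemma pderiv_dt_mul i j a : pderiv i (dt j ⋏ a) = dt j ⋏ pderiv i a.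
Proof.
rewrite pderivM pform_dtE pderiv_mono -mpolyC1 mderivC.
by rewrite pmono0 pform_mul0l add0r.
Qed.

Lemma pderiv_sgn i a : pderiv i (pform_sgn a) = pform_sgn (pderiv i a).
Proof. by apply/ffunP=> S; rewrite !ffunE mderiv_sign. Qed.

Lemma pform_d_sum a : pform_d a = \sum_i dt i ⋏ pderiv i a.
Proof. exact: pform_dE. Qed.

Lemma pform_d_is_linear : linear (@pform_d K n).
Proof.
move=> k a b; rewrite !pform_d_sum scaler_sumr -big_split; apply: eq_bigr => i _.
by rewrite linearP pform_mulDr pform_mulZr.
Qed.

HB.instance Definition _ := GRing.isLinear.Build K pf pf *:%R (@pform_d K n)
  pform_d_is_linear.

Lemma pform_dD a b : pform_d (a + b) = pform_d a + pform_d b.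
Proof. exact: linearD. Qed.

Lemma pform_d_sgn a : pform_d (pform_sgn a) = - pform_sgn (pform_d a).
Proof.
rewrite !pform_d_sum linear_sum -sumrN; apply: eq_bigr => i _ /=.
by rewrite pderiv_sgn pform_sgnM pform_sgn_dt pform_mulNl opprK.
Qed.

Lemma pform_dM a b : pform_d (a ⋏ b) = pform_d a ⋏ b + pform_sgn a ⋏ pform_d b.
Proof.
rewrite !pform_d_sum pform_mul_suml pform_mul_sumr -big_split; apply: eq_bigr => i _ /=.
by rewrite pderivM pform_mulDr !pform_mulA -(pform_dt_comm i a).
Qed.

Lemma pform_d_dt_mul i a : pform_d (dt i ⋏ a) = - (dt i ⋏ pform_d a).
Proof.
rewrite !pform_d_sum pform_mul_sumr -sumrN; apply: eq_bigr => j _ /=.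
by rewrite pderiv_dt_mul !pform_mulA pform_dt_anti pform_mulNl.
Qed.

(** Partial derivatives commute while the [dt_i] anticommute, so the double sum is alternating. *)
Lemma pform_dd a : pform_d (pform_d a) = 0.
Proof.
rewrite [pform_d a]pform_d_sum linear_sum /=.
under eq_bigr => i _ do rewrite pform_d_dt_mul pform_d_sum pform_mul_sumr.
rewrite sumrN sum_alternating ?oppr0 // => [i|i j]; first by rewrite pform_mulA pform_dt_sq pform_mul0l.
rewrite !pform_mulA (pform_dt_anti j i) pform_mulNl.
rewrite [pderiv j (pderiv i a)](_ : _ = pderiv i (pderiv j a)) ?addrN //.
by apply/ffunP=> S; rewrite !ffunE mderiv_comm.
Qed.

End PolynomialForms.

Lemma mpoly_alg_ind (n : nat) (K : fieldType) (P : {mpoly K[n]} -> Prop) :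
  (forall p q, P p -> P q -> P (p + q)) -> (forall p q, P p -> P q -> P (p * q)) ->
  (forall c, P c%:MP) -> (forall i, P 'X_i) -> forall p, P p.
Proof.
move=> PD PM PC PX; elim/mpolyind=> [|c m p _ _ Pp]; first by rewrite -mpolyC0.
apply: PD => //; rewrite -mul_mpolyC; apply: (PM) => //; rewrite mpolyXE_id.
apply: (big_ind P) => [||i _]; [by rewrite -mpolyC1|exact: PM|].
by elim: (m i) => [|k IHk]; rewrite ?expr0 -?mpolyC1 // exprS; apply: PM.
Qed.

Section Diff.
Context (K : fieldType) (n : nat).
Notation N := n.+1.
Notation poly := (@pform_poly K n).
Notation dt := (@pform_dt K n).

Lemma pform_d_poly p : pform_d (poly p) = \sum_i dt i ⋏ poly (mderiv i p).
Proof. by rewrite pform_d_sum; apply: eq_bigr => i _; rewrite pform_polyE pderiv_mono. Qed.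

Lemma pform_d_X i : pform_d (poly 'X_i) = dt i.
Proof.
rewrite pform_d_poly (bigD1 i) //= big1 => [|j ji]; last first.
  rewrite mderivX mnm1E eq_sym (negPf ji) scale0r.
  by rewrite pform_poly0 pform_mul0r.
rewrite mderivX mnm1E eqxx scale1r addr0 -{1}[U_(i)%MM]add0m addmK mpolyX0.
exact: pform_mul1r.
Qed.

Lemma pform_d_dt i : pform_d (dt i) = 0 :> pform K n.
Proof. by rewrite -pform_d_X pform_dd. Qed.

Lemma pform_d_polyC c : pform_d (poly c%:MP) = 0.
Proof.
rewrite pform_d_poly big1 // => i _; rewrite mderivC.
by rewrite pform_poly0 pform_mul0r.
Qed.

Lemma pform_dpoly_comm p a : pform_d (poly p) ⋏ a = pform_sgn a ⋏ pform_d (poly p).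
Proof.
rewrite pform_d_poly pform_mul_suml pform_mul_sumr; apply: eq_bigr => i _.
by rewrite -pform_mulA pform_mul_polyC pform_mulA pform_dt_comm -pform_mulA.
Qed.

Lemma pform_sgn_dpoly p : pform_sgn (pform_d (poly p)) = - pform_d (poly p).
Proof. by apply/eqP; rewrite -eqr_oppLR -pform_d_sgn pform_sgn_poly. Qed.

Lemma pform_dpoly_sq p : pform_d (poly p) ⋏ pform_d (poly p) = 0.
Proof.
rewrite {1}pform_d_poly pform_mul_suml.
under eq_bigr => i _ do rewrite pform_d_poly pform_mul_sumr.
have swap i j p1 p2 : (dt i ⋏ poly p1) ⋏ (dt j ⋏ poly p2) = dt i ⋏ dt j ⋏ poly (p1 * p2).
  rewrite -pform_mulA [poly p1 ⋏ _]pform_mulA pform_mul_polyC -[in RHS]pform_mulA.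
  by rewrite pform_polyM !pform_mulA.
apply: sum_alternating => [i|i j]; first by rewrite swap pform_dt_sq pform_mul0l.
by rewrite (swap i j) (swap j i) (pform_dt_anti _ i j) pform_mulNl mulrC addNr.
Qed.

End Diff.

(** * Substitution of polynomials as a morphism of dg algebras *)

Section Subst.
Context (K : fieldType) (m n : nat) (theta : 'I_m.+1 -> {mpoly K[n.+1]}).
Notation comp p := (p \mPo [tuple theta i | i < m.+1]).
Notation phi := (pform_subst theta).
Notation v i := (pform_d (pform_poly (theta i))).

Lemma comp_X i : comp 'X_i = theta i.
Proof. by rewrite comp_mpolyXU -tnth_nth tnth_mktuple. Qed.

Lemma pform_subst_is_linear : linear phi.
Proof.
move=> k a b; rewrite scaler_sumr -big_split; apply: eq_bigr => S _ /=.
by rewrite !ffunE linearP pform_polyD pform_polyZ pform_mulDl pform_mulZl.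
Qed.

HB.instance Definition _ := GRing.isLinear.Build K (pform K m) (pform K n) *:%R phi
  pform_subst_is_linear.

Lemma pform_substD a b : phi (a + b) = phi a + phi b.
Proof. exact: linearD. Qed.

Definition subst_dts (S : {set 'I_m.+1}) : pform K n :=
  \big[@pform_mul K n/pform_poly 1]_(i <- enum S) v i.

Lemma pform_subst_mono S p : phi (pmono S p) = pform_poly (comp p) ⋏ subst_dts S.
Proof.
rewrite /pform_subst (bigD1 S) //= [X in _ + X]big1 => [|T TS].
  by rewrite addr0 ffunE eqxx.
by rewrite ffunE (negPf TS) comp_mpoly0 pform_poly0 pform_mul0l.
Qed.

Lemma subst_dts0 : subst_dts set0 = pform_poly 1.
Proof. by rewrite /subst_dts enum_set0 big_nil. Qed.

Lemma subst_dtsU1 (i : 'I_m.+1) (S : {set 'I_m.+1}) : i \notin S -> {in S, forall j : 'I_m.+1, (i < j)%N} ->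
  subst_dts (i |: S) = v i ⋏ subst_dts S.
Proof. by move=> iS imin; rewrite /subst_dts enum_setU1_min // big_cons. Qed.

(** The differentials [v i] anticommute and square to zero as the [dt_i] do, so inserting one obeys
    the same signs. The multiplicativity of the substitution rests on this. *)
Lemma subst_dts_mul (i : 'I_m.+1) (S : {set 'I_m.+1}) : v i ⋏ subst_dts S =
  if i \in S then 0 else (-1) ^+ below S i *: subst_dts (i |: S).
Proof.
elim/set_min_ind: S => [|j S jS jmin IH].
  by rewrite inE below0 scale1r -subst_dtsU1 ?inE // => k; rewrite inE.
have [->|ij] := eqVneq i j.
  by rewrite setU11 subst_dtsU1 // pform_mulA pform_dpoly_sq pform_mul0l.
rewrite !inE (negPf ij) /= belowU1 //.
have: (i : nat) != j by [].
case: (ltngtP i j) => // [lij|lji] _.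
  have imin k : k \in j |: S -> (i < k)%N.
    rewrite !inE => /orP[/eqP->//|kS]; apply: (ltn_trans lij).
    exact: jmin kS.
  have -> : i \in S = false by apply: contraTF lij => /jmin; rewrite -leqNgt => /ltnW.
  have iS : i \notin j |: S by apply/negP => /imin; rewrite ltnn.
  rewrite add0n /below (_ : [set _ in _ | _] = set0) ?cards0 ?scale1r ?(subst_dtsU1 iS) //.
  apply/setP=> k; rewrite !inE; apply/negP => /andP[kS ki].
  by have := imin k; rewrite !inE kS orbT ltnNge ltnW // => /(_ isT).
(* Here j < i: [v i] passes the leading factor [v j], which costs one sign, and is then inserted
   into the rest by induction. *)
rewrite subst_dtsU1 // pform_mulA pform_dpoly_comm pform_sgn_dpoly !pform_mulNl.
rewrite -pform_mulA IH; case: ifP => iS; first by rewrite pform_mul0r oppr0.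
rewrite setUCA [subst_dts (j |: _)]subst_dtsU1; last 2 first.
- by rewrite !inE negb_or eq_sym ij.
- by move=> k; rewrite !inE => /predU1P[->//|/jmin].
by rewrite pform_mulZr -scaleNr exprS mulN1r.
Qed.

Lemma pform_subst_dt_mul i a : phi (pform_dt K i ⋏ a) = v i ⋏ phi a.
Proof.
move: a; apply: pform_mono_ext => [x y|x y|S p].
- by rewrite pform_mulDr pform_substD.
- by rewrite pform_substD pform_mulDr.
rewrite pform_dt_mono pform_subst_mono pform_mulA -pform_mul_polyC -pform_mulA subst_dts_mul.
case: ifP => iS; first by rewrite linear0 pform_mul0r.
by rewrite pform_subst_mono mpoly_signZ comp_mpolyZ pform_polyZ pform_mulZl pform_mulZr.
Qed.

Lemma pform_subst_poly p : phi (pform_poly p) = pform_poly (comp p).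
Proof. by rewrite pform_polyE pform_subst_mono subst_dts0 pform_mul1r. Qed.

Lemma pform_subst_polyC c : phi (pform_poly c%:MP) = pform_poly c%:MP.
Proof. by rewrite pform_subst_poly comp_mpolyC. Qed.

Lemma pform_subst_dt i : phi (pform_dt K i) = v i.
Proof.
by rewrite -[pform_dt K i]pform_mul1r pform_subst_dt_mul pform_subst_poly comp_mpoly1 pform_mul1r.
Qed.

Lemma pform_substM a b : phi (a ⋏ b) = phi a ⋏ phi b.
Proof.
elim/pform_ind: a => [x y IHx IHy|p|i x IHx].
- by rewrite pform_mulDl !pform_substD IHx IHy pform_mulDl.
- move: b; apply: pform_mono_ext => [x y|x y|S q].
  + by rewrite pform_mulDr pform_substD.
  + by rewrite pform_substD pform_mulDr.
  rewrite pform_poly_mono pform_subst_poly !pform_subst_mono rmorphM pform_polyM.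
  by rewrite pform_mulA.
- by rewrite -pform_mulA !pform_subst_dt_mul IHx pform_mulA.
Qed.

Lemma pform_subst_d a : phi (pform_d a) = pform_d (phi a).
Proof.
elim/pform_ind: a => [x y IHx IHy|p|i x IHx].
- by rewrite !(pform_dD, pform_substD, pform_sgnD) IHx IHy.
- rewrite pform_subst_poly; elim/mpoly_alg_ind: p => [p q IHp IHq|p q IHp IHq|c|i].
  + by rewrite comp_mpolyD !pform_polyD !(pform_dD, pform_substD) IHp IHq.
  + rewrite rmorphM !pform_polyM !pform_dM linearD /= !pform_substM IHp IHq.
    by rewrite !pform_sgn_poly !pform_subst_poly.
  + by rewrite comp_mpolyC !pform_d_polyC linear0.
  + by rewrite pform_d_X pform_subst_dt comp_X.
- rewrite pform_d_dt_mul linearN /= !pform_subst_dt_mul IHx pform_dM pform_dd pform_mul0l.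
  by rewrite add0r pform_sgn_dpoly pform_mulNl.
Qed.

Lemma pform_subst_sgn a : phi (pform_sgn a) = pform_sgn (phi a).
Proof.
elim/pform_ind: a => [x y IHx IHy|p|i x IHx].
- by rewrite !(pform_dD, pform_substD, pform_sgnD) IHx IHy.
- by rewrite pform_subst_poly !pform_sgn_poly pform_subst_poly.
- by rewrite pform_sgnM pform_sgn_dt pform_mulNl linearN /= !pform_subst_dt_mul IHx
    pform_sgnM pform_sgn_dpoly pform_mulNl.
Qed.

End Subst.

Lemma comp_mpolyA (K : fieldType) (l m n : nat) (eta : 'I_l -> {mpoly K[m]})
    (theta : 'I_m -> {mpoly K[n]}) p :
  (p \mPo [tuple eta i | i < l]) \mPo [tuple theta i | i < m] =
  p \mPo [tuple eta i \mPo [tuple theta i | i < m] | i < l].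
Proof.
elim/mpoly_alg_ind: p => [p q IHp IHq|p q IHp IHq|c|i].
- by rewrite !rmorphD /= IHp IHq.
- by rewrite !rmorphM /= IHp IHq.
- by rewrite !comp_mpolyC.
- by rewrite !comp_mpolyXU -!tnth_nth !tnth_mktuple.
Qed.

Lemma pform_subst_comp (K : fieldType) (l m n : nat) (eta : 'I_l.+1 -> {mpoly K[m.+1]})
    (theta : 'I_m.+1 -> {mpoly K[n.+1]}) a :
  pform_subst theta (pform_subst eta a) =
  pform_subst (fun i => eta i \mPo [tuple theta i | i < m.+1]) a.
Proof.
elim/pform_ind: a => [x y IHx IHy|p|i x IHx].
- transitivity (pform_subst theta (pform_subst eta x + pform_subst eta y)).
    by congr pform_subst; exact: pform_substD.
  by rewrite [LHS]pform_substD; exact: etrans (congr2 +%R IHx IHy) (esym (pform_substD _ _ _)).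
- by rewrite !pform_subst_poly comp_mpolyA.
- by rewrite (pform_subst_dt_mul eta) (pform_subst_dt_mul (fun _ => _)) pform_substM -IHx
    pform_subst_d (pform_subst_poly theta).
Qed.

Lemma eq_pform_subst (K : fieldType) (m n : nat) (eta theta : 'I_m.+1 -> {mpoly K[n.+1]}) a :
  eta =1 theta -> pform_subst eta a = pform_subst theta a.
Proof. by move=> /funext->. Qed.

Lemma pform_subst_id (K : fieldType) (n : nat) (a : pform K n) :
  pform_subst (fun i => 'X_i) a = a.
Proof.
elim/pform_ind: a => [x y IHx IHy|p|i x IHx].
- by rewrite !pform_substD IHx IHy.
- by rewrite pform_subst_poly comp_mpoly_id.
- by rewrite pform_subst_dt_mul IHx pform_d_X.
Qed.

(** * The Euler homotopy *)

Section Euler.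
Context (K : fieldType) (n : nat).
Notation N := n.+1.
Notation pf := (pform K n).
Notation poly := (@pform_poly K n).
Notation dt := (@pform_dt K n).
Implicit Types (S T U : {set 'I_N}) (i j : 'I_N) (p q : {mpoly K[N]}) (a b c : pf).

(** Interior product with the coordinate vector field d/dt_i. *)
Definition dt_contract i a : pf :=
  [ffun U : {set 'I_N} => if i \in U then 0 else (-1) ^+ below U i * a (i |: U)].

Lemma addfE a b U : (a + b) U = a U + b U.
Proof. by rewrite ffunE. Qed.

Lemma oppfE a U : (- a) U = - a U.
Proof. by rewrite ffunE. Qed.

Lemma dt_contractE i a U : dt_contract i a U = if i \in U then 0 else (-1) ^+ below U i * a (i |: U).
Proof. by rewrite ffunE. Qed.

Lemma dt_contract_is_linear i : linear (dt_contract i).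
Proof.
move=> k a b; apply/ffunP=> U; rewrite !ffunE; case: ifP => _.
  by rewrite scaler0 addr0.
by rewrite mulrDr -scalerAr.
Qed.

HB.instance Definition _ i := GRing.isLinear.Build K pf pf *:%R (dt_contract i)
  (dt_contract_is_linear i).

Lemma dt_contract_poly i p : dt_contract i (poly p) = 0.
Proof.
apply/ffunP=> U; rewrite !ffunE; case: ifP => // _.
by rewrite -subset0 subUset sub1set inE /= mulr0.
Qed.

Lemma dt_contract_dt_mul i j a :
  dt_contract i (dt j ⋏ a) = (if i == j then a else 0) - dt j ⋏ dt_contract i a.
Proof.
apply/ffunP=> U; rewrite addfE oppfE dt_contractE.
rewrite !pform_dt_mulE !inE [j == i]eq_sym.
case: eqVneq => [<-|ij] /=.
  rewrite dt_contractE.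
  case: ifP => iU.
    by rewrite setD11 setD1K // mulrA -expr2 sqrr_sign mul1r subrr.
  by rewrite mulrA setU1K ?iU // -expr2 sqrr_sign mul1r subr0.
rewrite dt_contractE !inE ij ffunE sub0r.
case: (boolP (j \in U)) => jU; last by case: ifP; rewrite ?mulr0 oppr0.
case: (boolP (i \in U)) => iU; first by rewrite mulr0 oppr0.
have Dij : (i |: U) :\ j = i |: (U :\ j).
  by apply/setP=> k; rewrite !inE; case: (eqVneq k i) => [->|//]; rewrite ij.
have iUj : i \notin U :\ j by rewrite !inE negb_and iU orbT.
rewrite Dij -[in below U i](setD1K jU) !belowU1 ?setD11 //.
have: (i : nat) != j by [].
case: ltngtP => // _ _; rewrite /= ?add0n ?add1n ?exprS; ring.
Qed.

(** Interior product with the Euler field, the sum of the t_i d/dt_i. *)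
Definition piota a : pf := \sum_i poly 'X_i ⋏ dt_contract i a.

Lemma piota_is_linear : linear piota.
Proof.
move=> k a b; rewrite scaler_sumr -big_split; apply: eq_bigr => i _ /=.
by rewrite linearP pform_mulDr pform_mulZr.
Qed.

HB.instance Definition _ := GRing.isLinear.Build K pf pf *:%R piota piota_is_linear.

Lemma piotaD a b : piota (a + b) = piota a + piota b.
Proof. exact: linearD. Qed.

Lemma piota_poly p : piota (poly p) = 0.
Proof. by rewrite /piota big1 // => i _; rewrite dt_contract_poly pform_mul0r. Qed.

Lemma piota_dt_mul j a : piota (dt j ⋏ a) = poly 'X_j ⋏ a - dt j ⋏ piota a.
Proof.
rewrite /piota pform_mul_sumr; under eq_bigr => i _ do rewrite dt_contract_dt_mul pform_mulDr.
rewrite big_split /= (bigD1 j) //= eqxx [X in _ + X + _]big1 => [|i /negPf->]; last first.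
  by rewrite pform_mul0r.
rewrite addr0 -sumrN; congr (_ + _); apply: eq_bigr => i _.
by rewrite pform_mulNr !pform_mulA pform_mul_polyC.
Qed.

Lemma piota_polyM p a : piota (poly p ⋏ a) = poly p ⋏ piota a.
Proof.
rewrite pform_mul_polyC; elim/pform_ind: a => [x y IHx IHy|q|i x IHx].
- by rewrite pform_mulDl !piotaD IHx IHy pform_mulDr.
- by rewrite -pform_polyM !piota_poly pform_mul0r.
- rewrite -pform_mulA !piota_dt_mul IHx pform_mulDr pform_mulNr.
  by rewrite !(pform_mul_polyC p) -!pform_mulA.
Qed.

Lemma piotaM a b : piota (a ⋏ b) = piota a ⋏ b + pform_sgn a ⋏ piota b.
Proof.
elim/pform_ind: a => [x y IHx IHy|p|i x IHx].
- by rewrite pform_mulDl !piotaD pform_sgnD IHx IHy !pform_mulDl addrACA.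
- by rewrite piota_polyM piota_poly pform_mul0l add0r pform_sgn_poly.
- rewrite -pform_mulA !piota_dt_mul IHx pform_sgnM pform_sgn_dt.
  by rewrite pform_mulDr pform_mulDl !pform_mulNl !pform_mulA opprD addrA.
Qed.

Lemma piota_dt i : piota (dt i) = poly 'X_i.
Proof. by rewrite -[dt i]pform_mul1r piota_dt_mul piota_poly pform_mul0r subr0 pform_mul1r. Qed.

(** Cartan's formula for the Lie derivative along the Euler field. *)
Definition pweight a : pf := pform_d (piota a) + piota (pform_d a).

Lemma pweight_is_linear : linear pweight.
Proof. by move=> k a b; rewrite /pweight !linearP /= scalerDr addrACA. Qed.

HB.instance Definition _ := GRing.isLinear.Build K pf pf *:%R pweight pweight_is_linear.

Lemma pweightD a b : pweight (a + b) = pweight a + pweight b.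
Proof. exact: linearD. Qed.

Lemma pweight_d a : pweight (pform_d a) = pform_d (pweight a).
Proof. by rewrite /pweight pform_dd linear0 addr0 linearD /= pform_dd add0r. Qed.

Lemma piota_sgn a : piota (pform_sgn a) = - pform_sgn (piota a).
Proof.
elim/pform_ind: a => [x y IHx IHy|p|i x IHx].
- by rewrite !(pform_sgnD, piotaD) IHx IHy opprD.
- by rewrite pform_sgn_poly piota_poly linear0 oppr0.
- rewrite pform_sgnM pform_sgn_dt pform_mulNl linearN /= !piota_dt_mul IHx.
  by rewrite pform_sgnB !pform_sgnM pform_sgn_dt pform_sgn_poly pform_mulNl pform_mulNr.
Qed.

(** The operators [piota] and [pform_d] are odd derivations. Of the eight terms, four make up the
    right-hand side and the mixed ones cancel in pairs. *)
Lemma pweightM a b : pweight (a ⋏ b) = pweight a ⋏ b + a ⋏ pweight b.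
Proof.
rewrite /pweight piotaM pform_dM pform_dD piotaD !pform_dM !piotaM.
rewrite pform_sgnK pform_d_sgn piota_sgn !pform_mulDl !pform_mulDr !pform_mulNl.
by rewrite [LHS](AC ((2*2)*(2*2)) (((1*5)*(4*8))*((2*7)*(3*6)))) /= subrr addNr !addr0.
Qed.

Lemma pweight_dt_mul i a : pweight (dt i ⋏ a) = dt i ⋏ a + dt i ⋏ pweight a.
Proof.
by rewrite pweightM {1}/pweight pform_d_dt linear0 addr0 piota_dt pform_d_X.
Qed.

Lemma pweight_poly_X m : pweight (poly 'X_[m]) = (mdeg m)%:R *: poly 'X_[m].
Proof.
have WX i : pweight (poly 'X_i) = poly 'X_i.
  by rewrite /pweight piota_poly linear0 add0r pform_d_X piota_dt.
have W1 : pweight (poly 1) = 0.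
  by rewrite /pweight piota_poly linear0 add0r -mpolyC1 pform_d_polyC linear0.
have Wn i k : pweight (poly ('X_i ^+ k)) = k%:R *: poly ('X_i ^+ k).
  elim: k => [|k IHk]; first by rewrite expr0 W1 scale0r.
  by rewrite exprS pform_polyM pweightM WX IHk pform_mulZr mulrS scalerDl scale1r.
have step (r : seq 'I_N) : pweight (poly (\prod_(i <- r) 'X_i ^+ m i)) =
    (\sum_(i <- r) m i)%N%:R *: poly (\prod_(i <- r) 'X_i ^+ m i).
  elim: r => [|i r IHr]; first by rewrite !big_nil W1 scale0r.
  rewrite !big_cons pform_polyM pweightM Wn IHr pform_mulZl pform_mulZr.
  by rewrite -scalerDl natrD.
by rewrite mpolyXE_id mdegE step.
Qed.

(** Every coordinate and every differential counts once, so the monomials diagonalise the Lie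
    derivative. *)
Lemma pweight_mono S m : pweight (pmono S 'X_[m]) = (mdeg m + #|S|)%N%:R *: pmono S 'X_[m].
Proof.
elim/set_min_ind: S => [|i S iS imin IH].
  by rewrite -pform_polyE pweight_poly_X cards0 addn0.
have E : pmono (i |: S) 'X_[m] = dt i ⋏ pmono S 'X_[m].
  rewrite pform_dt_mono (negPf iS) /below (_ : [set _ in _ | _] = set0) ?cards0 ?mul1r //.
  apply/setP=> j; rewrite !inE; apply/negP => /andP[/imin ij ji].
  by have := ltn_trans ij ji; rewrite ltnn.
rewrite E pweight_dt_mul IH pform_mulZr cardsU1 iS addnCA -[X in X + _]scale1r.
by rewrite -scalerDl -[1]/(1%:R) -natrD.
Qed.

(* In weight 0 the factor is the junk value 0^-1 = 0. *)
Definition wdiv (k : nat) p : {mpoly K[N]} :=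
  \sum_(m <- msupp p) ((mdeg m + k)%:R^-1 * p@_m) *: 'X_[m].

Lemma mcoeff_wdiv k p m : (wdiv k p)@_m = (mdeg m + k)%:R^-1 * p@_m.
Proof.
rewrite /wdiv raddf_sum /=; under eq_bigr => l _ do rewrite mcoeffZ mcoeffX.
have [mp|mp] := boolP (m \in msupp p).
  rewrite (bigD1_seq m) ?msupp_uniq //= eqxx mulr1 big1 ?addr0 // => l /negPf->.
  by rewrite mulr0.
rewrite big_seq big1 => [|l lp]; first by rewrite (memN_msupp_eq0 mp) mulr0.
by case: eqVneq mp => [<-|]; rewrite ?lp ?mulr0.
Qed.

Definition pwdiv a : pf := [ffun S : {set 'I_N} => wdiv #|S| (a S)].

Lemma pwdiv_is_linear : linear pwdiv.
Proof.
move=> k a b; apply/ffunP=> S; rewrite !ffunE; apply/mpolyP=> m.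
by rewrite mcoeffD mcoeffZ !mcoeff_wdiv mcoeffD mcoeffZ mulrDr mulrCA.
Qed.

HB.instance Definition _ := GRing.isLinear.Build K pf pf *:%R pwdiv pwdiv_is_linear.

Lemma mcoeff_pweight a S m : (pweight a S)@_m = (mdeg m + #|S|)%N%:R * (a S)@_m.
Proof.
elim/pform_ind_mono: a => [a b IHa IHb|k T l].
  have E x y : ((x + y : pf) S)@_m = (x S)@_m + (y S)@_m by rewrite addfE mcoeffD.
  rewrite pweightD [LHS]E [X in _ = _ * X]E mulrDr; exact: congr2 IHa IHb.
rewrite linearZ /= pweight_mono !ffunE; case: eqVneq => [->|_]; last first.
  by rewrite !scaler0 mcoeff0 mulr0.
rewrite !mcoeffZ mcoeffX; case: eqVneq => [->|_]; rewrite ?mulr0 ?mulr1 //.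
exact: mulrC.
Qed.

(** A monomial with nonzero coefficient in an eigenvector has its weight equal to k in the field, so
    the division is by k throughout. The convention 0^-1 = 0 is the same on both sides. *)
Lemma pwdiv_eigen (k : K) a : pweight a = k *: a -> pwdiv a = k^-1 *: a.
Proof.
move=> Wa; apply/ffunP=> S; rewrite !ffunE; apply/mpolyP=> m.
rewrite mcoeff_wdiv mcoeffZ; have [->|anz] := eqVneq ((a S)@_m) 0; first by rewrite !mulr0.
congr (_^-1 * _); apply: (mulIf anz); rewrite -mcoeff_pweight Wa.
by rewrite ffunE mcoeffZ.
Qed.

(** The value at the origin: in characteristic 0 this is the whole part of weight 0, which [pwdiv]
    cannot recover. *)
Definition pconst a : pf := poly (mcoeff 0%MM (a set0))%:MP.

Lemma pconstD a b : pconst (a + b) = pconst a + pconst b.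
Proof. by rewrite /pconst addfE mcoeffD mpolyCD pform_polyD. Qed.

Lemma pweight_pwdiv (charK : [pchar K] =i pred0) a : pweight (pwdiv a) = a - pconst a.
Proof.
apply/ffunP=> S; apply/mpolyP=> m; rewrite mcoeff_pweight addfE oppfE mcoeffB ffunE.
rewrite mcoeff_wdiv ffunE; case: eqVneq => [->|S0].
  rewrite cards0 addn0 mcoeffC; have [->|m0] := eqVneq m 0%MM.
    by rewrite mdeg0 mul0r mulr1 subrr.
  rewrite mulr0 subr0 mulVKf //.
  by rewrite (pcharf0P _).1 // mdeg_eq0.
rewrite mcoeff0 subr0 mulVKf //.
by rewrite (pcharf0P _).1 // addn_eq0 cards_eq0 (negPf S0) andbF.
Qed.

End Euler.

Section Commutation.
Context (K : fieldType) (m n : nat) (T : pform K m -> pform K n) (T_lin : linear T).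

(** Monomials are eigenvectors of the weight, and a map commuting with the weight preserves the
    eigenvalue by which [pwdiv] divides. *)
Lemma pwdiv_comm : (forall a, pweight (T a) = T (pweight a)) ->
  forall a, pwdiv (T a) = T (pwdiv a).
Proof.
move=> TW; have TD a b : T (a + b) = T a + T b by rewrite -[a]scale1r T_lin !scale1r.
elim/pform_ind_mono => [a b IHa IHb|k S l].
  by rewrite linearD /= !TD linearD /= IHa IHb.
rewrite linearZ /= !(linZ T_lin) linearZ /=; congr (_ *: _).
rewrite (pwdiv_eigen (pweight_mono K S l)) (linZ T_lin).
by apply: pwdiv_eigen; rewrite TW pweight_mono (linZ T_lin).
Qed.

End Commutation.

(** The hypothesis says that the Euler field fixes every [theta i], as it fixes linear forms; the
    substitution is then compatible with the Euler fields on both sides. *)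
Lemma piota_subst (K : fieldType) (m n : nat) (theta : 'I_m.+1 -> {mpoly K[n.+1]}) a :
  (forall i, piota (pform_d (pform_poly (theta i))) = pform_poly (theta i)) ->
  piota (pform_subst theta a) = pform_subst theta (piota a).
Proof.
move=> thetaE; elim/pform_ind: a => [x y IHx IHy|p|i x IHx].
- rewrite pform_substD [LHS]piotaD [X in _ = pform_subst _ X]piotaD [RHS]pform_substD.
  exact: (congr2 +%R IHx IHy).
- by rewrite pform_subst_poly !piota_poly linear0.
- rewrite pform_subst_dt_mul piotaM piota_dt_mul IHx thetaE pform_sgn_dpoly.
  rewrite [RHS]linearB /= pform_subst_dt_mul pform_substM pform_subst_poly comp_X.
  by rewrite pform_mulNl.
Qed.

Lemma pweight_subst (K : fieldType) (m n : nat) (theta : 'I_m.+1 -> {mpoly K[n.+1]}) a :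
  (forall i, piota (pform_d (pform_poly (theta i))) = pform_poly (theta i)) ->
  pweight (pform_subst theta a) = pform_subst theta (pweight a).
Proof.
move=> thetaE; rewrite /pweight [RHS]pform_substD; congr (_ + _).
  by rewrite piota_subst // pform_subst_d.
by rewrite -pform_subst_d piota_subst.
Qed.

(** The homotopy of the Poincaré lemma for the contraction to the origin, in its algebraic form. *)
Definition pradial (K : fieldType) n (a : pform K n) : pform K n := piota (pwdiv a).

Lemma pradial_is_linear (K : fieldType) n : linear (@pradial K n).
Proof. move=> k a b; rewrite /pradial -[RHS]linearP; congr piota; exact: linearP. Qed.

Lemma pradialP (K : fieldType) (charK : [pchar K] =i pred0) n (a : pform K n) :
  pform_d (pradial a) + pradial (pform_d a) = a - pconst a.
Proof.
rewrite /pradial (pwdiv_comm (@pform_d_is_linear K n) (@pweight_d K n)).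
exact: pweight_pwdiv.
Qed.

Lemma pradial_subst (K : fieldType) (m n : nat) (theta : 'I_m.+1 -> {mpoly K[n.+1]}) a :
  (forall i, piota (pform_d (pform_poly (theta i))) = pform_poly (theta i)) ->
  pradial (pform_subst theta a) = pform_subst theta (pradial a).
Proof.
move=> thetaE; rewrite /pradial (pwdiv_comm (pform_subst_is_linear theta)) ?piota_subst //.
by move=> b; rewrite pweight_subst.
Qed.

(** * Forms on the simplex *)

Section SpanMap.
Context (K : fieldType).

Lemma span_map (U V : lmodType K) (F : U -> V) (G : U -> Prop) (H : V -> Prop) :
  linear F -> (forall x, G x -> span H (F x)) -> forall x, span G x -> span H (F x).
Proof.
move=> FL FG x; elim=> [|//|c y z _ IHy _ IHz]; first by rewrite lin0 //; apply: span_0.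
by rewrite FL; apply: span_lin.
Qed.

Lemma spanN (V : lmodType K) (G : V -> Prop) x : span G x -> span G (- x).
Proof. by move=> gx; rewrite -scaleN1r; apply: spanZ. Qed.

Lemma span_sum (V : lmodType K) (G : V -> Prop) I (r : seq I) (Q : pred I) (F : I -> V) :
  (forall i, Q i -> span G (F i)) -> span G (\sum_(i <- r | Q i) F i).
Proof. by move=> GF; apply: big_ind => //; [apply: span_0|apply: spanD]. Qed.

End SpanMap.

(** * Degrees of polynomial forms and graded commutativity *)

Section Homogeneous.
Context (K : fieldType) (n : nat).
Notation N := n.+1.
Notation pf := (pform K n).
Notation poly := (@pform_poly K n).
Notation dt := (@pform_dt K n).
Implicit Types (S T U : {set 'I_N}) (i j : 'I_N) (q : {mpoly K[N]}) (a b c : pf) (p : int).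

Lemma pform_pr_is_linear p : linear (@pform_pr K n p).
Proof.
move=> k a b; apply/ffunP=> S; rewrite !ffunE; case: ifP => // _.
by rewrite scaler0 addr0.
Qed.

HB.instance Definition _ p := GRing.isLinear.Build K pf pf *:%R (@pform_pr K n p)
  (pform_pr_is_linear p).

Lemma pform_prD p a b : pform_pr p (a + b) = pform_pr p a + pform_pr p b.
Proof. exact: linearD. Qed.

Lemma pform_prZ p (k : K) a : pform_pr p (k *: a) = k *: pform_pr p a.
Proof. exact: linearZ. Qed.

Lemma pform_pr_mono p S q : pform_pr p (pmono S q) = if (#|S| : int) == p then pmono S q else 0.
Proof.
apply/ffunP=> U; rewrite !ffunE; have [->|US] := eqVneq U S.
  by case: ifP; rewrite ffunE ?eqxx.
by case: ifP; case: ifP => _; rewrite ffunE ?(negPf US).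
Qed.

Lemma pform_pr_pr p p' a : pform_pr p (pform_pr p' a) = if p == p' then pform_pr p' a else 0.
Proof.
apply/ffunP=> S; have [->|pp'] := eqVneq p p'; rewrite !ffunE; first by case: ifP => // ->.
by case: (eqVneq (Posz #|S|) p) => // ->; rewrite (negPf pp').
Qed.

Lemma pform_pr_sum a : a = \sum_(0 <= k < N.+1) pform_pr k a.
Proof.
apply/ffunP=> S; rewrite sum_ffunE (bigD1_seq #|S|) ?iota_uniq //=; last first.
  by rewrite mem_index_iota ltnS /= -[X in (_ <= X)%N](card_ord N) max_card.
rewrite ffunE eqxx big1 ?addr0 // => k; rewrite ffunE eqz_nat eq_sym => /negPf->.
by [].
Qed.

Definition phom p a := pform_pr p a = a.

Lemma phom_mono S q : phom #|S| (pmono S q).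
Proof. by rewrite /phom pform_pr_mono eqxx. Qed.

Lemma phom0 p : phom p 0.
Proof. exact: linear0. Qed.

Lemma phomD p a b : phom p a -> phom p b -> phom p (a + b).
Proof. by move=> ha hb; rewrite /phom pform_prD ha hb. Qed.

Lemma phomZ p (k : K) a : phom p a -> phom p (k *: a).
Proof. by move=> ha; rewrite /phom pform_prZ ha. Qed.

Lemma phomN p a : phom p a -> phom p (- a).
Proof. by move=> ha; rewrite -scaleN1r; apply: phomZ. Qed.

Lemma phom_sum p I (r : seq I) (Q : pred I) (F : I -> pf) :
  (forall x, Q x -> phom p (F x)) -> phom p (\sum_(x <- r | Q x) F x).
Proof. by move=> hF; apply: big_ind => //; [apply: phom0|apply: phomD]. Qed.

Lemma phomE p a : phom p a -> a = \sum_(S : {set 'I_N} | (#|S| : int) == p) pmono S (a S).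
Proof.
move=> <-; rewrite [LHS]pmono_sum [RHS]big_mkcond; apply: eq_bigr => S _ /=.
rewrite ffunE; case: ifP => //= _; by apply/ffunP=> U; rewrite !ffunE; case: ifP.
Qed.

Lemma phom_ind p (P : pf -> Prop) : P 0 -> (forall a b, P a -> P b -> P (a + b)) ->
  (forall S q, (#|S| : int) = p -> P (pmono S q)) -> forall a, phom p a -> P a.
Proof. by move=> P0 PD Pm a /phomE->; apply: big_ind => // S /eqP; apply: Pm. Qed.

Lemma phomM p p' a b : phom p a -> phom p' b -> phom (p + p') (a ⋏ b).
Proof.
move=> ha hb; move: a ha; apply: phom_ind => [|x y hx hy|S q Sp].
- by rewrite pform_mul0l; apply: phom0.
- by rewrite pform_mulDl; apply: phomD.
move: b hb; apply: phom_ind => [|x y hx hy|T q' Tp].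
- by rewrite pform_mul0r; apply: phom0.
- by rewrite pform_mulDr; apply: phomD.
rewrite pmono_mul; case: ifP => [dST|_]; last exact: phom0.
have := phom_mono (S :|: T) ((-1) ^+ inversions S T * (q * q')).
move: dST; rewrite -setI_eq0 => /eqP dST.
by rewrite cardsU dST cards0 subn0 PoszD Sp Tp.
Qed.

Lemma phom_poly q : phom 0 (poly q).
Proof. by have := phom_mono set0 q; rewrite cards0. Qed.

Lemma phom_dt i : phom 1 (dt i).
Proof. by have := phom_mono [set i] 1; rewrite cards1. Qed.

Lemma phom_d p a : phom p a -> phom (p + 1) (pform_d a).
Proof.
move: a; apply: phom_ind => [|x y hx hy|S q Sp].
- by rewrite linear0; apply: phom0.
- by rewrite pform_dD; apply: phomD.
rewrite pform_d_sum; apply: phom_sum => i _; rewrite addrC pderiv_mono.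
by apply: phomM (phom_dt i) _; rewrite -Sp; apply: phom_mono.
Qed.

Lemma sgnz_nat (k : nat) : sgnz K k = (-1) ^+ k.
Proof. by []. Qed.

Lemma sgnzD (p p' : int) : sgnz K (p + p') = sgnz K p * sgnz K p'.
Proof.
by rewrite /sgnz expfzDr // oppr_eq0 oner_eq0.
Qed.

Lemma phom_sgn p a : phom p a -> pform_sgn a = sgnz K p *: a.
Proof.
move: a; apply: phom_ind => [|x y hx hy|S q Sp].
- by rewrite linear0 scaler0.
- by rewrite pform_sgnD hx hy scalerDr.
by rewrite pform_sgn_mono -Sp.
Qed.

Lemma phomC p p' a b : phom p a -> phom p' b -> a ⋏ b = sgnz K (p * p') *: (b ⋏ a).
Proof.
move=> ha hb; move: a ha; apply: phom_ind => [|x y hx hy|S q Sp].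
- by rewrite pform_mul0l pform_mul0r scaler0.
- by rewrite pform_mulDl pform_mulDr hx hy scalerDr.
move: b hb; apply: phom_ind => [|x y hx hy|T q' Tp].
- by rewrite pform_mul0l pform_mul0r scaler0.
- by rewrite pform_mulDl pform_mulDr hx hy scalerDr.
rewrite !pmono_mul disjoint_sym; case: ifP => dST; last by rewrite scaler0.
rewrite setUC !mpoly_signZ !pmonoZ scalerA [q * _]mulrC; congr (_ *: _).
rewrite -Sp -Tp -PoszM sgnz_nat -inversions_sym 1?disjoint_sym // exprD -mulrA -expr2 sqrr_sign.
by rewrite mulr1.
Qed.

End Homogeneous.

Section HomogeneousOps.
Context (K : fieldType) (m n : nat) (theta : 'I_m.+1 -> {mpoly K[n.+1]}).

Lemma phom_subst_dts (S : {set 'I_m.+1}) : phom #|S| (subst_dts theta S).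
Proof.
elim/set_min_ind: S => [|i S iS imin IH]; first by rewrite subst_dts0 cards0; apply: phom_poly.
rewrite subst_dtsU1 // cardsU1 iS PoszD; apply: phomM IH.
exact: (@phom_d _ _ 0 _ (phom_poly _)).
Qed.

Lemma phom_subst p a : phom p a -> phom p (pform_subst theta a).
Proof.
move: a; apply: phom_ind => [|x y hx hy|S q Sp].
- by rewrite linear0; apply: phom0.
- by rewrite pform_substD; apply: phomD.
rewrite pform_subst_mono -[p]add0r; apply: phomM (phom_poly _) _.
by rewrite -Sp; apply: phom_subst_dts.
Qed.

Lemma pform_pr_subst p a : pform_pr p (pform_subst theta a) = pform_subst theta (pform_pr p a).
Proof.
move: a; apply: pform_mono_ext => [x y|x y|S q].
- by rewrite pform_substD pform_prD.
- by rewrite pform_prD pform_substD.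
have hS : phom #|S| (pform_subst theta (pmono S q)) by apply/phom_subst/phom_mono.
by rewrite -[in LHS]hS pform_pr_pr hS pform_pr_mono eq_sym; case: ifP; rewrite ?linear0.
Qed.

Lemma phom_piota p (a : pform K m) : phom p a -> phom (p - 1) (piota a).
Proof.
move: a; apply: phom_ind => [|x y hx hy|S q].
- by rewrite linear0; apply: phom0.
- by rewrite piotaD; apply: phomD.
elim/set_min_ind: S q p => [|i S iS imin IH] q p Sp.
  by rewrite -pform_polyE piota_poly; apply: phom0.
have E : pmono (i |: S) q = pform_dt K i ⋏ pmono S q.
  rewrite pform_dt_mono (negPf iS) /below (_ : [set _ in _ | _] = set0) ?cards0 ?mul1r //.
  apply/setP=> j; rewrite !inE; apply/negP => /andP[/imin ij ji].
  by have := ltn_trans ij ji; rewrite ltnn.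
have pE : p - 1 = #|S| by rewrite -Sp cardsU1 iS; lia.
rewrite E piota_dt_mul pE; apply: phomD.
  rewrite -[X in phom X _]add0r; apply: phomM (phom_poly _) (phom_mono _ _).
apply: phomN; rewrite -[X in phom X _](subrK 1) addrC; apply: phomM (phom_dt _ _) _.
exact: IH.
Qed.

Lemma phom_pwdiv p (a : pform K m) : phom p a -> phom p (pwdiv a).
Proof.
move=> ha; apply/ffunP=> S; rewrite ffunE; case: ifP => // Sp.
rewrite -ha !ffunE Sp; apply/esym/mpolyP => l.
by rewrite mcoeff_wdiv mcoeff0 mulr0.
Qed.

Lemma phom_pradial p (a : pform K m) : phom p a -> phom (p - 1) (pradial a).
Proof. by move=> ha; apply/phom_piota/phom_pwdiv. Qed.

End HomogeneousOps.

(** * The ideal of the simplex and the operations on its quotient *)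

Section SimplexForms.
Context (K : fieldType).

Section Ideal.
Context (n : nat).
Notation N := n.+1.
Notation pf := (pform K n).
Notation poly := (@pform_poly K n).
Notation dt := (@pform_dt K n).
Notation I := (span (@simplex_rel K n)).
Implicit Types (a b c : pf) (p : int).

Definition rel_t : pf := poly (\sum_i 'X_i - 1).
Definition rel_dt : pf := \sum_i dt i.

Lemma simplex_relP (P : pf -> Prop) :
  (forall a b, P (a ⋏ (rel_t ⋏ b))) -> (forall a b, P (a ⋏ (rel_dt ⋏ b))) ->
  forall x, simplex_rel x -> P x.
Proof. by move=> Pt Pdt _ [a b|a b]; [apply: Pt|apply: Pdt]. Qed.

Lemma ideal_t a b : I (a ⋏ (rel_t ⋏ b)).
Proof. exact/span_gen/simplex_rel_t. Qed.

Lemma ideal_dt a b : I (a ⋏ (rel_dt ⋏ b)).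
Proof. exact/span_gen/simplex_rel_dt. Qed.

Lemma ideal_mull a b : I b -> I (a ⋏ b).
Proof.
apply: span_map b => [k x y|]; first by rewrite pform_mulDr pform_mulZr.
by apply: simplex_relP => x y; rewrite pform_mulA; [apply: ideal_t|apply: ideal_dt].
Qed.

Lemma ideal_mulr a b : I b -> I (b ⋏ a).
Proof.
move: b; apply: (span_map (F := fun b => b ⋏ a)) => [k x y|].
  by rewrite pform_mulDl pform_mulZl.
by apply: simplex_relP => x y; rewrite -!pform_mulA; [apply: ideal_t|apply: ideal_dt].
Qed.

Lemma pform_d_rel_t : pform_d rel_t = rel_dt.
Proof.
rewrite /rel_t pform_polyD pform_dD -mpolyC1 -mpolyCN pform_d_polyC addr0.
rewrite (big_morph poly (@pform_polyD _ _) (id1 := 0)) ?linear_sum; last first.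
  exact: pform_poly0.
by apply: eq_bigr => i _ /=; rewrite pform_d_X.
Qed.

Lemma pform_d_rel_dt : pform_d rel_dt = 0.
Proof. by rewrite -pform_d_rel_t pform_dd. Qed.

Lemma phom_rel_t : phom 0 rel_t. Proof. exact: phom_poly. Qed.

Lemma phom_rel_dt : phom 1 rel_dt.
Proof. by apply: phom_sum => i _; apply: phom_dt. Qed.

(** Of the two generators, [rel_dt] is the differential of [rel_t], and the ideal is two-sided; the
    Leibniz rule does the rest. *)
Lemma ideal_d a : I a -> I (pform_d a).
Proof.
apply: span_map a; first exact: pform_d_is_linear.
apply: simplex_relP => x y; rewrite pform_dM; apply: spanD.
- exact: ideal_t.
- apply: ideal_mull; rewrite pform_dM pform_d_rel_t; apply: spanD.
    by rewrite -[rel_dt]pform_mul1l -pform_mulA; apply: ideal_dt.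
  by rewrite (phom_sgn phom_rel_t) pform_mulZl -[rel_t]pform_mul1l -pform_mulA;
    apply/spanZ/ideal_t.
- exact: ideal_dt.
- apply: ideal_mull; rewrite pform_dM pform_d_rel_dt pform_mul0l add0r.
  by rewrite (phom_sgn phom_rel_dt) pform_mulZl -[rel_dt]pform_mul1l -pform_mulA;
    apply/spanZ/ideal_dt.
Qed.

Lemma ideal_sgn a : I a -> I (pform_sgn a).
Proof.
apply: span_map a; first exact: pform_sgn_is_linear.
apply: simplex_relP => x y; rewrite !pform_sgnM ?(phom_sgn phom_rel_t) ?(phom_sgn phom_rel_dt)
  pform_mulZl pform_mulZr; apply: spanZ; [exact: ideal_t|exact: ideal_dt].
Qed.

(** The generators are homogeneous but their cofactors need not be. Splitting the cofactors into
    monomials leaves homogeneous elements of the ideal, which a projection either fixes or kills. *)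
Lemma ideal_pr p a : I a -> I (pform_pr p a).
Proof.
apply: span_map a; first exact: pform_pr_is_linear.
have homI q a : phom q a -> I a -> I (pform_pr p a).
  by move=> <- Ia; rewrite pform_pr_pr; case: eqP => // _; apply: span_0.
have reduce r q : phom q r -> (forall a b, I (a ⋏ (r ⋏ b))) ->
    forall a b, I (pform_pr p (a ⋏ (r ⋏ b))).
  move=> hr Ir a b; elim/pform_ind_mono: a => [x y Ix Iy|k S m].
    by rewrite pform_mulDl pform_prD; apply: spanD.
  elim/pform_ind_mono: b => [x y Ix Iy|l T m'].
    by rewrite !pform_mulDr pform_prD; apply: spanD.
  apply: homI (Ir _ _); apply: phomM (phomZ _ (phom_mono _ _)) _.
  exact: phomM hr (phomZ _ (phom_mono _ _)).
by apply: simplex_relP; [apply: reduce phom_rel_t ideal_t|apply: reduce phom_rel_dt ideal_dt].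
Qed.

Lemma to_form_eq0 a : to_form a = 0 <-> I a.
Proof.
have E0 : (0 : form K n) = cls (@simplex_rel K n) 0 by rewrite linear0.
by rewrite -[a in X in _ <-> X]subr0 E0; apply: clsP.
Qed.

Lemma to_formP a b : to_form a = to_form b <-> I (a - b).
Proof. exact: clsP. Qed.

Lemma to_form_is_linear : linear (@to_form K n).
Proof. exact: cls_is_linear. Qed.

HB.instance Definition _ := GRing.isLinear.Build K pf (form K n) *:%R (@to_form K n)
  to_form_is_linear.

Lemma to_formD a b : to_form (a + b) = to_form a + to_form b.
Proof. exact: linearD. Qed.

Lemma to_formZ (k : K) a : to_form (k *: a) = k *: to_form a.
Proof. exact: linearZ. Qed.

Lemma to_form0 : to_form (0 : pf) = 0.
Proof. exact: linear0. Qed.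

Lemma to_formN a : to_form (- a) = - to_form a.
Proof. exact: linearN. Qed.

Lemma form_ind (P : form K n -> Prop) : (forall a, P (to_form a)) -> forall x, P x.
Proof. exact: quot_ind. Qed.

Lemma to_form_rep_map (V : lmodType K) (F : pf -> V) : linear F ->
  (forall a, I a -> F a = 0) -> forall a, F (rep (to_form a)) = F a.
Proof. by move=> FL FI a; apply: rep_lift => // x Gx; apply/FI/span_gen. Qed.

Lemma form_mulE a b : form_mul (to_form a) (to_form b) = to_form (a ⋏ b).
Proof.
apply/to_formP; set a' := rep _; set b' := rep _.
have -> : a' ⋏ b' - a ⋏ b = (a' - a) ⋏ b' + a ⋏ (b' - b).
  by rewrite pform_mulDl pform_mulDr !pform_mulNl !pform_mulNr addrA subrK.
by apply: spanD; [apply: ideal_mulr|apply: ideal_mull]; apply: rep_cls.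
Qed.

(** Operations on the quotient are defined through [rep]. A linear operator respecting the ideals
    may be computed on any representative, and the evaluation lemmas for the linear operations below
    come from here. *)
Lemma to_form_map (m : nat) (F : pf -> pform K m) : linear F ->
  (forall a, I a -> span (@simplex_rel K m) (F a)) ->
  forall a, to_form (F (rep (to_form a))) = to_form (F a).
Proof.
move=> FL FI a; by apply/clsP; rewrite -(linB FL); apply/FI/rep_cls.
Qed.

Lemma form_dE a : dga_d (to_form a : Omega K n) = to_form (pform_d a).
Proof. by apply: to_form_map; [apply: pform_d_is_linear|apply: ideal_d]. Qed.

Lemma form_dga_mulE a b : dga_mul (to_form a : Omega K n) (to_form b) = to_form (a ⋏ b).
Proof. exact: form_mulE. Qed.

Lemma form_prE p a : gpr p (to_form a : Omega K n) = to_form (pform_pr p a).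
Proof. by apply: to_form_map; [apply: pform_pr_is_linear|apply: ideal_pr]. Qed.

Lemma form_degP p (x : Omega K n) : of_degree p x <-> exists2 a, phom p a & x = to_form a.
Proof.
split=> [xp|[a ha ->]]; last by rewrite /of_degree form_prE ha.
exists (pform_pr p (rep x)); last by rewrite -[LHS]xp.
by rewrite /phom pform_pr_pr eqxx.
Qed.

Lemma form_d_is_linear : linear (@dga_d K (Omega K n)).
Proof.
move=> k; elim/form_ind=> a; elim/form_ind=> b.
by rewrite -to_formZ -to_formD !form_dE -to_formZ -to_formD linearP.
Qed.

Definition form_sgn (x : Omega K n) : Omega K n := to_form (pform_sgn (rep x)).

Lemma form_sgnE a : form_sgn (to_form a) = to_form (pform_sgn a).
Proof. by apply: to_form_map; [apply: pform_sgn_is_linear|apply: ideal_sgn]. Qed.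

(** A monomial of degree above n contains every [dt_i], and the relation making the [dt_i] sum to 0
    kills the product of all of them. *)
Lemma form_top p (x : Omega K n) : of_degree p x -> (n : int) < p -> x = 0.
Proof.
case/form_degP=> a ha -> np; apply/to_form_eq0; move: a ha; apply: phom_ind.
- exact: span_0.
- by move=> a b; apply: spanD.
move=> S q Sp.
have ST : S = setT.
  by apply/eqP; rewrite eqEcard subsetT cardsT card_ord; move: np; rewrite -Sp; lia.
(* In the product of the relation with all [dt_j], j different from 0, only the summand [dt_0]
   survives. The power of -1 put into the coefficient compensates the sign of its insertion. *)
have := ideal_dt (poly 1) (pmono [set~ ord0] ((-1) ^+ below [set~ ord0] (ord0 : 'I_N) * q)).
rewrite pform_mul1l /rel_dt pform_mul_suml (bigD1 ord0) //= big1 => [|i i0]; last first.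
  by rewrite pform_dt_mono !inE i0.
rewrite addr0 pform_dt_mono !inE eqxx /= mulrA -expr2 sqrr_sign mul1r ST.
by have -> : ord0 |: [set~ ord0] = [set: 'I_N] by apply/setP=> i; rewrite !inE orbN.
Qed.

End Ideal.

End SimplexForms.

Arguments form_sgn {K n}.

(** These properties isolate what the study of brackets on g (x) A uses, so that it never looks into
    forms. *)
Record cdga_axioms (K : fieldType) (A : dga K) : Prop := CdgaAxioms {
  cdga_graded : graded A;
  cdga_mulPl : forall k (x y z : A), dga_mul (k *: x + y) z = k *: dga_mul x z + dga_mul y z;
  cdga_mulPr : forall k (x y z : A), dga_mul z (k *: x + y) = k *: dga_mul z x + dga_mul z y;
  cdga_mulA : associative (@dga_mul K A);
  cdga_mul1 : left_id (dga_one A) (@dga_mul K A);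
  cdga_mulr1 : right_id (dga_one A) (@dga_mul K A);
  cdga_deg1 : of_degree 0 (dga_one A);
  cdga_degM : forall i j (x y : A), of_degree i x -> of_degree j y ->
    of_degree (i + j) (dga_mul x y);
  cdga_mulC : forall i j (x y : A), of_degree i x -> of_degree j y ->
    dga_mul x y = sgnz K (i * j) *: dga_mul y x;
  cdga_d_linear : linear (@dga_d K A);
  cdga_d_deg : forall i (x : A), of_degree i x -> of_degree (i + 1) (dga_d x);
  cdga_dM : forall i (x y : A), of_degree i x ->
    dga_d (dga_mul x y) = dga_mul (dga_d x) y + sgnz K i *: dga_mul x (dga_d y);
  cdga_dd : forall x : A, dga_d (dga_d x) = 0 }.

Record dga_morphism (K : fieldType) (A B : dga K) (phi : A -> B) : Prop := DgaMorphism {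
  dga_morph_linear : linear phi;
  dga_morph_deg : forall i x, of_degree i x -> of_degree i (phi x);
  dga_morph1 : phi (dga_one A) = dga_one B;
  dga_morphM : forall x y, phi (dga_mul x y) = dga_mul (phi x) (phi y);
  dga_morph_d : forall x, phi (dga_d x) = dga_d (phi x) }.

Section OmegaCdga.
Context (K : fieldType).

Lemma form_gpr_sum n (x : Omega K n) : x = \sum_(0 <= k < n.+2) gpr (k : int) x.
Proof.
elim/form_ind: x => a; rewrite {1}[a]pform_pr_sum linear_sum.
by apply: eq_bigr => k _; rewrite form_prE.
Qed.

Lemma Omega_graded n : graded (Omega K n).
Proof.
split=> [p k|p q|x].
- elim/form_ind=> a; elim/form_ind=> b.
  by rewrite -to_formZ -to_formD !form_prE pform_prD pform_prZ to_formD to_formZ.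
- elim/form_ind=> a; by rewrite !form_prE pform_pr_pr; case: ifP => // _; exact: to_form0.
- exists (map Posz (index_iota 0 n.+2)); split; last by rewrite big_map -form_gpr_sum.
  by rewrite map_inj_uniq ?iota_uniq // => i j [].
Qed.

Lemma Omega_cdga n : cdga_axioms (Omega K n).
Proof.
split.
- exact: Omega_graded.
- move=> k; elim/form_ind=> a; elim/form_ind=> b; elim/form_ind=> c.
  by rewrite -to_formZ -to_formD !form_dga_mulE pform_mulDl pform_mulZl to_formD to_formZ.
- move=> k; elim/form_ind=> a; elim/form_ind=> b; elim/form_ind=> c.
  by rewrite -to_formZ -to_formD !form_dga_mulE pform_mulDr pform_mulZr to_formD to_formZ.
- elim/form_ind=> a; elim/form_ind=> b; elim/form_ind=> c.
  by rewrite !form_dga_mulE pform_mulA.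
- by elim/form_ind=> a; rewrite form_dga_mulE pform_mul1l.
- by elim/form_ind=> a; rewrite form_dga_mulE pform_mul1r.
- by apply/form_degP; exists (pform_poly 1) => //; apply: phom_poly.
- move=> i j x y /form_degP[a ha ->] /form_degP[b hb ->]; rewrite form_dga_mulE.
  by apply/form_degP; exists (a ⋏ b) => //; apply: phomM.
- move=> i j x y /form_degP[a ha ->] /form_degP[b hb ->]; rewrite !form_dga_mulE.
  by rewrite (phomC ha hb) to_formZ.
- exact: form_d_is_linear.
- move=> i x /form_degP[a ha ->]; rewrite form_dE.
  by apply/form_degP; exists (pform_d a) => //; apply: phom_d.
- move=> i x + /form_degP[a ha ->]; elim/form_ind=> b; rewrite form_dga_mulE (form_dE a) (form_dE b) !form_dga_mulE form_dE.
  by rewrite pform_dM (phom_sgn ha) pform_mulZl to_formD to_formZ.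
- by elim/form_ind=> a; rewrite !form_dE pform_dd to_form0.
Qed.

End OmegaCdga.

(** * Pullback of forms along maps of vertices *)

Section Pull.
Context (K : fieldType).

Section OnePull.
Context (k n : nat) (f : 'I_k.+1 -> 'I_n.+1).

Definition pull_coord (i : 'I_n.+1) : {mpoly K[k.+1]} := \sum_(j | f j == i) 'X_j.

Lemma sum_pull_coord : \sum_i pull_coord i = \sum_j 'X_j.
Proof. by rewrite [RHS](partition_big f xpredT). Qed.

Lemma subst_rel_t (theta : 'I_n.+1 -> {mpoly K[k.+1]}) :
  pform_subst theta (rel_t K n) = pform_poly (\sum_i theta i - 1).
Proof.
rewrite pform_subst_poly comp_mpolyB comp_mpoly1 raddf_sum /=.
by congr (pform_poly (_ - 1)); apply: eq_bigr => i _; rewrite comp_X.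
Qed.

Lemma subst_rel_dt (theta : 'I_n.+1 -> {mpoly K[k.+1]}) :
  pform_subst theta (rel_dt K n) = pform_d (pform_poly (\sum_i theta i - 1)).
Proof. by rewrite -pform_d_rel_t pform_subst_d subst_rel_t. Qed.

Lemma ideal_subst (theta : 'I_n.+1 -> {mpoly K[k.+1]}) a :
  \sum_i theta i = \sum_j 'X_j -> span (@simplex_rel K n) a ->
  span (@simplex_rel K k) (pform_subst theta a).
Proof.
move=> thetaE; apply: span_map a; first exact: pform_subst_is_linear.
apply: simplex_relP => a b; rewrite !pform_substM ?subst_rel_t ?subst_rel_dt thetaE.
  exact: ideal_t.
by rewrite -[pform_poly _]/(rel_t K k) pform_d_rel_t; apply: ideal_dt.
Qed.

Lemma form_pullE a : form_pull f (to_form a) = to_form (pform_subst pull_coord a).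
Proof.
apply: to_form_map; first exact: pform_subst_is_linear.
by move=> b; apply: ideal_subst; apply: sum_pull_coord.
Qed.

Lemma form_pull_morphism : dga_morphism (form_pull f : Omega K n -> Omega K k).
Proof.
split.
- move=> c; elim/form_ind=> a; elim/form_ind=> b.
  by rewrite -to_formZ -to_formD !form_pullE linearP to_formD to_formZ.
- move=> i x /form_degP[a ha ->]; rewrite form_pullE; apply/form_degP.
  by exists (pform_subst pull_coord a) => //; apply: phom_subst.
- by rewrite [LHS]form_pullE pform_subst_poly comp_mpoly1.
- elim/form_ind=> a; elim/form_ind=> b.
  by rewrite form_dga_mulE !form_pullE form_dga_mulE pform_substM.
- by elim/form_ind=> a; rewrite form_dE !form_pullE form_dE pform_subst_d.
Qed.

Lemma form_pull_sgn (x : Omega K n) : form_pull f (form_sgn x) = form_sgn (form_pull f x).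
Proof.
by elim/form_ind: x => a; rewrite form_sgnE !form_pullE form_sgnE pform_subst_sgn.
Qed.

End OnePull.

Lemma form_pull_id n (x : Omega K n) : form_pull id x = x.
Proof.
elim/form_ind: x => a; rewrite form_pullE -[in RHS](pform_subst_id a).
by congr to_form; apply: eq_pform_subst => i; rewrite /pull_coord big_pred1_eq.
Qed.

Lemma form_pull_comp l m n (f : 'I_m.+1 -> 'I_n.+1) (e : 'I_l.+1 -> 'I_m.+1)
    (x : Omega K n) : form_pull (f \o e) x = form_pull e (form_pull f x).
Proof.
elim/form_ind: x => a; rewrite !form_pullE pform_subst_comp.
congr to_form; apply: eq_pform_subst => i; rewrite /pull_coord raddf_sum /=.
rewrite (partition_big e (fun j => f j == i)) //=; apply: eq_bigr => j fj.
rewrite comp_X; apply: eq_bigl => b; case: (eqVneq (e b) j) => [->|]; by rewrite ?fj ?andbF.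
Qed.

Lemma eq_form_pull m n (f g : 'I_m.+1 -> 'I_n.+1) (x : Omega K n) :
  f =1 g -> form_pull f x = form_pull g x.
Proof. by move=> /funext->. Qed.

End Pull.

(** * The Euler homotopy centred at a vertex *)

Section Cone.
Context (K : fieldType).

(** Translation along the i-th axis. For c = 1 it moves the i-th vertex to the origin and turns the
    relation that the coordinates sum to 1 into the homogeneous one that they sum to 0. *)
Definition vshift n (i : 'I_n.+1) (c : K) (j : 'I_n.+1) : {mpoly K[n.+1]} :=
  'X_j + (if j == i then c else 0)%:MP.

Lemma sum_vshift n (i : 'I_n.+1) c : \sum_j vshift i c j = \sum_j 'X_j + c%:MP.
Proof.
rewrite /vshift big_split /=; congr (_ + _); rewrite (bigD1 i) //= eqxx big1 ?addr0 //.
by move=> j /negPf->; rewrite mpolyC0.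
Qed.

Lemma vshiftK n (i : 'I_n.+1) c a :
  pform_subst (vshift i (- c)) (pform_subst (vshift i c) a) = a.
Proof.
rewrite pform_subst_comp -[RHS]pform_subst_id; apply: eq_pform_subst => j.
rewrite /vshift comp_mpolyD comp_mpolyC comp_X -addrA -mpolyCD.
by case: ifP => _; rewrite ?subrr ?addNr ?addr0 ?mpolyC0 ?addr0.
Qed.

Definition pcone n (i : 'I_n.+1) (a : pform K n) : pform K n :=
  pform_subst (vshift i (- 1)) (pradial (pform_subst (vshift i 1) a)).

Lemma pcone_is_linear n (i : 'I_n.+1) : linear (pcone i).
Proof.
move=> c a b; rewrite /pcone [pform_subst (vshift i 1) _]linearP pradial_is_linear.
exact: linearP.
Qed.

(** Generators of the translated ideal. Both basic relations now have weight 1, which makes the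
    ideal stable under the Euler homotopy. *)
Inductive homog_rel n : pform K n -> Prop :=
| homog_rel_t a b : homog_rel (a ⋏ (pform_poly (\sum_i 'X_i) ⋏ b))
| homog_rel_dt a b : homog_rel (a ⋏ (rel_dt K n ⋏ b)).

Lemma rel_dtE n : rel_dt K n = pform_d (pform_poly (\sum_i 'X_i)).
Proof.
by rewrite -pform_d_rel_t /rel_t pform_polyD pform_dD -mpolyC1 -mpolyCN pform_d_polyC addr0.
Qed.

Lemma poly_sumX n : pform_poly (\sum_i 'X_i) = \sum_i pform_poly 'X_i :> pform K n.
Proof.
by apply: (big_morph _ (@pform_polyD K n)); apply: pform_poly0.
Qed.

Lemma piota_rel_dt n : piota (rel_dt K n) = pform_poly (\sum_i 'X_i).
Proof.
rewrite poly_sumX /rel_dt linear_sum; apply: eq_bigr => i _; exact: piota_dt.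
Qed.

(** On a product of weight eigenvectors [pwdiv] is a scalar, so with monomial cofactors only the
    contraction with the Euler field has to be examined. It is an odd derivation sending [rel_dt] to
    the sum of the coordinates and that sum to 0. *)
Lemma homog_rel_radial n (a : pform K n) :
  span (@homog_rel n) a -> span (@homog_rel n) (pradial a).
Proof.
apply: span_map a; first exact: pradial_is_linear.
have W1 : pweight (pform_poly (\sum_i 'X_i)) = 1 *: pform_poly (\sum_i 'X_i) :> pform K n.
  by rewrite /pweight piota_poly linear0 add0r -rel_dtE piota_rel_dt scale1r.
have W2 : pweight (rel_dt K n) = 1 *: rel_dt K n.
  by rewrite rel_dtE pweight_d W1 !scale1r.
have reduce r : pweight r = 1 *: r ->
    (forall a b, span (@homog_rel n) (piota (a ⋏ (r ⋏ b)))) ->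
    forall a b, span (@homog_rel n) (pradial (a ⋏ (r ⋏ b))).
  move=> Wr Ir a b; elim/pform_ind_mono: a => [x y Ix Iy|k S m].
    by rewrite pform_mulDl -[pform_mul x _]scale1r pradial_is_linear scale1r; apply: spanD.
  elim/pform_ind_mono: b => [x y Ix Iy|l T m'].
    by rewrite !pform_mulDr -[X in X + _]scale1r pradial_is_linear scale1r; apply: spanD.
  set x := k *: _; set y := l *: _.
  have Wx : pweight x = (mdeg m + #|S|)%N%:R *: x.
    by rewrite linearZ /= pweight_mono !scalerA mulrC.
  have Wy : pweight y = (mdeg m' + #|T|)%N%:R *: y.
    by rewrite linearZ /= pweight_mono !scalerA mulrC.
  clearbody x y; have W : pweight (x ⋏ (r ⋏ y)) =
      ((mdeg m + #|S|)%N%:R + (1 + (mdeg m' + #|T|)%N%:R)) *: (x ⋏ (r ⋏ y)).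
    rewrite !pweightM Wx Wr Wy pform_mulDr !(pform_mulZl, pform_mulZr).
    by rewrite !scalerDl.
  rewrite /pradial (pwdiv_eigen W) linearZ; apply: spanZ; exact: Ir.
have It a b : span (@homog_rel n) (a ⋏ (pform_poly (\sum_i 'X_i) ⋏ b)).
  exact/span_gen/homog_rel_t.
have Idt a b : span (@homog_rel n) (a ⋏ (rel_dt K n ⋏ b)).
  exact/span_gen/homog_rel_dt.
move=> _ [x y|x y]; apply: reduce => // {x y} x y; rewrite !piotaM.
  apply: spanD; first exact: It.
  by rewrite piota_poly pform_mul0l add0r pform_sgn_poly; apply: It.
apply: spanD; first exact: Idt.
rewrite piota_rel_dt pform_mulDr; apply: spanD; first exact: It.
by rewrite (phom_sgn (phom_rel_dt K n)) pform_mulZl pform_mulZr; apply/spanZ/Idt.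
Qed.

Lemma ideal_cone n (i : 'I_n.+1) a :
  span (@simplex_rel K n) a -> span (@simplex_rel K n) (pcone i a).
Proof.
move=> Ia; rewrite /pcone; have := homog_rel_radial (n := n).
move/(_ (pform_subst (vshift i 1) a)); set x := pradial _ => Hx.
have {}Hx : span (@homog_rel n) x.
  apply: Hx; move: Ia; apply: span_map; first exact: pform_subst_is_linear.
  apply: simplex_relP => y z; rewrite !pform_substM ?subst_rel_t ?subst_rel_dt
    sum_vshift mpolyC1 addrK; last by rewrite -rel_dtE; apply/span_gen/homog_rel_dt.
  exact/span_gen/homog_rel_t.
move: Hx; apply: span_map; first exact: pform_subst_is_linear.
move=> _ [y z|y z]; rewrite !pform_substM.
  rewrite pform_subst_poly raddf_sum /=; under eq_bigr => j _ do rewrite comp_X.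
  by rewrite sum_vshift mpolyCN mpolyC1; apply: ideal_t.
rewrite rel_dtE pform_subst_d pform_subst_poly raddf_sum /=.
under eq_bigr => j _ do rewrite comp_X.
by rewrite sum_vshift mpolyCN mpolyC1 pform_d_rel_t; apply: ideal_dt.
Qed.

Definition form_cone n (i : 'I_n.+1) (x : Omega K n) : Omega K n := to_form (pcone i (rep x)).

Lemma form_coneE n (i : 'I_n.+1) a : form_cone i (to_form a) = to_form (pcone i a).
Proof. by apply: to_form_map; [apply: pcone_is_linear|apply: ideal_cone]. Qed.

Lemma form_cone_linear n (i : 'I_n.+1) : linear (form_cone i).
Proof.
move=> c; elim/form_ind=> a; elim/form_ind=> b.
by rewrite -to_formZ -to_formD !form_coneE pcone_is_linear to_formD to_formZ.
Qed.

Lemma form_cone_deg n (i : 'I_n.+1) p x : of_degree p x -> of_degree (p - 1) (form_cone i x).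
Proof.
case/form_degP=> a ha ->; rewrite form_coneE; apply/form_degP; exists (pcone i a) => //.
by apply/phom_subst/phom_pradial/phom_subst.
Qed.

(** Under the constant map t_i becomes the sum of all coordinates, which is 1 in the quotient, its
    differential becomes 0, and the other t_j vanish. This is evaluation at the i-th vertex, hence
    at the origin after translation. *)
Lemma form_pull_const n (i : 'I_n.+1) a :
  form_pull (fun _ : 'I_n.+1 => i) (to_form a) =
  to_form (pconst (pform_subst (vshift i 1) a)).
Proof.
rewrite form_pullE; elim/pform_ind: a => [x y IHx IHy|p|j x IHx].
- rewrite !pform_substD pconstD [LHS]to_formD [RHS]to_formD.
  exact: (congr2 +%R IHx IHy).
- rewrite !pform_subst_poly /pconst [pform_poly _ set0]ffunE eqxx.
  elim/mpoly_alg_ind: p => [p q IHp IHq|p q IHp IHq|c|j].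
  + rewrite !comp_mpolyD mcoeffD mpolyCD !pform_polyD [LHS]to_formD [RHS]to_formD.
    exact: (congr2 +%R IHp IHq).
  + by rewrite !rmorphM /= !pform_polyM -!form_mulE IHp IHq.
  + by rewrite !comp_mpolyC mcoeffC eqxx mulr1.
  rewrite !comp_X /vshift mcoeffD mcoeffC eqxx mulr1 mcoeffX mnm1_eq0 add0r.
  rewrite /pull_coord; case: (eqVneq j i) => [_|_]; last by rewrite big_pred0 ?mpolyC0.
  apply/to_formP.
  have := ideal_t (pform_poly 1) (pform_poly 1 : pform K n).
  rewrite pform_mul1l pform_mul1r /rel_t pform_polyD mpolyC1.
  rewrite (_ : pform_poly (- 1) = - pform_poly 1) // -scaleN1r pform_polyZ scaleN1r //.
- rewrite !pform_subst_dt_mul /pconst.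
  have -> : (pform_d (pform_poly (vshift i 1 j)) ⋏ pform_subst (vshift i 1) x) set0 = 0.
    rewrite pform_polyD pform_dD pform_d_polyC addr0 pform_d_X pform_dt_mulE inE //.
  rewrite mcoeff0 mpolyC0; apply/to_formP.
  rewrite pform_poly0 subr0.
  rewrite /pull_coord; case: (eqVneq i j) => [_|_].
    by rewrite -rel_dtE -[rel_dt K n]pform_mul1l -pform_mulA; apply: ideal_dt.
  rewrite big_pred0 //.
  by rewrite -mpolyC0 pform_d_polyC pform_mul0l; apply: span_0.
Qed.

Lemma form_coneP (charK : [pchar K] =i pred0) n (i : 'I_n.+1) (x : Omega K n) :
  dga_d (form_cone i x) + form_cone i (dga_d x) = x - form_pull (fun _ : 'I_n.+1 => i) x.
Proof.
elim/form_ind: x => a; rewrite form_pull_const form_coneE (form_dE a) form_coneE form_dE.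
rewrite -to_formD -to_formN -[RHS]to_formD; congr to_form.
rewrite /pcone -[X in X + _]pform_subst_d [X in _ + pform_subst _ (pradial X)]pform_subst_d.
rewrite -[LHS]pform_substD pradialP // [LHS]linearB /= vshiftK; congr (_ - _).
by rewrite /pconst pform_subst_polyC.
Qed.

(** The affine map sends the vertex i to the vertex f i, so it intertwines the two translations; it
    acts on coordinates by linear forms, which respects the Euler fields. *)
Lemma form_cone_pull k n (f : 'I_k.+1 -> 'I_n.+1) (i : 'I_k.+1) (x : Omega K n) :
  form_pull f (form_cone (f i) x) = form_cone i (form_pull f x).
Proof.
elim/form_ind: x => a; rewrite form_coneE !form_pullE form_coneE; congr to_form.
have shift c b : pform_subst (pull_coord K f) (pform_subst (vshift (f i) c) b) =
    pform_subst (vshift i c) (pform_subst (pull_coord K f) b).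
  rewrite !pform_subst_comp; apply: eq_pform_subst => j.
  rewrite /vshift comp_mpolyD comp_mpolyC comp_X /pull_coord raddf_sum /=.
  under [in RHS]eq_bigr => b' _ do rewrite comp_X.
  rewrite big_split /=; congr (_ + _); case: (eqVneq j (f i)) => [->|ji].
    rewrite (bigD1 i) //= eqxx big1 ?addr0 // => b' /andP[_ /negPf->].
    by rewrite mpolyC0.
  rewrite big1 ?mpolyC0 // => b' /eqP fb; case: eqVneq => [b'i|_]; last by rewrite mpolyC0.
  by rewrite -fb b'i eqxx in ji.
rewrite /pcone shift -pradial_subst ?shift // => j.
rewrite /pull_coord (big_morph _ (@pform_polyD K k) (id1 := 0)); last first.
  exact: pform_poly0.
rewrite [pform_d _]linear_sum [LHS]linear_sum; apply: eq_bigr => b _ /=.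
by rewrite pform_d_X piota_dt.
Qed.

End Cone.

Section Homog.
Context (K : fieldType).

Lemma of_degree0 (V : gvect K) (gV : graded V) p : of_degree p (0 : V).
Proof. by case: gV => gl _ _; apply: (lin0 (gl p)). Qed.

Lemma of_degreeP (V : gvect K) (gV : graded V) p k (x y : V) :
  of_degree p x -> of_degree p y -> of_degree p (k *: x + y).
Proof. by case: gV => gl _ _; rewrite /of_degree gl => -> ->. Qed.

Lemma of_degreeD (V : gvect K) (gV : graded V) p (x y : V) :
  of_degree p x -> of_degree p y -> of_degree p (x + y).
Proof. by move=> hx hy; rewrite -[x]scale1r; apply: of_degreeP. Qed.

Lemma of_degreeZ (V : gvect K) (gV : graded V) p k (x : V) :
  of_degree p x -> of_degree p (k *: x).
Proof. by move=> hx; rewrite -[_ *: _]addr0; apply: of_degreeP => //; apply: of_degree0. Qed.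

Lemma of_degree_sum (V : gvect K) (gV : graded V) p I (r : seq I) (Q : pred I) (F : I -> V) :
  (forall i, Q i -> of_degree p (F i)) -> of_degree p (\sum_(i <- r | Q i) F i).
Proof. by move=> hF; apply: big_ind => //; [apply: of_degree0|move=> x y; apply: of_degreeD]. Qed.

Lemma of_degree_gpr (V : gvect K) (gV : graded V) p (x : V) : of_degree p (gpr p x).
Proof. by case: gV => _ gg _; rewrite /of_degree gg eqxx. Qed.

Lemma graded_ext (V : gvect K) (gV : graded V) (W : lmodType K) (F G : V -> W) :
  linear F -> linear G -> (forall p x, of_degree p x -> F x = G x) -> forall x, F x = G x.
Proof.
move=> FL GL FG x; case: (gV) => _ _ /(_ x)[s [_ ->]].
rewrite (lin_sum FL) (lin_sum GL); apply: eq_bigr => i _.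
by apply: (FG i); apply: of_degree_gpr.
Qed.

Lemma linD (V W : lmodType K) (F : V -> W) : linear F -> forall x y, F (x + y) = F x + F y.
Proof. by move=> FL x y; rewrite -[x]scale1r FL !scale1r. Qed.

Lemma linN (V W : lmodType K) (F : V -> W) : linear F -> forall x, F (- x) = - F x.
Proof. by move=> FL x; rewrite -scaleN1r (linZ FL) scaleN1r. Qed.

Lemma linearD_fun (V W : lmodType K) (F G : V -> W) : linear F -> linear G ->
  linear (fun x => F x + G x).
Proof. by move=> FL GL c x y; rewrite FL GL scalerDr addrACA. Qed.

Lemma linear_comp_fun (U V W : lmodType K) (F : V -> W) (G : U -> V) : linear F -> linear G ->
  linear (fun x => F (G x)).
Proof. by move=> FL GL c x y; rewrite GL FL. Qed.

Lemma linearN_fun (V W : lmodType K) (F : V -> W) : linear F -> linear (fun x => - F x).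
Proof. by move=> FL c x y; rewrite FL opprD scalerN. Qed.

End Homog.

(** * The contraction of a gauge onto a vertex *)

Section SimplexIntegral.
Context (K : fieldType).

(** Eliminating t_0 kills the ideal, so the integral may be computed on any representative. It then
    reads only the coefficient of dt_1 ... dt_k, which belongs to degree k. *)
Lemma simplex_int_eq0 k (x : Omega K k) : gpr (k : int) x = 0 -> simplex_int x = 0.
Proof.
elim/form_ind: x => a; rewrite form_prE => /to_form_eq0 Ia; rewrite /simplex_int.
pose theta (i : 'I_k.+1) : {mpoly K[k.+1]} :=
  if i == ord0 then 1 - \sum_(j | j != ord0) 'X_j else 'X_i.
have kill b : span (@simplex_rel K k) b -> pform_subst theta b = 0.
  have theta1 : \sum_i theta i - 1 = 0.
    rewrite (bigD1 ord0) //= {1}/theta eqxx (eq_bigr (fun j => 'X_j)) ?subrK ?subrr //.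
    by move=> j /negPf j0; rewrite /theta j0.
  elim=> [|y [y1 y2|y1 y2]|c y z _ Ey _ Ez]; first exact: linear0.
  - rewrite !pform_substM -[pform_poly (_ - 1)]/(rel_t K k) subst_rel_t theta1.
    by rewrite pform_poly0 pform_mul0l pform_mul0r.
  - rewrite !pform_substM -[\sum_i pform_dt _ i]/(rel_dt K k) subst_rel_dt theta1.
    by rewrite -mpolyC0 pform_d_polyC ?pform_mul0l ?pform_mul0r.
  by rewrite [LHS]linearP /= Ey Ez scaler0 addr0.
rewrite /pform_elim -/theta (to_form_rep_map (pform_subst_is_linear theta) kill).
suff -> : pform_subst theta a [set~ ord0] = 0 by rewrite msupp0 big_nil.
transitivity (pform_pr (k : int) (pform_subst theta a) [set~ ord0]).
  by rewrite ffunE cardsC1 card_ord eqxx.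
by rewrite pform_pr_subst kill // ffunE.
Qed.

End SimplexIntegral.

Section GaugeFacts.
Context (K : fieldType) (charK : [pchar K] =i pred0).
Context (s : forall n, Omega K n -> Omega K n) (s_gauge : gauge s).
Notation Om n := (Omega K n).
Notation P := (@Whitney_proj K _).

Let s_linear n : linear (@s n).
Proof. by move=> c x y; case: s_gauge => [[sl _ _ _] _]; apply: sl. Qed.

Let s_deg n p (x : Om n) : of_degree p x -> of_degree (p - 1) (s x).
Proof. by case: s_gauge => [[_ sd _ _] _]; apply: sd. Qed.

Let s_pull m n (f : ordmap m n) (x : Om n) : monotone f -> form_pull f (s x) = s (form_pull f x).
Proof. by case: s_gauge => [[_ _ sp _] _]; apply: sp. Qed.

Let s_contr n (x : Om n) : x - P x = dga_d (s x) + s (dga_d x).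
Proof. by case: s_gauge => [[_ _ _ sc] _]; apply: sc. Qed.

Let s_sq n (x : Om n) : s (s x) = 0.
Proof. by case: s_gauge => [_]; apply. Qed.

Let d_linear n := @form_d_is_linear K n.
Let d_sq n := cdga_dd (Omega_cdga K n).
Let Omg n := Omega_graded K n.

(** Linearity, degree, naturality and commutation with d are inherited from [s] through this
    formula. The definition of P by integrals is opened only in [Whitney_s]. *)
Lemma WhitneyE n (x : Om n) : P x = x - (dga_d (s x) + s (dga_d x)).
Proof. by rewrite -s_contr opprB addrC subrK. Qed.

Lemma Whitney_linear n : linear (@Whitney_proj K n).
Proof.
have L : linear (fun x : Om n => x + - (dga_d (s x) + s (dga_d x))).
  apply: linearD_fun => //; apply: linearN_fun; apply: linearD_fun.
    exact: linear_comp_fun (d_linear (n := n)) (s_linear (n := n)).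
  exact: linear_comp_fun (s_linear (n := n)) (d_linear (n := n)).
by move=> c x y; rewrite !WhitneyE; apply: L.
Qed.

Lemma Whitney_deg n p (x : Om n) : of_degree p x -> of_degree p (P x).
Proof.
move=> hx; rewrite WhitneyE; apply: of_degreeD => //; rewrite -scaleN1r; apply: of_degreeZ => //.
apply: of_degreeD => //; last by rewrite -[p](addrK 1); apply/s_deg/(cdga_d_deg (Omega_cdga K n)).
by rewrite -[p](subrK 1); apply/(cdga_d_deg (Omega_cdga K n))/s_deg.
Qed.

Lemma Whitney_pull m n (f : ordmap m n) (x : Om n) : monotone f ->
  form_pull f (P x) = P (form_pull f x).
Proof.
move=> fm; have [fl _ _ _ fd] := form_pull_morphism K f.
by rewrite !WhitneyE (linB fl) (linD fl) fd !s_pull // fd.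
Qed.

Lemma Whitney_d n (x : Om n) : P (dga_d x) = dga_d (P x).
Proof.
rewrite !WhitneyE (linB (d_linear (n := n))) d_sq (lin0 (@s_linear n)) addr0.
by rewrite (linD (d_linear (n := n))) d_sq add0r.
Qed.

(** By naturality, integrating s x over a k-dimensional face is integrating s of a form on the
    k-simplex. Its component of degree k would come from a form of degree k + 1, and those vanish by
    [form_top]. *)
Lemma Whitney_s n (x : Om n) : P (s x) = 0.
Proof.
rewrite /Whitney_proj big1 // => k _; rewrite big1 // => i inc_i.
have i_mono : monotone (i : ordmap k n).
  move=> a b; rewrite leq_eqVlt => /orP[/eqP/val_inj->//|ab].
  by move/forallP: inc_i => /(_ a)/forallP/(_ b); rewrite ab => /ltnW.
rewrite /chain_int s_pull // simplex_int_eq0 ?scale0r //.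
move: (form_pull i x) => {x inc_i i i_mono}.
apply: (graded_ext (Omg k) (G := fun _ : Om k => 0 : Om k)).
- by apply: linear_comp_fun; [case: (Omg k) => gl _ _; apply: gl|apply: s_linear].
- by move=> c x y; rewrite scaler0 addr0.
move=> p x hx; have hsx := s_deg hx; have [pk|pk] := eqVneq (p - 1) k.
  by rewrite (form_top hx) ?(lin0 (s_linear (n := k))) ?of_degree0 //; lia.
by rewrite -hsx; case: (Omg k) => _ -> _; rewrite eq_sym (negPf pk).
Qed.

(** The contraction identity at s x, together with P s = 0 and s^2 = 0, reads s = s d s. Hence s (ds
    + sd) = s, so that s (id - P) = s. *)
Lemma s_Whitney n (x : Om n) : s (P x) = 0.
Proof.
have ds : s (dga_d (s x)) = s x.
  by have := s_contr (s x); rewrite Whitney_s subr0 s_sq (lin0 (d_linear (n := n))) add0r.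
by rewrite WhitneyE (linB (s_linear (n := n))) (linD (s_linear (n := n))) ds s_sq addr0 subrr.
Qed.

Lemma form_neg n p (x : Om n) : of_degree p x -> p < 0 -> x = 0.
Proof.
case/form_degP=> a ha -> p0; rewrite -ha (_ : pform_pr p a = 0) ?to_form0 //.
by apply/ffunP=> S; rewrite !ffunE; case: eqP => // Sp; move: p0; rewrite -Sp.
Qed.

(** Forms on the point live in degree 0 only, so an operator of degree -1 has nowhere to go. With
    naturality this evaluates [s] and the cone at vertices. *)
Lemma lower_degree_Omega0 (T : Om 0 -> Om 0) : linear T ->
  (forall p x, of_degree p x -> of_degree (p - 1) (T x)) -> forall x, T x = 0.
Proof.
move=> TL Tdeg; apply: (graded_ext (Omg 0) TL (G := fun _ : Om 0 => 0 : Om 0)).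
  by move=> c x y; rewrite scaler0 addr0.
move=> p x hx; have [p0|p0] := boolP ((0 : int) < p).
  by rewrite (form_top hx) // lin0.
by apply: (form_neg (Tdeg _ _ hx)); lia.
Qed.

(** Evaluation at the i-th vertex, with values regarded as constant forms on the same simplex, so
    that it is an endomorphism and can occur in a homotopy formula. *)
Definition form_vertex n (i : 'I_n.+1) : Om n -> Om n := form_pull (fun _ : 'I_n.+1 => i).

Definition vertex_in n (i : 'I_n.+1) : ordmap 0 n := [ffun=> i].
Definition to_point n : ordmap n 0 := [ffun=> ord0].

(** The factorisation through the point consists of monotone maps, for which [s] and P are natural,
    and passes through Omega_0, where [s] vanishes. *)
Lemma form_vertexE n (i : 'I_n.+1) x :
  form_vertex i x = form_pull (to_point n) (form_pull (vertex_in i) x).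
Proof.
by rewrite -form_pull_comp; apply: eq_form_pull => j /=; rewrite ffunE.
Qed.

Lemma monotone_vertex_in n (i : 'I_n.+1) : monotone (vertex_in i).
Proof. by move=> a b; rewrite !ffunE. Qed.

Lemma monotone_to_point n : monotone (to_point n).
Proof. by move=> a b; rewrite !ffunE. Qed.

Lemma vertex_s n (i : 'I_n.+1) (x : Om n) : form_vertex i (s x) = 0.
Proof.
rewrite form_vertexE s_pull; last exact: monotone_vertex_in.
rewrite (lower_degree_Omega0 (@s_linear 0) (@s_deg 0)).
by have [fl _ _ _ _] := form_pull_morphism K (to_point n); rewrite (lin0 fl).
Qed.

Lemma vertex_cone n (i : 'I_n.+1) (x : Om n) : form_vertex i (form_cone i x) = 0.
Proof.
have E : form_pull (vertex_in i) (form_cone i x) = form_cone ord0 (form_pull (vertex_in i) x).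
  by rewrite -form_cone_pull ffunE.
rewrite form_vertexE E.
rewrite (lower_degree_Omega0 (T := form_cone ord0) (form_cone_linear _)); last first.
  exact: form_cone_deg.
by have [fl _ _ _ _] := form_pull_morphism K (to_point n); rewrite (lin0 fl).
Qed.

Lemma Whitney_vertex n (i : 'I_n.+1) (x : Om n) : P (form_vertex i x) = form_vertex i x.
Proof.
rewrite form_vertexE -Whitney_pull; last exact: monotone_to_point.
congr form_pull; rewrite WhitneyE !(lower_degree_Omega0 (@s_linear 0) (@s_deg 0)).
by rewrite (lin0 (d_linear (n := 0))) addr0 subr0.
Qed.

Lemma vertex_Whitney n (i : 'I_n.+1) (x : Om n) : form_vertex i (P x) = P (form_vertex i x).
Proof.
rewrite !form_vertexE Whitney_pull; last exact: monotone_vertex_in.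
by rewrite Whitney_pull //; apply: monotone_to_point.
Qed.

(* form_ctr is a contraction of the forms onto the i-th vertex: the gauge contracts onto the
   image of P, on which P o form_cone contracts onto the vertex. *)
Definition form_rho n (i : 'I_n.+1) (x : Om n) : Om n := P (form_cone i x).
Definition form_ctr n (i : 'I_n.+1) (x : Om n) : Om n := s x + form_rho i x.

Lemma form_rho_linear n (i : 'I_n.+1) : linear (form_rho i).
Proof. exact: linear_comp_fun (Whitney_linear (n := n)) (form_cone_linear i). Qed.

Lemma form_ctr_linear n (i : 'I_n.+1) : linear (form_ctr i).
Proof. exact: linearD_fun (@s_linear n) (form_rho_linear i). Qed.

Lemma form_rho_deg n (i : 'I_n.+1) p x : of_degree p x -> of_degree (p - 1) (form_rho i x).
Proof. by move=> hx; apply/Whitney_deg/form_cone_deg. Qed.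

Lemma form_ctr_deg n (i : 'I_n.+1) p x : of_degree p x -> of_degree (p - 1) (form_ctr i x).
Proof.
by move=> hx; apply: (of_degreeD (Omg n)); [apply: s_deg|apply: form_rho_deg].
Qed.

(** With e the evaluation at the vertex, the two homotopies contribute id - P and P (id - e). Their
    sum is id - e because P fixes the image of e. *)
Lemma form_ctrP n (i : 'I_n.+1) (x : Om n) :
  dga_d (form_ctr i x) + form_ctr i (dga_d x) = x - form_vertex i x.
Proof.
rewrite /form_ctr (linD (d_linear (n := n))) addrACA -s_contr /form_rho -Whitney_d.
rewrite -(linD (Whitney_linear (n := n))) form_coneP // (linB (Whitney_linear (n := n))).
by rewrite -/(form_vertex i x) Whitney_vertex addrA subrK.
Qed.

Lemma s_form_rho n (i : 'I_n.+1) (x : Om n) : s (form_rho i x) = 0.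
Proof. exact: s_Whitney. Qed.

Lemma s_d_form_rho n (i : 'I_n.+1) (x : Om n) : s (dga_d (form_rho i x)) = 0.
Proof. by rewrite /form_rho -Whitney_d s_Whitney. Qed.

Lemma s_form_ctr n (i : 'I_n.+1) (x : Om n) : s (form_ctr i x) = 0.
Proof. by rewrite /form_ctr (linD (@s_linear n)) s_sq s_form_rho addr0. Qed.

Lemma vertex_form_rho n (i : 'I_n.+1) (x : Om n) : form_vertex i (form_rho i x) = 0.
Proof. by rewrite vertex_Whitney vertex_cone (lin0 (@Whitney_linear n)). Qed.

Lemma vertex_form_ctr n (i : 'I_n.+1) (x : Om n) : form_vertex i (form_ctr i x) = 0.
Proof.
have [fl _ _ _ _] := form_pull_morphism K (fun _ : 'I_n.+1 => i).
by rewrite /form_ctr /form_vertex (linD fl) [X in X + _]vertex_s [X in _ + X]vertex_form_rho addr0.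
Qed.

Lemma form_rho_pull m n (f : ordmap m n) (i : 'I_m.+1) (x : Om n) : monotone f ->
  form_pull f (form_rho (f i) x) = form_rho i (form_pull f x).
Proof.
move=> fm; apply: etrans (Whitney_pull _ fm) _; congr Whitney_proj; exact: form_cone_pull.
Qed.

Lemma form_ctr_pull m n (f : ordmap m n) (i : 'I_m.+1) (x : Om n) : monotone f ->
  form_pull f (form_ctr (f i) x) = form_ctr i (form_pull f x).
Proof.
move=> fm; have [fl _ _ _ _] := form_pull_morphism K f.
apply: etrans (linD fl _ _) _; exact: (congr2 +%R (s_pull _ fm) (form_rho_pull _ _ fm)).
Qed.

Lemma gauge_vertex n (i : 'I_n.+1) (x : Om n) : s (form_vertex i x) = 0.
Proof.
rewrite form_vertexE -s_pull; last exact: monotone_to_point.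
rewrite (lower_degree_Omega0 (@s_linear 0) (@s_deg 0)).
by have [fl _ _ _ _] := form_pull_morphism K (to_point n); rewrite (lin0 fl).
Qed.

End GaugeFacts.

Section FormSign.
Context (K : fieldType) (n : nat).
Notation Om := (Omega K n).

Lemma form_sgn_linear : linear (@form_sgn K n).
Proof.
move=> c; elim/form_ind=> a; elim/form_ind=> b.
by rewrite -to_formZ -to_formD !form_sgnE pform_sgn_is_linear to_formD to_formZ.
Qed.

Lemma form_sgn_hom p (x : Om) : of_degree p x -> form_sgn x = sgnz K p *: x.
Proof. by case/form_degP=> a ha ->; rewrite form_sgnE (phom_sgn ha) to_formZ. Qed.

Lemma form_sgn_odd (T : Om -> Om) e : linear T -> sgnz K e = -1 ->
  (forall p x, of_degree p x -> of_degree (p + e) (T x)) ->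
  forall x, T (form_sgn x) = - form_sgn (T x).
Proof.
move=> TL eN Tdeg; apply: (graded_ext (Omega_graded K n)).
- exact: linear_comp_fun TL form_sgn_linear.
- exact/linearN_fun/linear_comp_fun/TL/form_sgn_linear.
move=> p x hx; rewrite (form_sgn_hom hx) (linZ TL) (form_sgn_hom (Tdeg _ _ hx)).
by rewrite sgnzD eN mulrN1 scaleNr opprK.
Qed.

End FormSign.

(** * Tensor products *)

Section TensorLinear.
Context (K : fieldType).

Lemma tpure_linear_l (V W : lmodType K) (w : W) : linear (fun v : V => tpure v w).
Proof. by move=> c v v'; apply: tpure_linl. Qed.

Lemma tpure_linear_r (V W : lmodType K) (v : V) : linear (fun w : W => tpure v w).
Proof. by move=> c w w'; apply: tpure_linr. Qed.

Lemma tens_ind (V W : lmodType K) (P : tens V W -> Prop) :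
  P 0 -> (forall c x y, P x -> P y -> P (c *: x + y)) -> (forall v w, P (tpure v w)) ->
  forall z, P z.
Proof.
move=> P0 PL Pp z; rewrite (tens_sum z); apply: (big_ind P) => //.
  by move=> x y Px Py; rewrite -[x]scale1r; apply: PL.
by move=> vw _; rewrite -[_ *: _]addr0; apply: PL.
Qed.

Lemma fglift_sum (T : choiceType) (U : lmodType K) (F : T -> U) (x : {freeg T / K}) :
  fglift F x = \sum_(t <- dom x) coeff t x *: F t.
Proof.
rewrite -{1}[x]freeg_sumE (lin_sum (fglift_linear F)); apply: eq_bigr => t _.
by rewrite liftU.
Qed.

Section Lift.
Context (V W U : lmodType K) (phi : V -> W -> U).
Hypothesis phi_l : forall w, linear (fun v => phi v w).
Hypothesis phi_r : forall v, linear (phi v).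

(** The universal property of the tensor product: bilinearity makes the value independent of the
    representative picked by [rep]. *)
Definition tlift (z : tens V W) : U := fglift (fun vw : V * W => phi vw.1 vw.2) (rep z).

Lemma tlift_rel : forall x, bilin_rel x -> fglift (fun vw : V * W => phi vw.1 vw.2) x = 0.
Proof.
by move=> _ [c v v' w|c v w w']; rewrite (linB (fglift_linear _)) fglift_linear !liftU !scale1r /=
  ?phi_l ?phi_r subrr.
Qed.

Lemma tlift_pure v w : tlift (tpure v w) = phi v w.
Proof.
by rewrite /tlift /tpure (rep_lift (fglift_linear _) tlift_rel) liftU scale1r.
Qed.

Lemma tlift_linear : linear tlift.
Proof.
move=> c; elim/quot_ind=> x; elim/quot_ind=> y; rewrite /tlift -linearP.
by rewrite !(rep_lift (fglift_linear _) tlift_rel) fglift_linear.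
Qed.

End Lift.

Section Map.
Context (V W V' W' : lmodType K) (f : V -> V') (g : W -> W').
Hypothesis (fL : linear f) (gL : linear g).

Let phi v w := tpure (f v) (g w).
Let phi_l w : linear (fun v => phi v w).
Proof. by move=> c x y; rewrite /phi fL tpure_linl. Qed.
Let phi_r v : linear (phi v).
Proof. by move=> c x y; rewrite /phi gL tpure_linr. Qed.

Lemma tmap_pure v w : tmap f g (tpure v w) = tpure (f v) (g w).
Proof. exact: (tlift_pure phi_l phi_r). Qed.

Lemma tmap_linear : linear (tmap f g).
Proof. exact: (tlift_linear phi_l phi_r). Qed.

End Map.

Lemma tens_ext (V W U : lmodType K) (F G : tens V W -> U) : linear F -> linear G ->
  (forall v w, F (tpure v w) = G (tpure v w)) -> forall z, F z = G z.
Proof.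
move=> FL GL FG; elim/tens_ind=> [|c x y IHx IHy|//]; first by rewrite !lin0.
by rewrite FL GL IHx IHy.
Qed.

Lemma tpure0l (V W : lmodType K) (w : W) : tpure (0 : V) w = 0.
Proof. exact: (lin0 (tpure_linear_l w)). Qed.

Lemma tpure0r (V W : lmodType K) (v : V) : tpure v (0 : W) = 0.
Proof. exact: (lin0 (tpure_linear_r v)). Qed.

Lemma tpureZl (V W : lmodType K) c (v : V) (w : W) : tpure (c *: v) w = c *: tpure v w.
Proof. exact: (linZ (tpure_linear_l w)). Qed.

Lemma tpureZr (V W : lmodType K) c (v : V) (w : W) : tpure v (c *: w) = c *: tpure v w.
Proof. exact: (linZ (tpure_linear_r v)). Qed.

Lemma linear_id (V : lmodType K) : linear (@idfun V).
Proof. by []. Qed.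

Lemma linear_zero (V W : lmodType K) : linear (fun _ : V => 0 : W).
Proof. by move=> c x y; rewrite scaler0 addr0. Qed.

Lemma linear_scale (V W : lmodType K) (k : K) (F : V -> W) : linear F ->
  linear (fun x => k *: F x).
Proof. by move=> FL c x y; rewrite FL scalerDr !scalerA mulrC. Qed.

Lemma linear_sum_fun (V W : lmodType K) I (r : seq I) (Q : pred I) (F : I -> V -> W) :
  (forall i, linear (F i)) -> linear (fun x => \sum_(i <- r | Q i) F i x).
Proof.
move=> FL c x y; rewrite scaler_sumr -big_split; apply: eq_bigr => i _ /=.
exact: FL.
Qed.

Lemma tmap_comp (V W V' W' V'' W'' : lmodType K) (f : V -> V') (g : W -> W')
    (f' : V' -> V'') (g' : W' -> W'') : linear f -> linear g -> linear f' -> linear g' ->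
  forall z, tmap f' g' (tmap f g z) = tmap (fun v => f' (f v)) (fun w => g' (g w)) z.
Proof.
move=> fL gL f'L g'L; apply: tens_ext.
- exact/linear_comp_fun/tmap_linear/gL/fL/tmap_linear.
- by apply: tmap_linear; apply: linear_comp_fun.
by move=> v w; rewrite !tmap_pure //; apply: linear_comp_fun.
Qed.

Lemma eq_tmap (V W V' W' : lmodType K) (f f' : V -> V') (g g' : W -> W') z :
  f =1 f' -> g =1 g' -> tmap f g z = tmap f' g' z.
Proof. by move=> /funext-> /funext->. Qed.

Lemma tmap_id (V W : lmodType K) (z : tens V W) : tmap idfun idfun z = z.
Proof.
move: z; apply: tens_ext => //; first exact: tmap_linear.
by move=> v w; rewrite tmap_pure.
Qed.

End TensorLinear.

(** * Homogeneous decompositions and the grading of a tensor product *)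

Section HomogeneousSums.
Context (K : fieldType).

Section OneFactor.
Context (V : gvect K) (gV : graded V) (U : lmodType K) (theta : int -> V -> U).
Hypothesis theta_lin : forall i, linear (theta i).

Lemma gsupp_uniq (x : V) : uniq (gsupp x).
Proof. by rewrite /gsupp; case: pselect => // e; case: (cid e) => s /= []. Qed.

Lemma gsupp0 (x : V) i : i \notin gsupp x -> gpr i x = 0.
Proof.
move=> ix; case: (gV) => gl gg _; rewrite (gsuppE x gV) (lin_sum (gl i)) big_seq big1 // => j jx.
by rewrite gg; case: eqVneq ix jx => // -> /negP.
Qed.

(** Components outside the chosen support vanish, so the supports of several elements can be
    enlarged to a common list. This is how linearity is obtained next. *)
Lemma gsupp_sum (x : V) s : uniq s -> {subset gsupp x <= s} ->
  \sum_(i <- gsupp x) theta i (gpr i x) = \sum_(i <- s) theta i (gpr i x).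
Proof.
move=> us xs; rewrite [RHS](bigID (mem (gsupp x))) /= [X in _ + X]big1 ?addr0.
  rewrite -[RHS]big_filter; apply: perm_big; apply: uniq_perm; rewrite ?filter_uniq ?gsupp_uniq //.
  by move=> i; rewrite mem_filter /=; case ix: (i \in gsupp x) => //=; rewrite xs.
by move=> i ix; rewrite gsupp0 // lin0.
Qed.

Lemma gsupp_sum_linear : linear (fun x : V => \sum_(i <- gsupp x) theta i (gpr i x)).
Proof.
move=> c x y; pose s := undup (gsupp (c *: x + y) ++ (gsupp x ++ gsupp y)).
have us : uniq s by apply: undup_uniq.
rewrite !(@gsupp_sum _ s) //; try by move=> i ix; rewrite mem_undup !mem_cat ix ?orbT.
rewrite scaler_sumr -big_split; apply: eq_bigr => i _ /=.
by case: (gV) => -> _ _; rewrite theta_lin.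
Qed.

Lemma gsupp_sum_hom j (x : V) : of_degree j x ->
  \sum_(i <- gsupp x) theta i (gpr i x) = theta j x.
Proof.
move=> hx; rewrite (@gsupp_sum x (undup (j :: gsupp x))) ?undup_uniq //; last first.
  by move=> i ix; rewrite mem_undup inE ix orbT.
rewrite (bigD1_seq j) ?undup_uniq ?mem_undup ?mem_head //= hx big1 ?addr0 // => i ij.
by rewrite -hx; case: (gV) => _ -> _; rewrite (negPf ij) lin0.
Qed.

End OneFactor.

Section TwoFactors.
Context (V W : gvect K) (gV : graded V) (gW : graded W) (U : lmodType K).
Context (psi : hpair V W -> U).
Hypothesis psi_l : forall i p w, linear (fun v => psi (HPair i v p w)).
Hypothesis psi_r : forall i v p, linear (fun w => psi (HPair i v p w)).

Let phi (v : V) (w : W) : U :=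
  \sum_(i <- gsupp v) \sum_(p <- gsupp w) psi (HPair i (gpr i v) p (gpr p w)).

Let phi_l w : linear (fun v => phi v w).
Proof.
apply: (gsupp_sum_linear gV (theta := fun i v =>
  \sum_(p <- gsupp w) psi (HPair i v p (gpr p w)))) => i.
by apply: linear_sum_fun => p.
Qed.

Let phi_r v : linear (phi v).
Proof.
apply: linear_sum_fun => i.
exact: (gsupp_sum_linear gW (theta := fun p w => psi (HPair i (gpr i v) p w))).
Qed.

(** The list [hdecomp z] depends on choices. When [psi] is linear in both components, the sum over
    it factors through the tensor product, by [hliftE], and is therefore canonical. *)
Definition hlift (z : tens V W) : U := \sum_(h <- hdecomp z) psi h.

Lemma hliftE z : hlift z = tlift phi z.
Proof.
rewrite /hlift big_flatten big_map /tlift fglift_sum; apply: eq_bigr => -[v w] _.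
rewrite big_allpairs_dep /= /phi scaler_sumr; apply: eq_bigr => i _.
rewrite scaler_sumr; apply: eq_bigr => p _.
by rewrite (linZ (@psi_l i p (gpr p w))).
Qed.

Lemma hlift_linear : linear hlift.
Proof. by move=> c x y; rewrite !hliftE (tlift_linear phi_l phi_r). Qed.

Lemma hlift_hom h : of_degree (hdeg1 h) (hfst h) -> of_degree (hdeg2 h) (hsnd h) ->
  hlift (tpure (hfst h) (hsnd h)) = psi h.
Proof.
case: h => i v p w /= hv hw; rewrite hliftE (tlift_pure phi_l phi_r) /phi.
under eq_bigr => j _.
  rewrite (gsupp_sum_hom gW (theta := fun p w => psi (HPair j (gpr j v) p w)) _ hw) //.
  over.
exact: (gsupp_sum_hom gV (theta := fun j v => psi (HPair j v p w)) _ hv).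
Qed.

End TwoFactors.

Section GradedTensor.
Context (V W : gvect K) (gV : graded V) (gW : graded W).
Notation T := (gtens V W).

Let psi m (h : hpair V W) : tens V W :=
  if hdeg1 h + hdeg2 h == m then tpure (hfst h) (hsnd h) else 0.

Let psi_l m i p w : linear (fun v => psi m (HPair i v p w)).
Proof.
rewrite /psi /=; case: (_ == m); [exact: tpure_linear_l|exact: linear_zero].
Qed.

Let psi_r m i v p : linear (fun w => psi m (HPair i v p w)).
Proof.
rewrite /psi /=; case: (_ == m); [exact: tpure_linear_r|exact: linear_zero].
Qed.

Lemma gtens_prE m (z : T) : gpr m z = hlift (psi m) z.
Proof. by rewrite /gpr /= big_mkcond. Qed.

Lemma gtens_pr_linear m : linear (@gpr K T m).
Proof.
by move=> c x y; rewrite !gtens_prE; apply: (hlift_linear gV gW (@psi_l m) (@psi_r m)).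
Qed.

Lemma gtens_pr_hom m i p (v : V) (w : W) : of_degree i v -> of_degree p w ->
  gpr m (tpure v w : T) = if i + p == m then tpure v w else 0.
Proof.
move=> hv hw; rewrite gtens_prE.
exact: (hlift_hom gV gW (@psi_l m) (@psi_r m) (h := HPair i v p w)).
Qed.

Lemma tens_hom_ind (P : T -> Prop) :
  P 0 -> (forall c x y, P x -> P y -> P (c *: x + y)) ->
  (forall i p v w, of_degree i v -> of_degree p w -> P (tpure v w)) -> forall z, P z.
Proof.
move=> P0 PL Pp; apply: tens_ind => // v w.
have PD x y : P x -> P y -> P (x + y) by move=> Px Py; rewrite -[x]scale1r; apply: PL.
rewrite (gsuppE v gV) (lin_sum (tpure_linear_l w)); apply: (big_ind P) => // i _.
rewrite (gsuppE w gW) (lin_sum (tpure_linear_r _)); apply: (big_ind P) => // p _.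
by apply: (Pp i p); apply: of_degree_gpr.
Qed.

Lemma gtens_graded : graded T.
Proof.
split=> [m|m m'|z]; first exact: gtens_pr_linear.
- elim/tens_hom_ind=> [|c x y IHx IHy|i p v w hv hw].
  + by rewrite !(lin0 (gtens_pr_linear _)) if_same.
  + by rewrite !(gtens_pr_linear _) IHx IHy; case: ifP => // _; rewrite scaler0 addr0.
  rewrite (gtens_pr_hom m' hv hw); case: (eqVneq (i + p) m') => [E|_].
    by rewrite (gtens_pr_hom m hv hw) E eq_sym.
  by rewrite (lin0 (gtens_pr_linear _)) if_same.
exists (undup [seq hdeg1 h + hdeg2 h | h <- hdecomp z]); split; first exact: undup_uniq.
rewrite {1}(hdecompE z gV gW) /gpr /= (exchange_big_dep xpredT) //=.
have : forall s, {subset [seq hdeg1 h + hdeg2 h | h <- hdecomp z] <= s} -> uniq s ->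
    \sum_(h <- hdecomp z) tpure (hfst h) (hsnd h) =
    \sum_(h <- hdecomp z) \sum_(i <- s | hdeg1 h + hdeg2 h == i) tpure (hfst h) (hsnd h).
  elim: (hdecomp z) => [|h hs IH] s sub us; first by rewrite !big_nil.
  rewrite !big_cons -IH //; last by move=> i ih; apply: sub; rewrite inE ih orbT.
  congr (_ + _); under eq_bigl do rewrite eq_sym.
  by rewrite -big_filter filter_pred1_uniq ?big_seq1 //; apply: sub; rewrite mem_head.
by apply; [move=> i; rewrite mem_undup|apply: undup_uniq].
Qed.

Lemma gtens_degree_ind m (P : T -> Prop) :
  P 0 -> (forall c x y, P x -> P y -> P (c *: x + y)) ->
  (forall i p v w, of_degree i v -> of_degree p w -> i + p = m -> P (tpure v w)) ->
  forall z, of_degree m z -> P z.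
Proof.
move=> P0 PL Pp z <-; elim/tens_hom_ind: z => [|c x y IHx IHy|i p v w hv hw].
- by rewrite (lin0 (gtens_pr_linear _)).
- by rewrite gtens_pr_linear; apply: PL.
by rewrite (gtens_pr_hom m hv hw); case: eqP => // E; apply: Pp E.
Qed.

Lemma of_degree_tpure i p (v : V) (w : W) : of_degree i v -> of_degree p w ->
  of_degree (i + p) (tpure v w : T).
Proof. by move=> hv hw; rewrite /of_degree (gtens_pr_hom _ hv hw) eqxx. Qed.

End GradedTensor.

End HomogeneousSums.

(** * Brackets on tensor products *)

Section Multilinear.
Context (K : fieldType) (V U : lmodType K).

Definition slot_linear (F : seq V -> U) : Prop :=
  forall (s1 s2 : seq V) c (x y : V),
    F (s1 ++ (c *: x + y) :: s2) = c *: F (s1 ++ x :: s2) + F (s1 ++ y :: s2).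

Fixpoint all_in (Gs : seq (V -> Prop)) (s : seq V) : Prop :=
  match Gs, s with
  | G :: Gs', x :: s' => G x /\ all_in Gs' s'
  | [::], [::] => True
  | _, _ => False
  end.

Lemma all_in_cat Gs Gs' s s' : all_in Gs s -> all_in Gs' s' -> all_in (Gs ++ Gs') (s ++ s').
Proof. by elim: Gs s => [|G Gs IH] [|x s] //= [Gx hs] hs'; split=> //; apply: IH. Qed.

Lemma all_in_nseq (G : V -> Prop) s : (forall x, G x) -> all_in (nseq (size s) G) s.
Proof. by move=> hG; elim: s => //= x s IH; split. Qed.

(** The slots are reduced to generators one at a time, [pre] holding those already reduced. With [H]
    the predicate of being zero this proves identities; with other choices it bounds degrees and
    filtration. *)
Lemma slot_linear_span (F : seq V -> U) (Gs : seq (V -> Prop)) (H : U -> Prop) :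
  slot_linear F -> (forall s, all_in Gs s -> span H (F s)) ->
  forall s, all_in [seq span G | G <- Gs] s -> span H (F s).
Proof.
move=> FL FG; suff gen pre Gpre s Gs' : all_in Gpre pre -> Gs = Gpre ++ Gs' ->
    all_in [seq span G | G <- Gs'] s -> span H (F (pre ++ s)).
  by move=> s; apply: (gen [::] [::]).
elim: s pre Gpre Gs' => [|x s IH] pre Gpre [|G Gs'] //= hpre E.
  by move=> _; apply: FG; rewrite E cats0 cats0.
move=> [hx hs]; elim: hx => [|{}x Gx|c y z _ IHy _ IHz].
- have := FL pre s (-1) 0 0; rewrite scaler0 addr0 scaleN1r addNr => ->; exact: span_0.
- rewrite -cat_rcons; apply: (IH _ (rcons Gpre G) Gs') => //; last by rewrite cat_rcons.
  by rewrite -!cats1; apply: all_in_cat.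
- by rewrite FL; apply: span_lin.
Qed.

Lemma span_eq0 (x : U) : span (fun y => y = 0) x -> x = 0.
Proof. by elim=> [//|//|c y z _ -> _ ->]; rewrite scaler0 addr0. Qed.

End Multilinear.

Section TensorBracket.
Context (K : fieldType) (g : brvect K) (gax : Linf_axioms g).
Context (A : dga K) (Aax : cdga_axioms A).
Notation hp := (hpair g A).
Notation T := (gtens g A).
Notation mul := (@dga_mul K A).
Implicit Types (h : hp) (hs : seq hp) (z : T).

Let gG : graded g. Proof. by case: gax. Qed.
Let AG : graded A := cdga_graded Aax.
Let br0 : br [::] = 0 :> g. Proof. by case: gax => _ []. Qed.
Let brL : br_multilinear g. Proof. by case: gax => _ []. Qed.
Let brD : br_degree g. Proof. by case: gax => _ []. Qed.
Let brA : br_antisym g. Proof. by case: gax => _ []. Qed.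

Let d_lin := cdga_d_linear Aax.

Lemma dga_prod_cat (I : Type) (s1 s2 : seq I) (F : I -> A) :
  \big[mul/dga_one A]_(i <- s1 ++ s2) F i =
  mul (\big[mul/dga_one A]_(i <- s1) F i) (\big[mul/dga_one A]_(i <- s2) F i).
Proof.
elim: s1 => [|i s1 IH] /=; first by rewrite big_nil (cdga_mul1 Aax).
by rewrite !big_cons IH (cdga_mulA Aax).
Qed.

Definition htensor h : T := tpure (hfst h) (hsnd h).
Definition hhom h : Prop := of_degree (hdeg1 h) (hfst h) /\ of_degree (hdeg2 h) (hsnd h).

Fixpoint all_hom hs : Prop := if hs is h :: hs' then hhom h /\ all_hom hs' else True.

Lemma all_hom_cat (s1 s2 : seq hp) : all_hom (s1 ++ s2) <-> all_hom s1 /\ all_hom s2.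
Proof. by elim: s1 => [|h s IH] /=; tauto. Qed.

Lemma all_hom_map (I : Type) (h : I -> hp) (s : seq I) : (forall i, hhom (h i)) ->
  all_hom [seq h i | i <- s].
Proof. by move=> hh; elim: s => //= i s IH; split. Qed.

(** The bracket of pure tensors is split into this part, given by one formula in all arities, and
    [dpure], the differential of forms, which occurs only in arity one. *)
Definition bpure hs : T := sgnz K (cross_degree hs) *:
  tpure (br [seq hfst h | h <- hs]) (\big[mul/dga_one A]_(h <- hs) hsnd h).

Definition dpure hs : T :=
  if hs is [:: h] then sgnz K (hdeg1 h) *: tpure (hfst h) (dga_d (hsnd h)) else 0.

Lemma tbr_pureE hs : tbr_pure hs = bpure hs + dpure hs.
Proof.
case: hs => [|h [|h' hs]].
- by rewrite /= /bpure /= br0 tpure0l scaler0 addr0.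
- rewrite /tbr_pure /bpure /dpure /= !big_cons !big_nil mulr0 addr0 /sgnz expr0z scale1r.
  by rewrite (cdga_mulr1 Aax).
- by rewrite /dpure addr0.
Qed.

Lemma cross_degree_slot (s1 s2 : seq hp) i v v' p w w' :
  cross_degree (s1 ++ (HPair i v p w : hp) :: s2) =
  cross_degree (s1 ++ (HPair i v' p w' : hp) :: s2).
Proof.
by elim: s1 => //= h s ->; rewrite !big_cat /= !big_cons.
Qed.

Lemma cross_degree_cat (s1 s2 : seq hp) : cross_degree (s1 ++ s2) =
  cross_degree s1 + (\sum_(h <- s1) hdeg2 h) * (\sum_(h <- s2) hdeg1 h) + cross_degree s2.
Proof.
elim: s1 => [|h s IH] /=; first by rewrite big_nil mul0r !add0r.
rewrite IH big_cat big_cons /=; ring.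
Qed.

Lemma bpure_slot_l (s1 s2 : seq hp) i p w : linear (fun v => bpure (s1 ++ HPair i v p w :: s2)).
Proof.
move=> c v v'; rewrite /bpure !(cross_degree_slot s1 s2 i _ 0 p _ 0).
rewrite !map_cat /= brL tpure_linl scalerDr !scalerA [_ * c]mulrC.
by rewrite !dga_prod_cat !big_cons.
Qed.

Lemma bpure_slot_r (s1 s2 : seq hp) i v p : linear (fun w => bpure (s1 ++ HPair i v p w :: s2)).
Proof.
move=> c w w'; rewrite /bpure !(cross_degree_slot s1 s2 i _ 0 p _ 0).
rewrite !map_cat /= !dga_prod_cat !big_cons /= (cdga_mulPl Aax) (cdga_mulPr Aax).
by rewrite tpure_linr scalerDr !scalerA mulrC.
Qed.

Lemma dpure_slot_l (s1 s2 : seq hp) i p w : linear (fun v => dpure (s1 ++ HPair i v p w :: s2)).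
Proof.
case: s1 s2 => [|h [|h' s1]] [|h2 s2] /=; try exact: linear_zero.
by apply: linear_scale; apply: tpure_linear_l.
Qed.

Lemma dpure_slot_r (s1 s2 : seq hp) i v p : linear (fun w => dpure (s1 ++ HPair i v p w :: s2)).
Proof.
case: s1 s2 => [|h [|h' s1]] [|h2 s2] /=; try exact: linear_zero.
by apply: linear_scale; apply: linear_comp_fun d_lin; apply: tpure_linear_r.
Qed.

Lemma tbr_pure_slot_l (s1 s2 : seq hp) i p w : linear (fun v => tbr_pure (s1 ++ HPair i v p w :: s2)).
Proof.
move=> c v v'; rewrite !tbr_pureE.
exact: (linearD_fun (@bpure_slot_l s1 s2 i p w) (@dpure_slot_l s1 s2 i p w)).
Qed.

Lemma tbr_pure_slot_r (s1 s2 : seq hp) i v p : linear (fun w => tbr_pure (s1 ++ HPair i v p w :: s2)).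
Proof.
move=> c v' v''; rewrite !tbr_pureE.
exact: (linearD_fun (@bpure_slot_r s1 s2 i v p) (@dpure_slot_r s1 s2 i v p)).
Qed.

Lemma sum_selections_cons (X : Type) (U : nmodType) (s : seq X) ss (F : seq X -> U) :
  \sum_(t <- selections (s :: ss)) F t = \sum_(x <- s) \sum_(t <- selections ss) F (x :: t).
Proof. by rewrite /= big_allpairs_dep. Qed.

Lemma sum_selections_cat (X : Type) (U : nmodType) (ss ss' : seq (seq X)) (F : seq X -> U) :
  \sum_(t <- selections (ss ++ ss')) F t =
  \sum_(t <- selections ss) \sum_(t' <- selections ss') F (t ++ t').
Proof.
elim: ss F => [|s ss IH] F; first by rewrite /= big_seq1.
rewrite cat_cons !sum_selections_cons; apply: eq_bigr => x _.
by rewrite IH.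
Qed.

Lemma tbr_slot s1 s2 z : tbr (s1 ++ z :: s2) =
  hlift (fun h => \sum_(t <- selections [seq hdecomp x | x <- s1])
    \sum_(t' <- selections [seq hdecomp x | x <- s2]) tbr_pure (t ++ h :: t')) z.
Proof.
rewrite /tbr map_cat sum_selections_cat /hlift [RHS]exchange_big; apply: eq_bigr => t _.
by rewrite sum_selections_cons.
Qed.

Lemma tbr_slot_linear : slot_linear (@tbr K g A).
Proof.
move=> s1 s2 c x y; rewrite !tbr_slot; apply: (hlift_linear gG AG) => i.
  by move=> p w; do 2![apply: linear_sum_fun => ?]; apply: tbr_pure_slot_l.
by move=> v p; do 2![apply: linear_sum_fun => ?]; apply: tbr_pure_slot_r.
Qed.

(** The entries are treated from the left. In each slot the sum over the decomposition is bilinear,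
    so on a homogeneous pure tensor it collapses to the tensor itself. *)
Lemma tbr_htensor hs : all_hom hs -> tbr [seq htensor h | h <- hs] = tbr_pure hs.
Proof.
rewrite /tbr -map_comp; suff gen pre : all_hom hs ->
    \sum_(t <- selections [seq (@hdecomp K g A \o htensor) h | h <- hs]) tbr_pure (pre ++ t) =
    tbr_pure (pre ++ hs) by apply: (gen [::]).
elim: hs pre => [|h hs IH] pre /=; first by rewrite big_seq1.
case=> -[h1 h2] hhs; rewrite sum_selections_cons /=.
transitivity (\sum_(x <- hdecomp (htensor h)) tbr_pure (pre ++ x :: hs)).
  apply: eq_bigr => x _; rewrite -cat_rcons -IH //; apply: eq_bigr => t _.
  by rewrite cat_rcons.
apply: (hlift_hom gG AG (psi := fun x => tbr_pure (pre ++ x :: hs))) => //.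
- by move=> i p w; apply: tbr_pure_slot_l.
- by move=> i v p; apply: tbr_pure_slot_r.
Qed.

Definition pure_of_degree (m : int) z : Prop := exists h, [/\ hhom h, hdeg1 h + hdeg2 h = m & z = htensor h].
Definition hom_pure z : Prop := exists2 h, hhom h & z = htensor h.

Lemma pure_of_degree_span m z : of_degree m z -> span (pure_of_degree m) z.
Proof.
apply: (gtens_degree_ind gG AG) => [|c x y|i p v w hv hw E]; first exact: span_0.
  exact: span_lin.
by apply: span_gen; exists (HPair i v p w).
Qed.

Lemma hom_pure_span z : span hom_pure z.
Proof.
move: z; apply: (tens_hom_ind gG AG) => [|c x y|i p v w hv hw]; first exact: span_0.
  exact: span_lin.
by apply: span_gen; exists (HPair i v p w).
Qed.

Lemma all_in_nseq_gen (G : T -> Prop) (P : hp -> Prop) (n : nat) s :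
  (forall z, G z -> exists h, P h /\ z = htensor h) -> all_in (nseq n G) s ->
  exists hs, [/\ s = [seq htensor h | h <- hs], size hs = n &
     foldr (fun h Q => P h /\ Q) True hs].
Proof.
move=> GP; elim: n s => [|n IH] [|x s] //=; first by exists [::].
case=> /GP[h [Ph ->]] /IH[hs [-> <- Phs]].
by exists (h :: hs).
Qed.

(** The difference F - G is multilinear and homogeneous pure tensors span, so [slot_linear_span]
    applies with zero as the target. *)
Lemma slot_linear_ext (U : lmodType K) (F G : seq T -> U) : slot_linear F -> slot_linear G ->
  (forall hs, all_hom hs -> F [seq htensor h | h <- hs] = G [seq htensor h | h <- hs]) ->
  forall s, F s = G s.
Proof.
move=> FL GL FG s; apply/eqP; rewrite -subr_eq0; apply/eqP; apply: span_eq0.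
apply: (@slot_linear_span K T U (fun s => F s - G s) (nseq (size s) hom_pure)).
- move=> s1 s2 c x y; rewrite FL GL opprD scalerBr -!addrA; congr (_ + _).
  by rewrite addrCA.
- move=> {}s /(all_in_nseq_gen (P := hhom)) [z [h hh ->]|hs [-> _ hhs]]; first by exists h.
  rewrite FG ?subrr; first exact: span_0.
  by elim: hs hhs => //= h hs IH [].
by rewrite map_nseq; apply: all_in_nseq; apply: hom_pure_span.
Qed.

End TensorBracket.

Section Sgnz.
Context (K : fieldType).

Lemma sgnz0 : sgnz K 0 = 1. Proof. by []. Qed.
Lemma sgnz1 : sgnz K 1 = -1. Proof. by []. Qed.

Lemma sgnz_sq p : sgnz K p * sgnz K p = 1.
Proof.
case: p => m; rewrite /sgnz /exprz; first by rewrite -expr2 sqrr_sign.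
by rewrite -invfM -expr2 sqrr_sign invr1.
Qed.

Lemma sgnzN1 : sgnz K (- 1) = -1.
Proof. by rewrite /sgnz exprN1 invrN1. Qed.

Lemma sgnz_double p : sgnz K (p + p) = 1.
Proof. by rewrite sgnzD sgnz_sq. Qed.

Lemma sgnz_even p q r : p = q + (r + r) -> sgnz K p = sgnz K q.
Proof. by move=> ->; rewrite sgnzD sgnz_double mulr1. Qed.

Lemma sgnz_odd_diff p q r : p = q + (r + r) + 1 -> sgnz K p = - sgnz K q.
Proof. by move=> ->; rewrite !sgnzD sgnz_sq sgnz1 mulrN1 mulr1. Qed.

End Sgnz.

Lemma map_nth_enum (X : Type) (x0 : X) (s : seq X) :
  [seq nth x0 s (i : 'I_(size s)) | i <- enum 'I_(size s)] = s.
Proof.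
by rewrite (map_comp (nth x0 s) (@nat_of_ord _)) val_enum_ord map_nth_iota0 ?take_size.
Qed.

(** * Degrees, filtration and antisymmetry of the brackets *)

Section TensorBracketMore.
Context (K : fieldType) (g : brvect K) (gax : Linf_axioms g).
Context (A : dga K) (Aax : cdga_axioms A).
Notation hp := (hpair g A).
Notation T := (gtens g A).
Notation mul := (@dga_mul K A).
Implicit Types (h : hp) (hs : seq hp) (z : T).

Let gG : graded g. Proof. by case: gax. Qed.
Let AG : graded A := cdga_graded Aax.
Let TG : graded T := gtens_graded gG AG.
Let br0 : br [::] = 0 :> g. Proof. by case: gax => _ []. Qed.
Let brL : br_multilinear g. Proof. by case: gax => _ []. Qed.
Let brD : br_degree g. Proof. by case: gax => _ []. Qed.
Let brA : br_antisym g. Proof. by case: gax => _ []. Qed.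

Let d_lin := cdga_d_linear Aax.

Lemma all_hom_nth hs h0 i : all_hom hs -> (i < size hs)%N -> hhom (nth h0 hs i).
Proof. by elim: hs i => //= h hs IH [|i] [hh hhs] // i_lt; apply: IH. Qed.

Lemma br_deg_list hs : (0 < size hs)%N -> all_hom hs ->
  of_degree (\sum_(h <- hs) hdeg1 h + 2 - (size hs)%:Z) (br [seq hfst h | h <- hs]).
Proof.
case: hs => // h0 hs0; set hs := h0 :: hs0 => hs_gt0 hhs.
have := brD (k := size hs) (d := fun i => hdeg1 (nth h0 hs i)) (x := fun i => hfst (nth h0 hs i)).
rewrite (map_comp (@hfst _ _ _) (fun i : 'I_(size hs) => nth h0 hs i)) map_nth_enum.
rewrite [X in _ -> _ -> of_degree (X + _ - _) _](_ : _ = \sum_(h <- hs) hdeg1 h).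
  by apply=> // i; case: (all_hom_nth h0 hhs (ltn_ord i)).
by rewrite (big_nth h0) big_mkord.
Qed.

Lemma dga_prod_deg hs : all_hom hs ->
  of_degree (\sum_(h <- hs) hdeg2 h) (\big[mul/dga_one A]_(h <- hs) hsnd h).
Proof.
elim: hs => [|h hs IH] /=; first by rewrite !big_nil => _; apply: (cdga_deg1 Aax).
by case=> -[_ hh] /IH hhs; rewrite !big_cons; apply: (cdga_degM Aax).
Qed.

(** The value [bpure hs] is again a homogeneous pure tensor. Recording its two factors with their
    degrees lets it be an entry of an outer bracket. *)
Definition bpair hs : hp :=
  HPair (\sum_(h <- hs) hdeg1 h + 2 - (size hs)%:Z)
    (sgnz K (cross_degree hs) *: br [seq hfst h | h <- hs])
    (\sum_(h <- hs) hdeg2 h) (\big[mul/dga_one A]_(h <- hs) hsnd h).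

Lemma bpureE hs : bpure hs = htensor (bpair hs).
Proof. by rewrite /htensor /= tpureZl. Qed.

Lemma bpair_hom hs : (0 < size hs)%N -> all_hom hs -> hhom (bpair hs).
Proof.
move=> hs0 hhs; split; last exact: dga_prod_deg.
by apply: of_degreeZ => //; apply: br_deg_list.
Qed.

Definition dpair h : hp :=
  HPair (hdeg1 h) (sgnz K (hdeg1 h) *: hfst h) (hdeg2 h + 1) (dga_d (hsnd h)).

Lemma dpureE h : dpure [:: h] = htensor (dpair h).
Proof. by rewrite /htensor /= tpureZl. Qed.

Lemma dpair_hom h : hhom h -> hhom (dpair h).
Proof. by case=> h1 h2; split; [apply: of_degreeZ|apply: (cdga_d_deg Aax)]. Qed.

Lemma htensor_deg h : hhom h -> of_degree (hdeg1 h + hdeg2 h) (htensor h).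
Proof. by case=> h1 h2; apply: of_degree_tpure. Qed.

Lemma span_of_degree m z : span (of_degree (V := T) m) z -> of_degree m z.
Proof.
by elim=> [|//|c x y _ hx _ hy]; [apply: of_degree0|apply: of_degreeP].
Qed.

Lemma tbr1_htensor h : hhom h -> tbr [:: htensor h] = tbr_pure [:: h].
Proof. by move=> hh; apply: (tbr_htensor gax Aax (hs := [:: h])). Qed.

Lemma tbr1_linear : linear (fun z => tbr [:: z]).
Proof. exact: (tbr_slot_linear gax Aax [::] [::]). Qed.

Lemma tbr1_deg m z : of_degree m z -> of_degree (m + 1) (tbr [:: z]).
Proof.
move: z; apply: (gtens_degree_ind gG AG (P := fun z => of_degree (m + 1) (tbr [:: z])))
  => [|c x y|i p v w hv hw E].
- by rewrite (lin0 tbr1_linear); apply: of_degree0.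
- by rewrite tbr1_linear; apply: of_degreeP.
rewrite -[tpure v w]/(htensor (HPair i v p w)) tbr1_htensor // (tbr_pureE gax Aax) bpureE dpureE.
apply: of_degreeD => //.
  have := htensor_deg (bpair_hom (hs := [:: HPair i v p w]) isT (conj (conj hv hw) I)).
  by rewrite /= !big_seq1 /= (_ : i + 2 - 1 + p = m + 1) // -E; ring.
have := htensor_deg (dpair_hom (h := HPair i v p w) (conj hv hw)).
by rewrite /= addrA E.
Qed.

Lemma all_hom_deg1 n (s : seq T) : all_in (nseq n (pure_of_degree 1)) s ->
  exists hs, [/\ s = [seq htensor h | h <- hs], size hs = n, all_hom hs &
    \sum_(h <- hs) (hdeg1 h + hdeg2 h) = n%:Z].
Proof.
case/(all_in_nseq_gen (P := fun h => hhom h /\ hdeg1 h + hdeg2 h = 1)) => [z [h [hh E ->]]|].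
  by exists h.
move=> hs [-> sz Phs]; exists hs; split=> //; first by elim: hs Phs {sz} => //= h hs IH [[? ?] /IH].
rewrite -sz; elim: hs Phs {sz} => [|h hs IH] /=; first by rewrite big_nil.
by case=> -[_ E] /IH E'; rewrite big_cons E' E; lia.
Qed.

(** The k entries contribute k to the degree and the k-ary operation 2 - k. *)
Lemma tbr_deg1 (s : seq T) : (0 < size s)%N -> all_in (nseq (size s) (of_degree 1)) s ->
  of_degree 2 (tbr s).
Proof.
move=> s0 hs; apply: span_of_degree.
apply: (slot_linear_span (Gs := nseq (size s) (pure_of_degree 1)) (tbr_slot_linear gax Aax)); last first.
  elim: {s0} s hs => //= x s IH [hx /IH hs]; split=> //.
  exact: (pure_of_degree_span gax Aax).
move=> {hs} s' /all_hom_deg1[hs [-> sz hhs E]]; apply: span_gen.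
rewrite tbr_htensor // tbr_pureE //; rewrite -sz in s0 E; move: E; rewrite big_split /= => E.
apply: of_degreeD => //.
  rewrite bpureE; have := htensor_deg (bpair_hom s0 hhs).
  by rewrite (_ : hdeg1 _ + hdeg2 _ = 2) //= -E; ring.
case: hs {sz} s0 E hhs => // h [|h' hs] _ E [hh _]; last exact: of_degree0.
rewrite dpureE; have := htensor_deg (dpair_hom hh).
by rewrite (_ : hdeg1 _ + hdeg2 _ = 2) //=; move: E; rewrite !big_seq1 /=; lia.
Qed.

Lemma Fil_br_list (s : seq (nat * g)) : (2 <= size s)%N ->
  (forall i, (i < size s)%N -> Fil (nth (0%N, 0) s i).1 (nth (0%N, 0) s i).2) ->
  Fil (\sum_(x <- s) x.1)%N (br [seq x.2 | x <- s]).
Proof.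
move=> s2 hs.
have := @Fil_br K g (size s) (fun i => (nth (0%N, 0) s i).1) (fun i => (nth (0%N, 0) s i).2) s2.
rewrite (map_comp snd (fun i : 'I_(size s) => nth (0%N, 0) s i)) map_nth_enum.
rewrite (big_nth (0%N, 0)) big_mkord; apply=> j; exact: hs.
Qed.

(* The bracket filtration of g, made of homogeneous elements and made decreasing: F^3 need not
   be contained in F^2 when the only higher bracket is ternary. *)
Definition fil_gen (i : nat) z : Prop :=
  exists h, [/\ hhom h, exists2 j, (i <= j)%N & Fil j (hfst h) & z = htensor h].
Definition tfil (i : nat) : T -> Prop := span (fil_gen i).

Lemma tfil1 z : tfil 1 z.
Proof.
move: z; apply: (tens_hom_ind gG AG) => [|c x y|i p v w hv hw]; first exact: span_0.
  exact: span_lin.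
apply: span_gen; exists (HPair i v p w); split=> //; exists 1%N => //; exact: Fil_1.
Qed.

Lemma tfil_nilp N : (forall i, (N <= i)%N -> forall x : g, Fil i x -> x = 0) ->
  forall z, tfil N z -> z = 0.
Proof.
move=> gN z; elim=> [//|x [h [_ [j Nj hj] ->]]|c x y _ -> _ ->].
  by rewrite /htensor (gN j Nj _ hj) tpure0l.
by rewrite scaler0 addr0.
Qed.

(** On generators, every entry other than z contributes at least 1 to the filtration index, and
    there is at least one such entry. *)
Lemma tfil_bracket i s1 s2 z : (0 < size s1 + size s2)%N -> tfil i z ->
  tfil i.+1 (tbr (s1 ++ z :: s2)).
Proof.
move=> s12 hz.
pose Gs := nseq (size s1) (@hom_pure K g A) ++ fil_gen i :: nseq (size s2) (@hom_pure K g A).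
apply: (slot_linear_span (Gs := Gs) (tbr_slot_linear gax Aax)); last first.
  rewrite map_cat /= !map_nseq; apply: all_in_cat; last split=> //;
  by apply: all_in_nseq; apply: hom_pure_span.
have anyP n s : all_in (nseq n (@hom_pure K g A)) s ->
    exists hs, [/\ s = [seq htensor h | h <- hs], size hs = n & all_hom hs].
  case/(all_in_nseq_gen (P := @hhom K g A)) => [x [h hh ->]|hs [-> sz hhs]]; first by exists h.
  by exists hs; split=> //; elim: hs hhs {sz} => //= h hs IH [].
have splitG n (G : T -> Prop) n' s : all_in (nseq n (@hom_pure K g A) ++ G :: nseq n' (@hom_pure K g A)) s ->
    exists a x b, [/\ s = a ++ x :: b, all_in (nseq n (@hom_pure K g A)) a, G x
      & all_in (nseq n' (@hom_pure K g A)) b].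
  elim: n s => [|n IH] [|x s] //=; first by case=> Gx hs; exists [::], x, s.
  by case=> hx /IH[a [y [b [-> ha Gy hb]]]]; exists (x :: a), y, b.
move=> s /splitG[a [x [b [-> /anyP[ha [-> sza hha]] [h [hh [j ij hj] ->]] /anyP[hb [-> szb hhb]]]]]].
have -> : [seq htensor h | h <- ha] ++ htensor h :: [seq htensor h | h <- hb] =
    [seq htensor h | h <- ha ++ h :: hb] by rewrite map_cat.
have hall : all_hom (ha ++ h :: hb) by apply/all_hom_cat.
have sz : (2 <= size (ha ++ h :: hb))%N by rewrite size_cat /= sza szb; lia.
rewrite tbr_htensor // tbr_pureE //.
have -> : dpure (ha ++ h :: hb) = 0 by move: sz; case: (ha ++ h :: hb) => [|? [|? ?]].
rewrite addr0 bpureE; apply: span_gen; exists (bpair (ha ++ h :: hb)).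
split=> //; first by apply: bpair_hom => //; apply: ltnW.
exists (size ha + j + size hb)%N; first by rewrite sza szb; lia.
(* The sign in [bpair] is absorbed by [Fil_lin], for which 0 must lie in the same step; [Fil_0]
   provides it since the index is positive. *)
rewrite /=; rewrite -[_ *: _]addr0.
have := @Fil_br_list ([seq (1%N, hfst h) | h <- ha] ++ (j, hfst h) :: [seq (1%N, hfst h) | h <- hb]).
rewrite !map_cat /= -!map_comp big_cat big_cons !big_map /= !sum1_size addnA => H.
apply: Fil_lin; last by apply: Fil_0; move: sz; rewrite size_cat /=; case: (size ha) (size hb) => [|?] [|?] //; lia.
apply: H; first by move: sz; rewrite !size_cat /= !size_map.
move=> k; rewrite size_cat /= !size_map => k_lt; rewrite nth_cat size_map.
case: ltnP => k_ha; first by rewrite (nth_map h) //; apply: Fil_1.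
case E: (k - size ha)%N => [|l] //=.
rewrite (nth_map h); first exact: Fil_1.
by move: k_lt E; lia.
Qed.

(** All entries lie in F^1, so for at least two of them the bracket in g lies in the step given by
    their number. *)
Lemma tbr_nilp N (s : seq T) : (forall i, (N <= i)%N -> forall x : g, Fil i x -> x = 0) ->
  (N <= size s)%N -> (2 <= size s)%N -> tbr s = 0.
Proof.
move=> gN Ns s2; apply: span_eq0.
apply: (slot_linear_span (Gs := nseq (size s) (@hom_pure K g A)) (tbr_slot_linear gax Aax)); last first.
  by rewrite map_nseq; apply: all_in_nseq; apply: hom_pure_span.
move=> s' /(all_in_nseq_gen (P := @hhom K g A)) [x [h hh ->]|hs [-> sz hhs]]; first by exists h.
have {}hhs : all_hom hs by elim: hs hhs {sz} => //= h hs IH [].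
rewrite -sz in Ns s2; apply: span_gen; rewrite tbr_htensor // tbr_pureE //.
have -> : dpure hs = 0 by move: s2; case: (hs) => [|? [|? ?]].
rewrite addr0 /bpure; have := @Fil_br_list [seq (1%N, hfst h) | h <- hs].
rewrite size_map -map_comp big_map sum1_size => /(_ s2) H.
rewrite (gN _ Ns _ (H _)) ?tpure0l ?scaler0 // => i i_lt.
case: hs i_lt {H sz hhs Ns s2} => // h hs i_lt; rewrite (nth_map h) //; exact: Fil_1.
Qed.

(** The sign in total degrees combines the antisymmetry in g, the commutation of the two forms and
    the change of [cross_degree]. *)
Lemma bpure_swap s1 s2 h h' : hhom h -> hhom h' ->
  bpure (s1 ++ h :: h' :: s2) =
  - (sgnz K ((hdeg1 h + hdeg2 h) * (hdeg1 h' + hdeg2 h')) *: bpure (s1 ++ h' :: h :: s2)).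
Proof.
move=> [hx ha] [hx' ha']; rewrite /bpure !map_cat /=.
have /eqP := brA [seq hfst h | h <- s1] [seq hfst h | h <- s2] hx hx'.
rewrite addr_eq0 => /eqP ->; rewrite !dga_prod_cat // !big_cons.
rewrite [mul (hsnd h) _](cdga_mulA Aax) (cdga_mulC Aax ha ha').
rewrite -[_ *: mul (hsnd h') (hsnd h)]addr0 (cdga_mulPl Aax).
have mul0r x : mul 0 x = 0 by have := cdga_mulPl Aax (-1) 0 0 x; rewrite scaler0 addr0 scaleN1r addNr.
have mulr0 x : mul x 0 = 0 by have := cdga_mulPr Aax (-1) 0 0 x; rewrite scaler0 addr0 scaleN1r addNr.
rewrite mul0r -(cdga_mulA Aax) (cdga_mulPr Aax) mulr0 addr0.
rewrite -scaleNr tpureZl tpureZr !scalerA -scaleNr; congr (_ *: _).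
rewrite !cross_degree_cat /= !big_cons.
set C := cross_degree s1; set D := cross_degree s2.
set x1 := \sum_(h <- s1) hdeg2 h; set x2 := \sum_(h <- s2) hdeg1 h.
rewrite mulNr mulrN; congr (- _); rewrite -!sgnzD.
(* The exponents of the two signs differ by twice the integer supplied here; the same device settles
   the later comparisons of signs. *)
apply: (@sgnz_even _ _ _ (- (hdeg1 h * hdeg2 h'))); ring.
Qed.

End TensorBracketMore.

(** * Naturality of the brackets in the algebra and in the forms *)

Section Naturality.
Context (K : fieldType) (g g' : brvect K) (gax : Linf_axioms g) (gax' : Linf_axioms g').
Context (A B : dga K) (Aax : cdga_axioms A) (Bax : cdga_axioms B).
Context (f : g -> g') (phi : A -> B) (phi_m : dga_morphism phi).
Hypothesis f_lin : linear f.
Hypothesis f_deg : forall (i : int) (x : g), of_degree i x -> of_degree i (f x).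
Hypothesis f_br : forall s : seq g, (0 < size s)%N -> f (br s) = br [seq f x | x <- s].

Let phi_lin := dga_morph_linear phi_m.

Lemma tmap_tbr (s : seq (gtens g A)) :
  tmap f phi (tbr s) = tbr [seq (tmap f phi : gtens g A -> gtens g' B) z | z <- s].
Proof.
have tl := tmap_linear f_lin phi_lin.
move: s; apply: (slot_linear_ext gax Aax).
- by move=> s1 s2 c x y; rewrite (tbr_slot_linear gax Aax) tl.
- by move=> s1 s2 c x y; rewrite !map_cat /= tl (tbr_slot_linear gax' Bax).
move=> hs hhs; pose fp (h : hpair g A) : hpair g' B :=
  HPair (hdeg1 h) (f (hfst h)) (hdeg2 h) (phi (hsnd h)).
rewrite tbr_htensor // -map_comp.
rewrite (eq_map (g := @htensor K g' B \o fp)); last by move=> h; rewrite /= /htensor tmap_pure.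
have hfp : all_hom [seq fp h | h <- hs].
  elim: hs hhs => //= h hs IH [[hx ha] /IH hhs]; split=> //; split; first exact: f_deg.
  exact: (dga_morph_deg phi_m).
rewrite map_comp tbr_htensor // !tbr_pureE // (linD tl).
have crossE : cross_degree [seq fp h | h <- hs] = cross_degree hs.
  by elim: (hs) => //= h s ->; rewrite big_map.
have prodE : phi (\big[@dga_mul K A/dga_one A]_(h <- hs) hsnd h) =
    \big[@dga_mul K B/dga_one B]_(h <- [seq fp h | h <- hs]) hsnd h.
  elim: (hs) => [|h s IH]; first by rewrite !big_nil (dga_morph1 phi_m).
  by rewrite /= !big_cons (dga_morphM phi_m) IH.
congr (_ + _).
  rewrite /bpure (linZ tl) tmap_pure // prodE crossE -!map_comp.
  case: (hs) => [|h s]; last by rewrite f_br // -map_comp.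
  have br0 : br [::] = 0 :> g by case: gax => _ [].
  have br0' : br [::] = 0 :> g' by case: gax' => _ [].
  by rewrite /= br0 br0' (lin0 f_lin).
case: (hs) => [|h [|h' s]] /=; rewrite ?(lin0 tl) //.
by rewrite (linZ tl) tmap_pure // (dga_morph_d phi_m).
Qed.

Lemma tmap_deg m (z : gtens g A) : of_degree m z -> of_degree m (tmap f phi z : gtens g' B).
Proof.
have gG : graded g by case: gax.
have gG' : graded g' by case: gax'.
have tl := tmap_linear f_lin phi_lin.
move: z; apply: (gtens_degree_ind gG (cdga_graded Aax)
  (P := fun z => of_degree m (tmap f phi z : gtens g' B))) => [|c x y|i p v w hv hw E].
- by rewrite (lin0 tl); apply/of_degree0/gtens_graded/cdga_graded.
- by rewrite tl; apply/of_degreeP/gtens_graded/cdga_graded.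
rewrite tmap_pure // -E; apply: of_degree_tpure => //; first exact: cdga_graded.
  exact: f_deg.
exact: (dga_morph_deg phi_m).
Qed.

End Naturality.

Lemma big_take_index (I : eqType) (L : seq I) i : i \in L ->
  L = take (index i L) L ++ i :: drop (index i L).+1 L.
Proof.
by move=> iL; rewrite -[LHS](cat_take_drop (index i L)) (drop_nth i) ?index_mem // nth_index.
Qed.

(** * The Jacobi identity in total degree one *)

Section Leibniz.
Context (K : fieldType) (A : dga K) (Aax : cdga_axioms A).
Notation mul := (@dga_mul K A).
Notation dprod s F := (\big[mul/dga_one A]_(j <- s) F j).

Lemma dga_mul0l x : mul 0 x = 0.
Proof. by have := cdga_mulPl Aax (-1) 0 0 x; rewrite scaler0 addr0 scaleN1r addNr. Qed.

Lemma dga_mul0r x : mul x 0 = 0.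
Proof. by have := cdga_mulPr Aax (-1) 0 0 x; rewrite scaler0 addr0 scaleN1r addNr. Qed.

Lemma dga_mulZr c x y : mul x (c *: y) = c *: mul x y.
Proof. by have := cdga_mulPr Aax c y 0 x; rewrite !addr0 dga_mul0r addr0. Qed.

Lemma dga_mulZl c x y : mul (c *: x) y = c *: mul x y.
Proof. by have := cdga_mulPl Aax c x 0 y; rewrite !addr0 dga_mul0l addr0. Qed.

Lemma dga_mul_sumr (I : Type) (s : seq I) (F : I -> A) x :
  mul x (\sum_(i <- s) F i) = \sum_(i <- s) mul x (F i).
Proof. by apply: (lin_sum (F := mul x)) => c y z; rewrite (cdga_mulPr Aax). Qed.

Lemma dga_d1 : dga_d (dga_one A) = 0.
Proof.
have := cdga_dM Aax (dga_one A) (cdga_deg1 Aax); rewrite !(cdga_mul1 Aax) (cdga_mulr1 Aax).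
by rewrite sgnz0 scale1r => /eqP; rewrite -subr_eq0 opprD addrA subrr sub0r oppr_eq0 => /eqP.
Qed.

Lemma dga_d_prod (I : eqType) (L : seq I) (F : I -> A) (p : I -> int) : uniq L ->
  (forall i, of_degree (p i) (F i)) ->
  dga_d (dprod L F) =
  \sum_(i <- L) sgnz K (\sum_(j <- take (index i L) L) p j) *:
    mul (dprod (take (index i L) L) F)
      (mul (dga_d (F i)) (dprod (drop (index i L).+1 L) F)).
Proof.
move=> + Fp; elim: L => [|j L IH] /=; first by rewrite !big_nil dga_d1.
case/andP=> jL uL; rewrite !big_cons (cdga_dM Aax _ (Fp j)) IH // eqxx /= drop0 !big_nil.
rewrite sgnz0 scale1r (cdga_mul1 Aax) dga_mul_sumr scaler_sumr; congr (_ + _).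
apply: eq_big_seq => i iL; have /negPf-> : j != i by apply: contraNneq jL => ->.
by rewrite /= !big_cons dga_mulZr scalerA -sgnzD (cdga_mulA Aax).
Qed.

End Leibniz.

Section JacobiPure.
Context (K : fieldType) (g : brvect K) (gax : Linf_axioms g).
Context (A : dga K) (Aax : cdga_axioms A).
Notation hp := (hpair g A).
Notation T := (gtens g A).
Notation mul := (@dga_mul K A).

Let gG : graded g. Proof. by case: gax. Qed.
Let brL : br_multilinear g. Proof. by case: gax => _ []. Qed.
Let brJ : br_jacobi g. Proof. by case: gax => _ []. Qed.

Context (n : nat) (n_gt0 : (0 < n)%N) (h : 'I_n -> hp).
Hypothesis hh : forall i, hhom (h i).
Hypothesis h1 : forall i, hdeg1 (h i) + hdeg2 (h i) = 1.

Notation x := (fun i => hdeg1 (h i)).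
Notation L := (enum 'I_n).

(** The form factor of a nested bracket whose entries appear in the order l, together with the sign
    of moving forms past elements of g. *)
Definition signed_prod (l : seq 'I_n) : A :=
  sgnz K (cross_degree [seq h i | i <- l]) *: \big[mul/dga_one A]_(i <- l) hsnd (h i).

(** In total degree 1 the degree of a form is 1 minus that of its partner in g. Commuting the forms
    and correcting the crossing sign then gives exactly the factor of [shuffle_sign] for one
    inversion. *)
Lemma signed_prod_swap s1 s2 i j : signed_prod (s1 ++ i :: j :: s2) =
  - sgnz K (x i * x j) *: signed_prod (s1 ++ j :: i :: s2).
Proof.
have [_ ai] := hh i; have [_ aj] := hh j.
rewrite /signed_prod !(dga_prod_cat Aax) !big_cons.
rewrite [mul (hsnd (h i)) _](cdga_mulA Aax) (cdga_mulC Aax ai aj).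
rewrite (dga_mulZl Aax) (dga_mulZr Aax) -(cdga_mulA Aax) !scalerA; congr (_ *: _).
rewrite !map_cat /= !cross_degree_cat /= !big_cons.
set C := cross_degree _; set D := cross_degree _; set y1 := \sum_(_ <- _) _.
set y2 := \sum_(_ <- _) _; rewrite mulNr -!sgnzD.
have -> : hdeg2 (h i) = 1 - hdeg1 (h i) by rewrite -(h1 i); ring.
have -> : hdeg2 (h j) = 1 - hdeg1 (h j) by rewrite -(h1 j); ring.
apply: (@sgnz_odd_diff _ _ _ (- hdeg1 (h i))); ring.
Qed.

Lemma signed_prod_move pre s post i : signed_prod (pre ++ s ++ i :: post) =
  (\prod_(j <- s) (- sgnz K (x i * x j))) *: signed_prod (pre ++ i :: s ++ post).
Proof.
elim: s pre => [|j s IH] pre; first by rewrite big_nil scale1r.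
rewrite cat_cons -cat_rcons IH cat_rcons signed_prod_swap scalerA big_cons.
by rewrite mulrC [hdeg1 (h j) * _]mulrC.
Qed.

(** The product of the signs of all inversions created when the entries satisfying p are moved to
    the front of l; [inv_signE] matches it with [shuffle_sign]. *)
Fixpoint inv_sign (p : pred 'I_n) (l : seq 'I_n) : K :=
  if l is i :: l' then
    (if p i then 1 else \prod_(j <- l' | p j) (- sgnz K (x i * x j))) * inv_sign p l'
  else 1.

Lemma signed_prod_merge p l pre :
  signed_prod (pre ++ filter p l ++ filter (predC p) l) = inv_sign p l *: signed_prod (pre ++ l).
Proof.
elim: l pre => [|i l IH] pre /=; first by rewrite scale1r.
case pi: (p i) => /=; first by rewrite -cat_rcons IH cat_rcons mul1r.
by rewrite signed_prod_move -cat_rcons IH cat_rcons scalerA big_filter.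
Qed.

Lemma inv_signE p l : sorted (fun i j : 'I_n => (i < j)%N) l ->
  inv_sign p l =
  \prod_(j <- l | ~~ p j) \prod_(i <- l | p i && (j < i)%N) (- sgnz K (x j * x i)).
Proof.
elim: l => [|i l IH] /=; first by rewrite big_nil.
move=> pl; rewrite IH; last exact: path_sorted pl.
have lt_i j : j \in l -> (i < j)%N.
  apply/allP: j; apply: order_path_min pl => a b c; exact: ltn_trans.
rewrite big_cons; have -> : \prod_(j <- l | ~~ p j) \prod_(i0 <- l | p i0 && (j < i0)%N)
     (- sgnz K (x j * x i0)) = \prod_(j <- l | ~~ p j) \prod_(i0 <- i :: l | p i0 && (j < i0)%N)
     (- sgnz K (x j * x i0)).
  rewrite big_seq_cond [RHS]big_seq_cond; apply: eq_bigr => j /andP[jl _].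
  by rewrite big_cons [(j < i)%N]ltnNge ltnW ?lt_i // andbF.
case: (p i) => /=; first by rewrite mul1r.
congr (_ * _); rewrite big_cons ltnn andbF big_seq_cond [RHS]big_seq_cond.
by apply: eq_bigl => j; case jl: (j \in l) => //=; rewrite lt_i ?andbT.
Qed.

Lemma enum_filter (I : {set 'I_n}) : enum I = filter (mem I) L.
Proof. by rewrite [in RHS]enumT. Qed.

Lemma enumC_filter (I : {set 'I_n}) : enum (~: I) = filter (predC (mem I)) L.
Proof. by rewrite enum_filter; apply: eq_filter => i; rewrite -[LHS]/(i \in ~: I) inE. Qed.

Lemma signed_prod_shuffle (I : {set 'I_n}) :
  signed_prod (enum I ++ enum (~: I)) = shuffle_sign K x I *: signed_prod L.
Proof.
rewrite enumC_filter enum_filter -[in LHS](cat0s (filter (mem I) L ++ _)) signed_prod_merge /=.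
congr (_ *: _); rewrite inv_signE; last first.
  have := sorted_enum_ord [set: 'I_n]; congr sorted; apply: eq_enum => i; exact: in_setT.
rewrite /shuffle_sign [RHS](exchange_big_dep [pred j | j \notin I]) /=; last first.
  by move=> i j _; rewrite !inE => /andP[].
rewrite big_enum_cond; apply: eq_big => [j|j /andP[_ jI]]; first by rewrite ?inE ?andbT.
rewrite big_enum_cond; apply: eq_big => [i|i _]; last by rewrite mulrC.
by rewrite /= !inE jI.
Qed.

Lemma br_head_linear (s : seq g) : linear (fun y => br (y :: s)).
Proof. by move=> c y z; apply: (brL [::]). Qed.

Lemma bpure_bpair (I : {set 'I_n}) :
  bpure (bpair [seq h i | i <- enum I] :: [seq h j | j <- enum (~: I)]) =
  shuffle_sign K x I *:
    tpure (br (br [seq hfst (h i) | i <- enum I] :: [seq hfst (h j) | j <- enum (~: I)]))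
      (signed_prod L).
Proof.
rewrite -tpureZr -signed_prod_shuffle /signed_prod /bpure /= tpureZr.
rewrite (linZ (br_head_linear _)) tpureZl scalerA -!map_comp big_cons !big_map /=.
rewrite (dga_prod_cat Aax) map_cat cross_degree_cat !big_map; congr (_ *: _).
rewrite -sgnzD; congr sgnz; ring.
Qed.

(** After reordering, all terms share the form factor [signed_prod L], and what multiplies it is the
    Jacobi sum of g. *)
Lemma sum_bpure_bpair :
  \sum_(1 <= k < n.+1) (-1) ^+ k *: \sum_(I : {set 'I_n} | #|I| == k)
    bpure (bpair [seq h i | i <- enum I] :: [seq h j | j <- enum (~: I)]) = 0.
Proof.
have := brJ n_gt0 (fun i => (hh i).1) => J.
rewrite -[RHS](tpure0l _ (signed_prod L)) -J (lin_sum (tpure_linear_l _)).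
apply: eq_bigr => k _; rewrite (linZ (tpure_linear_l _)); congr (_ *: _).
rewrite -[in RHS]big_filter (lin_sum (tpure_linear_l _)) big_filter; apply: eq_bigr => I _.
by rewrite bpure_bpair tpureZl.
Qed.

Lemma sum_card_sign (U : lmodType K) (F : {set 'I_n} -> U) :
  \sum_(1 <= k < n.+1) (-1) ^+ k *: \sum_(I : {set 'I_n} | #|I| == k) F I =
  \sum_(I : {set 'I_n} | I != set0) (-1) ^+ #|I| *: F I.
Proof.
under eq_bigr => k _ do rewrite scaler_sumr.
rewrite (exchange_big_dep xpredT) //= [RHS]big_mkcond; apply: eq_bigr => I _ /=.
rewrite -big_filter; have [->|I0] := eqVneq I set0.
  rewrite cards0 big_filter big_nat_cond big_pred0 // => k.
  by case: k => // k; rewrite andbF.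
rewrite (_ : [seq k <- _ | _] = [:: #|I|]) ?big_seq1 //.
rewrite -(@filter_pred1_uniq _ (index_iota 1 n.+1) #|I|) ?iota_uniq //.
  by apply: eq_filter => k; rewrite /= eq_sym.
by rewrite mem_index_iota card_gt0 I0 ltnS -[X in (_ <= X)%N](card_ord n) max_card.
Qed.

(** The Koszul sign of an element of degree 2 with one of degree 1 is trivial, so each exchange
    costs only the -1 of antisymmetry. *)
Lemma bpure_move (hd : hp) pre s post : hhom hd -> hdeg1 hd + hdeg2 hd = 2 ->
  bpure (pre ++ [seq h i | i <- s] ++ hd :: post) =
  (-1) ^+ size s *: bpure (pre ++ hd :: [seq h i | i <- s] ++ post).
Proof.
move=> hhd hd2; elim: s pre => [|i s IH] pre; first by rewrite expr0 scale1r.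
rewrite /= -cat_rcons IH cat_rcons (bpure_swap gax Aax) // hd2 h1 mul1r.
by rewrite (sgnz_double K 1) scale1r scalerN -scaleNr exprS mulN1r.
Qed.

Lemma br_slot_linear (s1 s2 : seq g) : linear (fun y => br (s1 ++ y :: s2)).
Proof. by move=> c y z; apply: brL. Qed.

(** This is the Leibniz rule for the product of all forms: in each summand the differentiated entry,
    now of total degree 2, is moved to the front. *)
Lemma dpure_bpair :
  (-1) ^+ n *: dpure [:: bpair [seq h i | i <- L]] =
  \sum_(i < n) bpure (dpair (h i) :: [seq h j | j <- enum [set~ i]]).
Proof.
have EF i : enum [set~ i] = filter (predC1 i) L.
  by rewrite enum_filter; apply: eq_filter => j; rewrite /= !inE.
have mL i : i \in L by rewrite mem_enum.
rewrite [RHS](eq_bigl (mem 'I_n)) // -[RHS]big_enum.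
have uL : uniq L := enum_uniq _; have szL : size L = n := size_enum_ord n.
move: uL szL mL EF; move: (enum 'I_n) => L uL szL mL EF.
have -> : dpure [:: bpair [seq h i | i <- L]] =
    sgnz K (\sum_(i <- L) hdeg1 (h i) + 2 - (size [seq h i | i <- L])%:Z) *:
    tpure (sgnz K (cross_degree [seq h i | i <- L]) *: br [seq hfst (h i) | i <- L])
      (dga_d (\big[mul/dga_one A]_(i <- L) hsnd (h i))).
  rewrite (map_comp (@hfst _ _ _) h) -(big_map h xpredT (@hdeg1 _ _ _)).
  by rewrite -(big_map h xpredT (@hsnd _ _ _)).
rewrite size_map szL (dga_d_prod Aax (p := fun i => hdeg2 (h i)))
  //; last by move=> i; case: (hh i).
rewrite (lin_sum (tpure_linear_r _)) !scaler_sumr; apply: eq_bigr => i _.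
set l1 := take _ _; set l2 := drop _ _.
have LE : L = l1 ++ i :: l2 := big_take_index (mL i).
have -> : enum [set~ i] = l1 ++ l2.
  rewrite EF; move: uL; rewrite LE cat_uniq /= => /and3P[_ /norP[il1 _] /andP[il2 _]].
  have nf l : i \notin l -> filter (predC1 i) l = l.
    by move=> il; apply/all_filterP/allP => j jl /=; apply: contraNneq il => <-.
  by rewrite filter_cat /= eqxx !nf.
have dh : hhom (dpair (h i)) by apply: (dpair_hom gax Aax).
have dh2 : hdeg1 (dpair (h i)) + hdeg2 (dpair (h i)) = 2 by rewrite /= addrA h1.
have -> : bpure (dpair (h i) :: [seq h j | j <- l1 ++ l2]) =
    (-1) ^+ size l1 *: bpure ([seq h j | j <- l1] ++ dpair (h i) :: [seq h j | j <- l2]).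
  rewrite (bpure_move [::] l1 _ dh dh2) scalerA -exprD -signr_odd oddD addbb scale1r.
  by rewrite map_cat.
have sumE F : \sum_(j <- L) F j = \sum_(j <- l1) F j + (F i + \sum_(j <- l2) F j) :> int.
  by rewrite [in LHS]LE big_cat big_cons.
rewrite /bpure !map_cat /= (dga_prod_cat Aax) !big_cons /=.
rewrite (linZ (br_slot_linear _ _)) !tpureZl !tpureZr !scalerA !big_map -!map_comp.
rewrite [in X in _ *: tpure (br X) _]LE map_cat /=; congr (_ *: _).
rewrite sumE [in cross_degree _]LE map_cat !cross_degree_cat /=.
rewrite !big_cons !big_map.
set C := cross_degree _; set D := cross_degree _.
have a1E : \sum_(j <- l1) hdeg2 (h j) = (size l1)%:Z - \sum_(j <- l1) hdeg1 (h j).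
  elim: (l1) => [|j l IH]; first by rewrite !big_nil.
  have a1 : hdeg2 (h j) = 1 - hdeg1 (h j) by rewrite -(h1 j); ring.
  rewrite !big_cons IH /= -addn1 PoszD a1; ring.
rewrite -!sgnz_nat -!sgnzD.
apply: (@sgnz_even _ _ _ (1 + 0)); rewrite a1E /=; ring.
Qed.

Lemma tbr_head_linear (s : seq T) : linear (fun z => tbr (z :: s)).
Proof. exact: (tbr_slot_linear gax Aax [::] s). Qed.

Lemma all_hom_h (l : seq 'I_n) : all_hom [seq h i | i <- l].
Proof. exact: all_hom_map. Qed.

(** Both nested brackets split into a bracket of g and a differential of forms. The sum [T1], with g
    inside and outside, is governed by the Jacobi identity of g. In [T2] the differential is
    outside, which needs I to be everything; in [T3] it is inside, which needs I to be a singleton.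
    These two cancel by the Leibniz rule. *)
Lemma jacobi_pure :
  \sum_(1 <= k < n.+1) (-1) ^+ k *: \sum_(I : {set 'I_n} | #|I| == k)
    tbr (tbr [seq htensor (h i) | i <- enum I] :: [seq htensor (h j) | j <- enum (~: I)]) = 0.
Proof.
rewrite sum_card_sign.
pose T1 (I : {set 'I_n}) := bpure (bpair [seq h i | i <- enum I] :: [seq h j | j <- enum (~: I)]).
pose T2 (I : {set 'I_n}) := dpure (bpair [seq h i | i <- enum I] :: [seq h j | j <- enum (~: I)]).
pose T3 (I : {set 'I_n}) :=
  tbr (dpure [seq h i | i <- enum I] :: [seq htensor (h j) | j <- enum (~: I)]).
have -> : \sum_(I : {set 'I_n} | I != set0) (-1) ^+ #|I| *:
    tbr (tbr [seq htensor (h i) | i <- enum I] :: [seq htensor (h j) | j <- enum (~: I)]) =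
  \sum_(I : {set 'I_n} | I != set0) (-1) ^+ #|I| *: T1 I +
  (\sum_(I : {set 'I_n} | I != set0) (-1) ^+ #|I| *: T2 I +
   \sum_(I : {set 'I_n} | I != set0) (-1) ^+ #|I| *: T3 I).
  rewrite -!big_split; apply: eq_bigr => I I0 /=; rewrite -!scalerDr; congr (_ *: _).
  have -> : tbr [seq htensor (h i) | i <- enum I] = tbr_pure [seq h i | i <- enum I].
    by rewrite -(tbr_htensor gax Aax (all_hom_h _)) -map_comp.
  rewrite (tbr_pureE gax Aax).
  rewrite (linD (tbr_head_linear _)) addrA; congr (_ + _).
  rewrite bpureE (map_comp (@htensor _ _ _) h (enum (~: I))).
  rewrite -[_ :: _]/[seq htensor j | j <- bpair [seq h i | i <- enum I] :: _].
  rewrite (tbr_htensor gax Aax) ?(tbr_pureE gax Aax) //=; split; last exact: all_hom_h.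
  apply: bpair_hom => //; last exact: all_hom_h.
  by rewrite size_map -cardE card_gt0.
rewrite -sum_card_sign sum_bpure_bpair add0r.
have setTn0 : [set: 'I_n] != set0 by rewrite -card_gt0 cardsT card_ord.
rewrite (bigD1 [set: 'I_n]) //= [X in _ + X + _]big1 => [|I /andP[I0 IT]]; last first.
  have : enum (~: I) != [::].
    by rewrite -size_eq0 -cardE cards_eq0 -setCT (inj_eq (@setC_inj _)).
  by rewrite /T2; case: (enum (~: I)) => // j l _; rewrite scaler0.
have T3E I : I != set0 -> #|I| != 1%N -> T3 I = 0.
  rewrite /T3 -card_gt0 cardE; case: (enum I) => [|i [|j l]] //= _ _.
  exact: (lin0 (tbr_head_linear _)).
rewrite (bigID (fun I : {set 'I_n} => #|I| == 1%N)) /= [X in _ + (_ + X)]big1 ?addr0; last first.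
  by move=> I /andP[I0 I1]; rewrite T3E ?scaler0.
have -> : \sum_(I : {set 'I_n} | (I != set0) && (#|I| == 1%N)) (-1) ^+ #|I| *: T3 I =
    \sum_(i < n) - T3 [set i].
  rewrite -(big_imset (fun I => - T3 I)) /=; last by move=> i j _ _ /set1_inj.
  apply: eq_big => [I|I /andP[_ /eqP->]]; last by rewrite scaleN1r.
  apply/andP/imsetP => [[_ /cards1P[i ->]]|[i _ ->]]; first by exists i.
  by rewrite cards1 eqxx -card_gt0 cards1.
rewrite sumrN cardsT card_ord /T2 setCT.
have -> : enum (set0 : {set 'I_n}) = [::] by rewrite enum_set0.
rewrite (_ : enum [set: 'I_n] = L); last by apply: eq_enum => i; rewrite !inE.
rewrite dpure_bpair -sumrB big1 // => i _; rewrite /T3 enum_set1 dpureE.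
have -> : tbr (htensor (dpair (h i)) :: [seq htensor (h j) | j <- enum (~: [set i])]) =
    tbr_pure (dpair (h i) :: [seq h j | j <- enum (~: [set i])]).
  rewrite -(tbr_htensor gax Aax) /= -?map_comp //; split; last exact: all_hom_h.
  exact: (dpair_hom gax Aax).
rewrite (tbr_pureE gax Aax).
rewrite -/(~: [set i]) [X in _ - (_ + X)](_ : _ = 0) ?addr0 ?subrr //.
(* The differential can be both inside and outside only if no entry is left over, that is for n = 1,
   and then d^2 = 0. *)
case: [seq _ | _ <- _] => //=.
by rewrite (cdga_dd Aax) tpure0r scaler0.
Qed.

End JacobiPure.

(** * Maurer-Cartan elements as fixed points *)

Section MultilinearFun.
Context (K : fieldType) (V U : lmodType K) (n : nat).

Definition upd (z : 'I_n -> V) (i : 'I_n) (x : V) : 'I_n -> V :=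
  fun j => if j == i then x else z j.

Lemma upd_same z i : upd z i (z i) = z.
Proof. by apply/funext => j; rewrite /upd; case: eqP => [->|]. Qed.

(** The counterpart of [slot_linear_span] for indexed families, as needed for sums over subsets of
    the indices. The induction runs over the number of coordinates not yet reduced to generators. *)
Lemma multilinear_span (Phi : ('I_n -> V) -> U) (G : V -> Prop) :
  (forall z i, linear (fun x => Phi (upd z i x))) ->
  (forall z, (forall i, G (z i)) -> Phi z = 0) ->
  forall z, (forall i, span G (z i)) -> Phi z = 0.
Proof.
move=> PhiL PhiG z hz.
suff gen m y : (forall i : 'I_n, (i < m)%N -> span G (y i)) ->
    (forall i : 'I_n, (m <= i)%N -> G (y i)) -> Phi y = 0.
  by apply: (gen n) => // i; rewrite leqNgt ltn_ord.
elim: m y => [|m IH] y hy Gy; first by apply: PhiG => i; apply: Gy.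
have [m_lt|m_ge] := ltnP m n; last first.
  by apply: IH => i mi; [apply/hy/ltnW|have := leq_ltn_trans (leq_trans m_ge mi) (ltn_ord i);
    rewrite ltnn].
pose i0 := Ordinal m_lt; rewrite -(upd_same y i0).
elim: (hy i0 (ltnSn m)) => [|x Gx|c x x' _ Ex _ Ex'].
- exact: (lin0 (PhiL y i0)).
- apply: IH => i mi; rewrite /upd; case: (eqVneq i i0) => [_|ii0].
  + exact: span_gen.
  + by apply: hy; apply: ltnW.
  + exact: Gx.
  apply: Gy; rewrite ltn_neqAle mi andbT; apply: contra_neq ii0 => E.
  exact: val_inj.
- by rewrite PhiL Ex Ex' scaler0 addr0.
Qed.

Lemma map_upd_notin z i x (l : seq 'I_n) : i \notin l -> map (upd z i x) l = map z l.
Proof.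
move=> il; apply/eq_in_map => j jl; rewrite /upd; case: eqP => // ji.
by rewrite -ji jl in il.
Qed.

Lemma map_upd_linear (F : seq V -> U) z i (l : seq 'I_n) : slot_linear F -> uniq l -> i \in l ->
  linear (fun x => F (map (upd z i x) l)).
Proof.
move=> FL ul il; have LE := big_take_index il; move: ul; rewrite LE cat_uniq /=.
move=> /and3P[_ /norP[i1 _] /andP[i2 _]] c x y.
by rewrite !map_cat /= !(map_upd_notin _ _ i1) !(map_upd_notin _ _ i2) /upd eqxx FL.
Qed.

End MultilinearFun.

Lemma map_const_nseq (X Y : Type) (y : Y) (s : seq X) : [seq y | _ <- s] = nseq (size s) y.
Proof. by elim: s => //= x s ->. Qed.

Lemma triangle_sum (U : nmodType) (c : nat -> nat -> U) M :
  \sum_(0 <= n < M) \sum_(0 <= k < n.+1) c k (n - k)%N =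
  \sum_(0 <= k < M) \sum_(0 <= l < M - k) c k l.
Proof.
elim: M => [|M IH]; first by rewrite !big_geq.
rewrite big_nat_recr //= IH [RHS]big_nat_recr //= subSnn big_nat1.
rewrite [X in _ + X]big_nat_recr //= subnn addrA; congr (_ + _).
rewrite -big_split; apply: eq_big_nat => k /andP[_ kM] /=.
by rewrite subSn 1?ltnW // big_nat_recr.
Qed.

Section Core.
Context (K : fieldType) (charK : [pchar K] =i pred0).
Context (g : brvect K) (gax : Linf_axioms g).
Context (A : dga K) (Aax : cdga_axioms A).
Context (N : nat) (N2 : (2 <= N)%N).
Hypothesis gN : forall i, (N <= i)%N -> forall x : g, Fil i x -> x = 0.
Notation T := (gtens g A).
Notation D z := (tbr [:: z]).

Let gG : graded g. Proof. by case: gax. Qed.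
Let AG : graded A := cdga_graded Aax.
Let TG : graded T := gtens_graded gG AG.
Let brL : br_multilinear g. Proof. by case: gax => _ []. Qed.
Let brJ : br_jacobi g. Proof. by case: gax => _ []. Qed.
Let tbrL := tbr_slot_linear gax Aax.
Let D_lin := tbr1_linear gax Aax.

Lemma jacobi_deg1 n (z : 'I_n -> T) : (0 < n)%N -> (forall i, of_degree 1 (z i)) ->
  \sum_(1 <= k < n.+1) (-1) ^+ k *: \sum_(I : {set 'I_n} | #|I| == k)
    tbr (tbr [seq z i | i <- enum I] :: [seq z j | j <- enum (~: I)]) = 0.
Proof.
move=> n0 hz.
apply: (multilinear_span (Phi := fun z : 'I_n -> T => \sum_(1 <= k < n.+1) (-1) ^+ k *:
  \sum_(I : {set 'I_n} | #|I| == k)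
    tbr (tbr [seq z i | i <- enum I] :: [seq z j | j <- enum (~: I)])) (G := pure_of_degree 1)).
- move=> {hz} {}z i; apply: linear_sum_fun => k; apply: linear_scale.
  apply: linear_sum_fun => I.
  have [iI|iI] := boolP (i \in I).
    have nC : i \notin enum (~: I) by rewrite mem_enum inE negbK.
    move=> c x y; rewrite !(map_upd_notin _ _ nC).
    have h := map_upd_linear (i := i) z tbrL (enum_uniq I).
    by rewrite (h _ c x y) ?mem_enum // (tbrL [::]).
  have nI : i \notin enum I by rewrite mem_enum.
  move=> c x y; rewrite !(map_upd_notin _ _ nI).
  have FL : slot_linear (fun s => tbr (tbr [seq z i | i <- enum I] :: s)).
    by move=> s1 s2 c' x' y'; rewrite -cat_cons tbrL.
  by rewrite (map_upd_linear z FL (enum_uniq (~: I))) // mem_enum inE.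
- move=> {hz} {}z hz; pose P i h := [/\ @hhom K g A h, hdeg1 h + hdeg2 h = 1 & z i = htensor h].
  have hP i : exists h, P i h := hz i.
  pose h i := sval (cid (hP i)); have hh i : P i (h i) := svalP (cid (hP i)).
  have zE : z = fun i => htensor (h i) by apply/funext => i; case: (hh i).
  rewrite zE; apply: (jacobi_pure gax Aax n0) => i; by case: (hh i).
- by move=> i; apply: (pure_of_degree_span gax Aax).
Qed.

(** With equal entries, all subsets of size k give the same term. *)
Lemma jacobi_power (a : T) n : (0 < n)%N -> of_degree 1 a ->
  \sum_(1 <= k < n.+1) (-1) ^+ k *:
    ('C(n, k)%:R *: tbr (tbr (nseq k a) :: nseq (n - k) a)) = 0.
Proof.
move=> n0 ha; rewrite -[RHS](jacobi_deg1 (z := fun _ => a) n0) //.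
apply: eq_bigr => k _; congr (_ *: _).
rewrite (eq_bigr (fun _ => tbr (tbr (nseq k a) :: nseq (n - k) a))) => [|I /eqP Ik].
  by rewrite sumr_const -cardsE card_draws card_ord scaler_nat.
by rewrite !map_const_nseq -!cardE [#|~: I|]cardsCs setCK Ik card_ord.
Qed.

(** Nilpotency kills the brackets of N or more entries, so the truncated sum is the complete
    non-linear part of the curvature. *)
Definition quad (a : T) : T := \sum_(2 <= l < N) (l`!%:R)^-1 *: tbr (nseq l a).
Definition curvature (a : T) : T := D a + quad a.

Lemma curvE a : curvature a = \sum_(1 <= k < N) (k`!%:R)^-1 *: tbr (nseq k a).
Proof. by rewrite big_ltn // invr1 scale1r. Qed.

Lemma tbr_long (s : seq T) : (N <= size s)%N -> tbr s = 0.
Proof. by move=> Ns; apply: (tbr_nilp gax Aax gN Ns); apply: leq_trans Ns. Qed.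

Lemma tbr_head0 (s : seq T) : tbr (0 :: s) = 0.
Proof. exact: (lin0 (tbrL [::] s)). Qed.

Lemma natr_unit m : (0 < m)%N -> (m%:R : K) != 0.
Proof. by move=> m0; rewrite (pcharf0P _).1 // -lt0n. Qed.

(** The Jacobi identity on n equal entries, divided by n!, is summed over n. Since C(n,k)/n! is
    1/(k! l!) with l = n - k, the double sum separates and reassembles the curvature. *)
Lemma bianchi (a : T) : of_degree 1 a ->
  \sum_(0 <= l < N) ((-1) ^+ l * (l`!%:R)^-1) *: tbr (curvature a :: nseq l a) = 0.
Proof.
move=> ha.
(* The curvature has no term for k = 0; the value 0 there lets the sums run over full triangles. *)
pose c k l : T := if k == 0%N then 0 else
  ((-1) ^+ l * (l`!%:R)^-1 * (k`!%:R)^-1) *: tbr (tbr (nseq k a) :: nseq l a).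
have c0 k l : (N <= k)%N || (N <= l)%N -> c k l = 0.
  rewrite /c; case: eqP => // _ /orP[Nk|Nl].
    by rewrite (tbr_long (s := nseq k a)) ?size_nseq // tbr_head0 scaler0.
  by rewrite tbr_long ?scaler0 //= size_nseq leqW.
(* Outside the square k, l < N the terms vanish, and the triangle k + l < 2N contains that square,
   so it can be summed along n = k + l instead. *)
have -> : \sum_(0 <= l < N) ((-1) ^+ l * (l`!%:R)^-1) *: tbr (curvature a :: nseq l a) =
    \sum_(0 <= k < N + N) \sum_(0 <= l < N + N - k) c k l.
  rewrite [RHS](big_cat_nat (n := N)) ?leq_addr //= [X in _ = _ + X]big1_seq ?addr0; last first.
    move=> k; rewrite mem_index_iota => /andP[_ /andP[Nk _]].
    by rewrite /= big1 // => l _; rewrite c0 // Nk.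
  have -> : \sum_(0 <= k < N) \sum_(0 <= l < N + N - k) c k l =
      \sum_(0 <= k < N) \sum_(0 <= l < N) c k l.
    apply: eq_big_nat => k /andP[_ kN]; rewrite (big_cat_nat (n := N)) ?leq_addr //=; last first.
      by rewrite -addnBA ?leq_addr // ltnW.
    rewrite [X in _ + X]big1_seq ?addr0 // => l; rewrite mem_index_iota => /andP[_ /andP[Nl _]].
    by rewrite c0 // Nl orbT.
  rewrite exchange_big; apply: eq_bigr => l _.
  rewrite curvE (lin_sum (tbrL [::] _)) scaler_sumr [RHS]big_ltn; last by apply: leq_trans N2.
  rewrite {1}/c eqxx /= add0r; apply: eq_big_nat => k /andP[k0 _].
  by rewrite /c eqn0Ngt k0 /= (linZ (tbrL [::] _)) scalerA.
rewrite -triangle_sum big1_seq // => n _.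
case: n => [|n]; first by rewrite big_nat1 /c.
rewrite big_ltn // {1}/c eqxx /= add0r.
have := jacobi_power (n := n.+1) isT ha.
move/(congr1 (fun x => ((-1) ^+ n.+1 * (n.+1`!%:R)^-1) *: x)); rewrite scaler0 => J; apply: etrans J.
rewrite scaler_sumr; apply: eq_big_nat => k /andP[k0 kn].
rewrite /c eqn0Ngt k0 /= !scalerA; congr (_ *: _).
have {}kn : (k <= n.+1)%N := kn.
rewrite -signr_odd oddB // signr_addb !signr_odd.
have f1 := natr_unit (fact_gt0 k); have f2 := natr_unit (fact_gt0 (n.+1 - k)%N).
have f3 : ('C(n.+1, k)%:R : K) != 0 by apply: natr_unit; rewrite bin_gt0.
have -> : (n.+1`!%:R : K) = 'C(n.+1, k)%:R * (k`!%:R * (n.+1 - k)`!%:R).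
  by rewrite -(bin_fact kn) !natrM.
by field; rewrite f1 f2 f3.
Qed.

Lemma tbr1_pure i v (w : A) : of_degree i v ->
  tbr [:: (tpure v w : T)] = tpure (br [:: v]) w + sgnz K i *: tpure v (dga_d w).
Proof.
move=> hv; move: w; apply: (graded_ext AG).
- by apply: linear_comp_fun D_lin _; apply: tpure_linear_r.
- apply: linearD_fun; first exact: tpure_linear_r.
  by apply: linear_scale; apply: linear_comp_fun (cdga_d_linear Aax); apply: tpure_linear_r.
move=> p w hw; have := tbr1_htensor gax Aax (h := HPair i v p w) (conj hv hw).
by rewrite /htensor /=.
Qed.

Lemma br1_sq i (v : g) : of_degree i v -> br [:: br [:: v]] = 0.
Proof.
move=> hv; have := brJ (n := 1) (d := fun _ => i) (x := fun _ => v) isT (fun _ => hv).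
rewrite big_nat1 expr1 scaleN1r (big_pred1 [set: 'I_1]) => [|I]; last first.
  rewrite [RHS]/= eqEcard subsetT cardsT card_ord /= eqn_leq.
  by rewrite -[X in (_ <= X)%N && _](card_ord 1) max_card.
rewrite setCT enum_set0 (_ : enum [set: 'I_1] = enum 'I_1); last first.
  by apply: eq_enum => j; rewrite inE.
rewrite map_const_nseq size_enum_ord /= /shuffle_sign big1 => [|j _]; last first.
  by rewrite big_pred0 // => k; rewrite setCT inE.
by rewrite scale1r => /eqP; rewrite oppr_eq0 => /eqP.
Qed.

(** A separate argument, because [jacobi_deg1] covers total degree 1 only, while D^2 = 0 will also
    be applied to elements of degree 0. The mixed terms cancel by the sign of the internal
    degree. *)
Lemma tbr1_sq (z : T) : D (D z) = 0.
Proof.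
move: z; apply: (tens_hom_ind gG AG) => [|c x y IHx IHy|i p v w hv hw].
- by rewrite !(lin0 D_lin).
- by rewrite !D_lin IHx IHy scaler0 addr0.
have hbv : of_degree (i + 1) (br [:: v]).
  have := br_deg_list gax (hs := [:: HPair i v p w]) isT (conj (conj hv hw) I).
  by rewrite big_seq1 /= (_ : i + 2 - 1 = i + 1) //; ring.
rewrite (tbr1_pure _ hv) (linD D_lin) (linZ D_lin) (tbr1_pure _ hbv) !(tbr1_pure _ hv).
rewrite (br1_sq hv) tpure0l add0r (cdga_dd Aax) tpure0r scaler0 addr0.
by rewrite sgnzD sgnz1 mulrN1 scaleNr addNr.
Qed.

Lemma quad_deg a : of_degree 1 a -> of_degree 2 (quad a).
Proof.
move=> ha; rewrite /quad big_seq; apply: of_degree_sum => // l.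
rewrite mem_index_iota => /andP[l2 _]; apply: of_degreeZ => //.
apply: (tbr_deg1 gax Aax); rewrite size_nseq; first exact: leq_trans l2.
by elim: (l) => //= m IH; split.
Qed.

(** Telescoping: replacing a by b one entry at a time, each difference is a bracket with the entry a
    - b and at least one other entry. *)
Lemma tfil_powers i (a b : T) l pre : (2 <= size pre + l)%N -> tfil i (a - b) ->
  tfil i.+1 (tbr (pre ++ nseq l a) - tbr (pre ++ nseq l b)).
Proof.
move=> + hab; elim: l pre => [|l IH] pre hl; first by rewrite subrr; apply: span_0.
rewrite /= -(subrKA (tbr (pre ++ a :: nseq l b))).
apply: spanD.
  by rewrite -!cat_rcons; apply: IH; rewrite size_rcons addSn -addnS.
rewrite -(linB (tbrL pre (nseq l b))).
by apply: (tfil_bracket gax Aax) => //; rewrite size_nseq; move: hl; rewrite addnS ltnS.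
Qed.

Lemma tfil_quad i (a b : T) : tfil i (a - b) -> tfil i.+1 (quad a - quad b).
Proof.
move=> hab; rewrite /quad -sumrB big_seq; apply: span_sum => l.
rewrite mem_index_iota => /andP[l2 _]; rewrite -scalerBr; apply: spanZ.
exact: (tfil_powers (pre := [::])).
Qed.

Section FixedPoint.
Context (ctr eps : A -> A).
Hypothesis ctr_lin : linear ctr.
Hypothesis ctr_degree : forall p x, of_degree p x -> of_degree (p - 1) (ctr x).
Hypothesis eps_m : dga_morphism eps.
Notation KK := (tmap (@idfun g) ctr : T -> T).
Notation EE := (tmap (@idfun g) eps : T -> T).
Hypothesis htp1 : forall z : T, of_degree 1 z -> z - EE z = KK (D z) - D (KK z).
Hypothesis htp2 : forall z : T, of_degree 2 z -> z - EE z = D (KK z) - KK (D z).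
Hypothesis eps_ctr : forall x, eps (ctr x) = 0.

Let KK_lin : linear (tmap (@idfun g) ctr) := tmap_linear (@linear_id K g) ctr_lin.
Let EE_lin : linear (tmap (@idfun g) eps) :=
  tmap_linear (@linear_id K g) (dga_morph_linear eps_m).

Lemma ctr_deg m (z : T) : of_degree m z -> of_degree (m - 1) (KK z).
Proof.
move: z; apply: (gtens_degree_ind gG AG (P := fun z => of_degree (m - 1) (KK z)))
  => [|c x y|i p v w hv hw E].
- by rewrite (lin0 KK_lin); apply: of_degree0.
- by rewrite KK_lin; apply: of_degreeP.
by rewrite tmap_pure // -E -addrA; apply: of_degree_tpure => //; apply: ctr_degree.
Qed.

Lemma ctr_tfil i (z : T) : tfil i z -> tfil i (KK z).
Proof.
apply: span_map; first exact: KK_lin.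
move=> _ [h [[hx ha] hj ->]]; rewrite /htensor tmap_pure //; apply: span_gen.
by exists (HPair (hdeg1 h) (hfst h) (hdeg2 h - 1) (ctr (hsnd h))); split=> //; split=> //; apply: ctr_degree.
Qed.

Lemma vertex_ctr (z : T) : EE (KK z) = 0.
Proof.
move: z; apply: tens_ext; [exact: linear_comp_fun EE_lin KK_lin|exact: linear_zero|].
by move=> v w; rewrite !tmap_pure ?eps_ctr ?tpure0r //; apply: (dga_morph_linear eps_m).
Qed.

Lemma tfil_all0 (z : T) : (forall i, tfil i z -> tfil i.+1 z) -> z = 0.
Proof.
move=> step; apply: (tfil_nilp gN); case: N N2 => // M _.
by elim: M => [|M IH]; [apply: (tfil1 gax Aax)|apply: step].
Qed.

(** The quadratic and higher terms push a difference one filtration step deeper, and the contraction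
    preserves the filtration. The difference of two solutions thus lies in every step. *)
Lemma fixed_point_unique c a b :
  a = c - KK (quad a) -> b = c - KK (quad b) -> a = b.
Proof.
move=> Ea Eb; apply/eqP; rewrite -subr_eq0; apply/eqP; apply: tfil_all0 => i hab.
rewrite Ea Eb opprB addrC subrKA -(linB KK_lin); apply: ctr_tfil; apply: tfil_quad.
by rewrite -opprB; apply: spanN.
Qed.

(** The right-hand side is iterated from c. The m-th increment lies in step m + 1, so the increment
    after N - 1 iterations is zero. *)
Lemma fixed_point_exists c : of_degree 1 c ->
  exists2 a, of_degree 1 a & a = c - KK (quad a).
Proof.
move=> hc; pose Phi a := c - KK (quad a).
have Phi_deg a : of_degree 1 a -> of_degree 1 (Phi a).
  move=> ha; rewrite /Phi -scaleN1r; apply: of_degreeD => //; apply: of_degreeZ => //.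
  by have := ctr_deg (quad_deg ha).
pose u m := iter m Phi c; have u_deg m : of_degree 1 (u m) by elim: m => //= m; apply: Phi_deg.
have step m : tfil m.+1 (u m.+1 - u m).
  elim: m => [|m IH]; first exact: (tfil1 gax Aax).
  change (tfil m.+2 ((c - KK (quad (u m.+1))) - (c - KK (quad (u m))))).
  rewrite opprB addrC subrKA -(linB KK_lin).
  by apply/ctr_tfil/tfil_quad; rewrite -opprB; apply: spanN.
exists (u N.-1) => //; apply/eqP; rewrite -subr_eq0 -oppr_eq0 opprB; apply/eqP.
apply: (tfil_nilp gN); have h : tfil N.-1.+1 (Phi (u N.-1) - u N.-1) := step N.-1.
by rewrite prednK ?(ltnW N2) in h.
Qed.

Lemma vertex_quad (z : T) : EE (quad z) = quad (EE z).
Proof.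
rewrite (lin_sum EE_lin); apply: eq_bigr => l _; rewrite (linZ EE_lin).
by rewrite (tmap_tbr gax gax Aax Aax eps_m) ?map_nseq // => s _; rewrite map_id.
Qed.

Lemma vertex_tbr1 (z : T) : EE (D z) = D (EE z).
Proof. by rewrite (tmap_tbr gax gax Aax Aax eps_m) // => s _; rewrite map_id. Qed.

(** Write F, Q, K for [curvature], [quad] and the contraction. The homotopy formula for Q(a), with
    F(a0) = 0, gives F(a) = - K D Q(a) = - K D F(a). By the Bianchi identity D F(a) is a combination
    of brackets of F(a) with at least one a, so F(a) sinks through the filtration and vanishes. *)
Lemma fixed_point_MC a0 r a : of_degree 1 a -> curvature a0 = 0 -> EE a0 = a0 -> EE r = 0 ->
  a = a0 - D r - KK (quad a) -> curvature a = 0.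
Proof.
move=> ha F0 Ea0 Er Ea.
have EEa : EE a = a0.
  by rewrite Ea !(linB EE_lin) Ea0 vertex_tbr1 Er (lin0 D_lin) vertex_ctr !subr0.
have Da : D a = D a0 - D (KK (quad a)).
  by rewrite {1}Ea !(linB D_lin) tbr1_sq subr0.
have hq := quad_deg ha.
have FE : curvature a = - KK (D (quad a)).
  have := htp2 hq; rewrite vertex_quad EEa => /eqP; rewrite subr_eq => /eqP E.
  have gen (p x y q : T) : p + q = 0 -> p - x + (x - y + q) = - y.
    by move=> pq; rewrite -!addrA addKr addrCA pq addr0.
  rewrite /curvature Da [X in _ + X]E; exact: gen F0.
have DF : D (quad a) = D (curvature a) by rewrite /curvature (linD D_lin) tbr1_sq add0r.
apply: tfil_all0 => i hF; rewrite {1}FE; apply: spanN; apply: ctr_tfil; rewrite DF.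
have := bianchi ha; rewrite big_ltn; last exact: leq_trans N2.
rewrite expr0 mul1r invr1 scale1r => /eqP; rewrite addr_eq0 => /eqP ->.
apply: spanN; rewrite big_seq; apply: span_sum => l; rewrite mem_index_iota => /andP[l0 _].
by apply: spanZ; apply: (tfil_bracket gax Aax (s1 := [::])) => //; rewrite size_nseq.
Qed.

End FixedPoint.

End Core.

(** * The fixed-point equation for a gauge on forms *)

Section TensorOmega.
Context (K : fieldType) (charK : [pchar K] =i pred0).
Context (s : forall n, Omega K n -> Omega K n) (s_gauge : gauge s).
Context (g : brvect K) (gax : Linf_axioms g).
Context (N : nat) (N2 : (2 <= N)%N).
Hypothesis gN : forall i, (N <= i)%N -> forall x : g, Fil i x -> x = 0.
Notation Om n := (Omega K n).
Notation T n := (gtens g (Omega K n)).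
Notation D z := (tbr [:: z]).

Let gG : graded g. Proof. by case: gax. Qed.
Let Oax n := Omega_cdga K n.
Let OG n := Omega_graded K n.

Let s_linear n : linear (@s n).
Proof. by move=> c x y; case: s_gauge => [[sl _ _ _] _]; apply: sl. Qed.

Let s_deg n p (x : Om n) : of_degree p x -> of_degree (p - 1) (s x).
Proof. by case: s_gauge => [[_ sd _ _] _]; apply: sd. Qed.

(* Up to the sign (-1)^m in total degree m, the form part of the differential of a tensor
   product is id (x) (d o form_sgn); twisting the contraction by form_sgn as well makes
   id (x) signed_ctr a homotopy for the total differential, see tensor_htp. *)
Definition signed_ctr n (i : 'I_n.+1) (x : Om n) : Om n := form_ctr s i (form_sgn x).
Definition signed_rho n (i : 'I_n.+1) (x : Om n) : Om n := form_rho i (form_sgn x).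

Lemma form_sgn_deg n p (x : Om n) : of_degree p x -> of_degree p (form_sgn x).
Proof. by move=> hx; rewrite (form_sgn_hom hx); apply: of_degreeZ. Qed.

Lemma signed_ctr_linear n (i : 'I_n.+1) : linear (signed_ctr i).
Proof. exact: linear_comp_fun (form_ctr_linear s_gauge i) (@form_sgn_linear K n). Qed.

Lemma signed_rho_linear n (i : 'I_n.+1) : linear (signed_rho i).
Proof. exact: linear_comp_fun (form_rho_linear s_gauge i) (@form_sgn_linear K n). Qed.

Lemma signed_ctr_deg n (i : 'I_n.+1) p x : of_degree p x -> of_degree (p - 1) (signed_ctr i x).
Proof. by move=> hx; apply/(form_ctr_deg s_gauge)/form_sgn_deg. Qed.

Lemma signed_rho_deg n (i : 'I_n.+1) p x : of_degree p x -> of_degree (p - 1) (signed_rho i x).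
Proof. by move=> hx; apply/(form_rho_deg s_gauge)/form_sgn_deg. Qed.

Definition tens_ctr n (i : 'I_n.+1) : T n -> T n := tmap (@idfun g) (signed_ctr i).
Definition tens_rho n (i : 'I_n.+1) : T n -> T n := tmap (@idfun g) (signed_rho i).
Definition tens_vertex n (i : 'I_n.+1) : T n -> T n := tmap (@idfun g) (@form_vertex K n i).

Lemma tens_ctr_linear n (i : 'I_n.+1) : linear (tens_ctr i).
Proof. exact: tmap_linear (@linear_id K g) (signed_ctr_linear i). Qed.

Lemma tens_rho_linear n (i : 'I_n.+1) : linear (tens_rho i).
Proof. exact: tmap_linear (@linear_id K g) (signed_rho_linear i). Qed.

Lemma vertex_morphism n (i : 'I_n.+1) : dga_morphism (@form_vertex K n i).
Proof. exact: form_pull_morphism. Qed.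

Lemma tens_vertex_linear n (i : 'I_n.+1) : linear (tens_vertex i).
Proof. exact: tmap_linear (@linear_id K g) (dga_morph_linear (vertex_morphism i)). Qed.

Lemma tens_ctr_pure n (i : 'I_n.+1) v w : tens_ctr i (tpure v w) = tpure v (signed_ctr i w).
Proof. exact: tmap_pure (@linear_id K g) (signed_ctr_linear i) v w. Qed.

Lemma tens_rho_pure n (i : 'I_n.+1) v w : tens_rho i (tpure v w) = tpure v (signed_rho i w).
Proof. exact: tmap_pure (@linear_id K g) (signed_rho_linear i) v w. Qed.

Lemma tens_vertex_pure n (i : 'I_n.+1) v w : tens_vertex i (tpure v w) = tpure v (form_vertex i w).
Proof. exact: tmap_pure (@linear_id K g) (dga_morph_linear (vertex_morphism i)) v w. Qed.

(** The terms involving the differential of g cancel, since the contraction acts on forms alone.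
    What remains is [form_ctrP], multiplied by the signs of the two factors. *)
Lemma tensor_htp n (i : 'I_n.+1) m (z : T n) : of_degree m z ->
  tens_ctr i (D z) - D (tens_ctr i z) = - sgnz K m *: (z - tens_vertex i z).
Proof.
have DL := tbr1_linear gax (Oax n); have KL := tens_ctr_linear i; have EL := tens_vertex_linear i.
have ZL : linear (fun z : T n => tens_ctr i (D z) - D (tens_ctr i z)).
  exact: linearD_fun (linear_comp_fun KL DL) (linearN_fun (linear_comp_fun DL KL)).
have WL : linear (fun z : T n => - sgnz K m *: (z - tens_vertex i z)).
  by apply: linear_scale; apply: linearD_fun => //; apply: linearN_fun.
move: z; apply: (gtens_degree_ind gG (OG n)
  (P := fun z => tens_ctr i (D z) - D (tens_ctr i z) = - sgnz K m *: (z - tens_vertex i z)))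
  => [|c x y Ex Ey|j p v w hv hw E].
- by rewrite (lin0 DL) (lin0 KL) (lin0 DL) (lin0 EL) subrr scaler0.
- by rewrite [LHS](ZL c x y) Ex Ey -(WL c x y).
rewrite (tbr1_pure gax (Oax n) _ hv) (linD KL) (linZ KL) !tens_ctr_pure tens_vertex_pure.
rewrite (tbr1_pure gax (Oax n) _ hv) opprD addrACA subrr add0r -scalerBr.
rewrite -(linB (tpure_linear_r v)) /signed_ctr (form_sgn_hom hw).
rewrite (form_sgn_hom (cdga_d_deg (Oax n) hw)) !(linZ (form_ctr_linear s_gauge i)).
rewrite (linZ (cdga_d_linear (Oax n))) sgnzD sgnz1 mulrN1 scaleNr -opprD -scalerDr.
rewrite addrC (form_ctrP charK s_gauge) -scaleNr tpureZr scalerA -E sgnzD mulrN.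
by rewrite (linB (tpure_linear_r v)).
Qed.

Lemma tensor_htp1 n (i : 'I_n.+1) (z : T n) : of_degree 1 z ->
  z - tens_vertex i z = tens_ctr i (D z) - D (tens_ctr i z).
Proof. by move=> hz; rewrite (tensor_htp i hz) sgnz1 opprK scale1r. Qed.

Lemma tensor_htp2 n (i : 'I_n.+1) (z : T n) : of_degree 2 z ->
  z - tens_vertex i z = D (tens_ctr i z) - tens_ctr i (D z).
Proof.
move=> hz; rewrite -[RHS]opprB (tensor_htp i hz) (_ : sgnz K 2 = 1) ?scaleN1r ?opprK //.
by rewrite (sgnz_double K 1).
Qed.

Lemma vertex_signed_ctr n (i : 'I_n.+1) x : form_vertex i (signed_ctr i x) = 0.
Proof. exact: (vertex_form_ctr s_gauge). Qed.

Lemma tens_vertex_rho n (i : 'I_n.+1) (z : T n) : tens_vertex i (tens_rho i z) = 0.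
Proof.
move: z; apply: tens_ext; [exact: linear_comp_fun (tens_vertex_linear i) (tens_rho_linear i)|exact: linear_zero|].
by move=> v w; rewrite tens_rho_pure tens_vertex_pure (vertex_form_rho s_gauge) tpure0r.
Qed.

Lemma tens_vertex_idem n (i : 'I_n.+1) (z : T n) : tens_vertex i (tens_vertex i z) = tens_vertex i z.
Proof.
move: z; apply: tens_ext; [exact: linear_comp_fun (tens_vertex_linear i) (tens_vertex_linear i)|exact: tens_vertex_linear|].
by move=> v w; rewrite !tens_vertex_pure /form_vertex -form_pull_comp.
Qed.

Lemma tens_rho_deg n (i : 'I_n.+1) (z : T n) : of_degree 1 z -> of_degree 0 (tens_rho i z).
Proof.
have TG := gtens_graded gG (OG n).
move: z; apply: (gtens_degree_ind gG (OG n) (P := fun z => of_degree 0 (tens_rho i z)))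
  => [|c x y|j p v w hv hw E].
- by rewrite (lin0 (tens_rho_linear i)); apply: of_degree0.
- by rewrite tens_rho_linear; apply: of_degreeP.
rewrite tens_rho_pure; have := of_degree_tpure gG (OG n) hv (signed_rho_deg i hw).
by rewrite addrA E subrr.
Qed.

Definition tens_gauge n : T n -> T n := tmap (@idfun g) (@s n).

Lemma tens_gauge_linear n : linear (@tens_gauge n).
Proof. exact: tmap_linear (@linear_id K g) (@s_linear n). Qed.

Lemma tens_gauge_pure n v w : @tens_gauge n (tpure v w) = tpure v (s w).
Proof. exact: tmap_pure (@linear_id K g) (@s_linear n) v w. Qed.

(** As [s] anticommutes with [form_sgn], the [s] part of the twisted contraction vanishes wherever
    the gauge does. *)
Lemma tens_ctr_gauge n (i : 'I_n.+1) (z : T n) : tens_gauge z = 0 -> tens_ctr i z = tens_rho i z.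
Proof.
move=> sz; have sgnL := tmap_linear (@linear_id K g) (@form_sgn_linear K n).
suff -> : tens_ctr i z = - tmap (@idfun g) (@form_sgn K n) (tens_gauge z) + tens_rho i z.
  by rewrite sz (lin0 sgnL) oppr0 add0r.
move: z {sz}; apply: tens_ext; first exact: tens_ctr_linear.
  apply: linearD_fun (tens_rho_linear i); apply: linearN_fun.
  exact: linear_comp_fun sgnL (@tens_gauge_linear n).
move=> v w; rewrite tens_ctr_pure tens_rho_pure tens_gauge_pure tmap_pure //; last exact: form_sgn_linear.
rewrite /signed_ctr /form_ctr (form_sgn_odd (@s_linear n) (sgnzN1 K) (@s_deg n)).
by rewrite (linD (tpure_linear_r v)) (linN (tpure_linear_r v)).
Qed.

Lemma tens_gauge_ctr n (i : 'I_n.+1) (z : T n) : tens_gauge (tens_ctr i z) = 0.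
Proof.
move: z; apply: tens_ext; [exact: linear_comp_fun (@tens_gauge_linear n) (tens_ctr_linear i)|exact: linear_zero|].
by move=> v w; rewrite tens_ctr_pure tens_gauge_pure (s_form_ctr s_gauge) tpure0r.
Qed.

Lemma tens_gauge_vertex n (i : 'I_n.+1) (z : T n) : tens_gauge (tens_vertex i z) = 0.
Proof.
move: z; apply: tens_ext; [exact: linear_comp_fun (@tens_gauge_linear n) (tens_vertex_linear i)|exact: linear_zero|].
by move=> v w; rewrite tens_vertex_pure tens_gauge_pure (gauge_vertex s_gauge) tpure0r.
Qed.

Lemma tens_gauge_d_rho n (i : 'I_n.+1) (z : T n) : tens_gauge (D (tens_rho i z)) = 0.
Proof.
have DL := tbr1_linear gax (Oax n); have SL := @tens_gauge_linear n.
move: z; apply: (tens_hom_ind gG (OG n)) => [|c x y Ex Ey|j p v w hv hw].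
- by rewrite (lin0 (tens_rho_linear i)) (lin0 DL) (lin0 SL).
- by rewrite tens_rho_linear DL SL Ex Ey scaler0 addr0.
rewrite tens_rho_pure (tbr1_pure gax (Oax n) _ hv) (linD SL) (linZ SL) !tens_gauge_pure.
by rewrite (s_form_rho s_gauge) (s_d_form_rho s_gauge) !tpure0r scaler0 addr0.
Qed.

Notation cur := (curvature N (g := g) (A := Om _)).
Notation qu := (quad N (g := g) (A := Om _)).

Lemma MC_curv n (a : T n) : MC (a : tensor_Linf g (Om n)) <-> of_degree 1 a /\ cur a = 0.
Proof.
have E M : (N <= M)%N -> \sum_(2 <= l < M) (l`!%:R)^-1 *: tbr (nseq l a) = qu a.
  move=> NM; rewrite (big_cat_nat (n := N)) //= [X in _ + X]big1_seq ?addr0 // => l.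
  rewrite mem_index_iota => /andP[_ /andP[Nl _]].
  by rewrite (tbr_long gax (Oax n) N2 gN) ?scaler0 // size_nseq.
split=> [[a1 [N0 H]]|[a1 H]]; split=> //.
  have := H (maxn N0 N) (leq_maxl _ _); rewrite -[br _]/(tbr _) => <-.
  by rewrite /curvature -(E (maxn N0 N)) ?leq_maxr.
by exists N => M NM; rewrite -[RHS]H /curvature -(E M).
Qed.

(** The equation for a with b as datum; b enters only through its value at the vertex and through
    [tens_rho i b]. *)
Definition is_solution n (i : 'I_n.+1) (b a : T n) : Prop :=
  a = (tens_vertex i b - D (tens_rho i b)) - tens_ctr i (qu a).

(** This is the homotopy formula in degree 1 with D a = - Q(a) inserted; the gauge condition turns
    the contraction of a into [tens_rho i a]. *)
Lemma gamma_solution n (i : 'I_n.+1) (a : T n) : of_degree 1 a -> cur a = 0 -> tens_gauge a = 0 ->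
  is_solution i a a.
Proof.
move=> a1 ca sa; rewrite /is_solution -(tens_ctr_gauge i sa).
have := tensor_htp1 i a1; rewrite (_ : D a = - qu a); last by apply/eqP; rewrite -addr_eq0 -/(cur a) ca.
rewrite (linN (tens_ctr_linear i)) => /eqP; rewrite subr_eq => /eqP {1}->.
by rewrite addrC addrA addrAC [X in X - _]addrC.
Qed.

Lemma solution_unique n (i : 'I_n.+1) (b a a' : T n) :
  is_solution i b a -> is_solution i b a' -> a = a'.
Proof. exact: (fixed_point_unique gax (Oax n) N2 gN (signed_ctr_linear i) (@signed_ctr_deg n i)). Qed.

Lemma solution_exists n (i : 'I_n.+1) (b : T n) : of_degree 1 b -> cur (tens_vertex i b) = 0 ->
  exists a : T n, [/\ of_degree 1 a, cur a = 0, tens_gauge a = 0 & is_solution i b a].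
Proof.
move=> b1 cb; have TG := gtens_graded gG (OG n).
have hc : of_degree 1 (tens_vertex i b - D (tens_rho i b)).
  rewrite -scaleN1r; apply: of_degreeD => //; last first.
    by apply: of_degreeZ => //; have := tbr1_deg gax (Oax n) (tens_rho_deg i b1); rewrite add0r.
  apply: (tmap_deg gax gax (Oax n) (Oax n) (vertex_morphism i)) => //.
have [a a1 aE] := fixed_point_exists gax (Oax n) N2 gN (signed_ctr_linear i) (@signed_ctr_deg n i) hc.
exists a; split=> //.
  apply: (fixed_point_MC charK gax (Oax n) N2 gN (signed_ctr_linear i) (@signed_ctr_deg n i) (vertex_morphism i)
    (@tensor_htp2 n i) (@vertex_signed_ctr n i) a1 cb (tens_vertex_idem i b) (tens_vertex_rho i b) aE).
(* The gauge kills each of the three terms of the equation separately. *)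
rewrite aE; have SL := @tens_gauge_linear n; rewrite !(linB SL).
by rewrite [X in _ - X](tens_gauge_ctr i) tens_gauge_vertex tens_gauge_d_rho !subr0.
Qed.

End TensorOmega.

(** * Naturality of the fixed-point equation *)

Section SolutionNaturality.
Context (K : fieldType) (charK : [pchar K] =i pred0).
Context (s : forall n, Omega K n -> Omega K n) (s_gauge : gauge s).
Context (g h : brvect K) (gax : Linf_axioms g) (hax : Linf_axioms h) (N : nat).
Notation Om n := (Omega K n).
Context (f : g -> h).
Hypothesis f_lin : linear f.
Hypothesis f_deg : forall (i : int) (x : g), of_degree i x -> of_degree i (f x).
Hypothesis f_br : forall s : seq g, (0 < size s)%N -> f (br s) = br [seq f x | x <- s].
Context (m n : nat) (e : ordmap m n) (e_mono : monotone e) (i : 'I_m.+1).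

Let e_morph := form_pull_morphism K e.
Let e_lin := dga_morph_linear e_morph.
Notation Phi := (tmap f (form_pull e) : gtens g (Om n) -> gtens h (Om m)).

Let Phi_lin : linear (tmap f (form_pull e : Om n -> Om m)) := tmap_linear f_lin e_lin.

Lemma tmap_quad (a : gtens g (Om n)) : Phi (quad N a) = quad N (Phi a).
Proof.
rewrite (lin_sum Phi_lin); apply: eq_bigr => l _; rewrite (linZ Phi_lin).
by rewrite (tmap_tbr gax hax (Omega_cdga K n) (Omega_cdga K m) e_morph) // map_nseq.
Qed.

Lemma tmap_tbr1 (a : gtens g (Om n)) : Phi (tbr [:: a]) = tbr [:: Phi a].
Proof. exact: (tmap_tbr gax hax (Omega_cdga K n) (Omega_cdga K m) e_morph). Qed.

Lemma tmap_intertwine (F : Om n -> Om n) (G : Om m -> Om m) : linear F -> linear G ->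
  (forall w, form_pull e (F w) = G (form_pull e w)) ->
  forall z : gtens g (Om n), Phi (tmap (@idfun g) F z) = tmap (@idfun h) G (Phi z).
Proof.
move=> FL GL FG; have idL (V : lmodType K) := @linear_id K V.
apply: tens_ext.
- exact: linear_comp_fun Phi_lin (tmap_linear (idL g) FL).
- exact: linear_comp_fun (tmap_linear (idL h) GL) Phi_lin.
move=> v w; rewrite (tmap_pure (idL g) FL) !(tmap_pure f_lin e_lin).
by rewrite (tmap_pure (idL h) GL) FG.
Qed.

(** The vertex [e i] upstairs has to match i downstairs: then evaluation, cone and gauge all commute
    with the pullback, and f commutes with the brackets. *)
Lemma solution_natural (b a : gtens g (Om n)) :
  is_solution s N (e i) b a -> is_solution s N i (Phi b) (Phi a).
Proof.
move=> E; rewrite /is_solution {1}E !(linB Phi_lin) tmap_tbr1 -tmap_quad.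
congr (_ - tbr [:: _] - _).
- apply: (tmap_intertwine (F := @form_vertex K n (e i)) (G := @form_vertex K m i)).
    exact: (dga_morph_linear (vertex_morphism K _)).
    exact: (dga_morph_linear (vertex_morphism K _)).
  by move=> w; rewrite /form_vertex -!form_pull_comp.
- apply: (tmap_intertwine (F := signed_rho (e i)) (G := signed_rho i)); try exact: (signed_rho_linear s_gauge).
  by move=> w; rewrite /signed_rho (form_rho_pull s_gauge _ _ e_mono) form_pull_sgn.
- apply: (tmap_intertwine (F := signed_ctr s (e i)) (G := signed_ctr s i)); try exact: signed_ctr_linear.
  by move=> w; rewrite /signed_ctr (form_ctr_pull s_gauge _ _ e_mono) form_pull_sgn.
Qed.

End SolutionNaturality.

(** * Horn filling *)

Section SimplicialOps.
Context (K : fieldType) (s : forall n, Omega K n -> Omega K n) (s_gauge : gauge s).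
Notation Om n := (Omega K n).

Let s_linear n : linear (@s n).
Proof. by move=> c x y; case: s_gauge => [[sl _ _ _] _]; apply: sl. Qed.

Let pull_lin m n (f : 'I_m.+1 -> 'I_n.+1) : linear (form_pull f : Om n -> Om m) :=
  dga_morph_linear (form_pull_morphism K f).

Section OneAlgebra.
Context (V : lmodType K).
Notation T n := (tens V (Om n)).

Definition tpull m n (f : 'I_m.+1 -> 'I_n.+1) : T n -> T m :=
  tmap (@idfun V) (form_pull f : Om n -> Om m).

Lemma tpull_linear m n (f : 'I_m.+1 -> 'I_n.+1) : linear (tpull f).
Proof. exact: tmap_linear (@linear_id K V) (pull_lin f). Qed.

Lemma tpull_comp l m n (f : 'I_m.+1 -> 'I_n.+1) (e : 'I_l.+1 -> 'I_m.+1) (z : T n) :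
  tpull (f \o e) z = tpull e (tpull f z).
Proof.
rewrite /tpull (tmap_comp (@linear_id K V) (pull_lin f) (@linear_id K V) (pull_lin e)).
by apply: eq_tmap => // x; apply: form_pull_comp.
Qed.

Lemma eq_tpull m n (f e : 'I_m.+1 -> 'I_n.+1) (z : T n) : f =1 e -> tpull f z = tpull e z.
Proof. by move=> /funext->. Qed.

Lemma tpull_id n (z : T n) : tpull id z = z.
Proof. by rewrite -[RHS]tmap_id; apply: eq_tmap => // x; apply: form_pull_id. Qed.

End OneAlgebra.

Lemma tmap_tpull (V W : lmodType K) (f : V -> W) m n (e : 'I_m.+1 -> 'I_n.+1) z : linear f ->
  tmap f (@idfun (Om m)) (tpull e z) = tpull e (tmap f (@idfun (Om n)) z).
Proof.
move=> fL; rewrite /tpull (tmap_comp (@linear_id K V) (pull_lin e) fL (@linear_id K _)).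
by rewrite (tmap_comp fL (@linear_id K _) (@linear_id K W) (pull_lin e)).
Qed.

Lemma tmap_surj (V W : lmodType K) (f : V -> W) n : linear f -> (forall y, exists x, f x = y) ->
  forall y : tens W (Om n), exists x, tmap f (@idfun (Om n)) x = y.
Proof.
move=> fL fs; have tL := tmap_linear fL (@linear_id K (Om n)).
elim/tens_ind=> [|c y y' [x <-] [x' <-]|v w]; first by exists 0; rewrite lin0.
  by exists (c *: x + x'); rewrite tL.
by case: (fs v) => v' <-; exists (tpure v' w); rewrite tmap_pure.
Qed.

Lemma tmap_gpr (V W : gvect K) (VG : graded V) (WG : graded W) (F : V -> W) m l
    (phi : Om m -> Om l) (p : int) : dga_morphism phi -> linear F ->
  (forall (q : int) (v : V), of_degree q v -> of_degree q (F v)) -> forall u,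
  tmap F phi (gpr p (u : gtens V (Om m))) = gpr p (tmap F phi u : gtens W (Om l)).
Proof.
move=> phi_m FL Fd; have tL := tmap_linear FL (dga_morph_linear phi_m).
have p1 := gtens_pr_linear VG (Omega_graded K m) p.
have p2 := gtens_pr_linear WG (Omega_graded K l) p.
apply: (tens_hom_ind VG (Omega_graded K m)) => [|c u u' E E'|q r v w hv hw].
- by rewrite (lin0 p1) (lin0 tL) (lin0 p2).
- by rewrite p1 !tL p2 E E'.
rewrite (gtens_pr_hom VG (Omega_graded K m) p hv hw) (tmap_pure FL (dga_morph_linear phi_m)).
rewrite (gtens_pr_hom WG (Omega_graded K l) p (Fd _ _ hv) (dga_morph_deg phi_m hw)).
case: ifP => _; last exact: lin0.
by rewrite (tmap_pure FL (dga_morph_linear phi_m)).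
Qed.

End SimplicialOps.

(** * Faces of the simplex and their intersections *)

Section Faces.

Definition dface n (r : 'I_n.+2) : ordmap n n.+1 := [ffun j : 'I_n.+1 => fintype.lift r j].

Lemma dface_mono n (r : 'I_n.+2) : monotone (dface r).
Proof. by move=> a b; rewrite !ffunE /= leq_bump2. Qed.

Lemma dface_neq n (r : 'I_n.+2) a : dface r a != r.
Proof. by rewrite ffunE eq_sym neq_lift. Qed.

Lemma dface_onto n (r j : 'I_n.+2) : j != r -> exists a : 'I_n.+1, dface r a = j.
Proof.
by rewrite eq_sym => /unlift_some[a -> _]; exists a; rewrite ffunE.
Qed.

Lemma dface_factor m n (r : 'I_n.+2) (f : ordmap m n.+1) : monotone f -> (forall a, f a != r) ->
  exists2 e : ordmap m n, monotone e & f = ocomp (dface r) e.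
Proof.
move=> fm fr; pose e : ordmap m n := [ffun a => odflt ord0 (unlift r (f a))].
have E a : fintype.lift r (e a) = f a.
  by rewrite ffunE; have := fr a; rewrite eq_sym => /unlift_some[b E ->]; rewrite E.
exists e; last by apply/ffunP => a; rewrite [RHS]ffunE [RHS]ffunE E.
by move=> a b ab; have := fm a b ab; rewrite -!E /= leq_bump2.
Qed.

Lemma dface_in_horn n (i r : 'I_n.+2) : r != i -> in_horn i (dface r).
Proof.
move=> ri; split; first exact: dface_mono.
by exists r => // a; apply: dface_neq.
Qed.

(** The witness is the face of codimension 2 opposite to r and r', included through both faces; the
    last clause says that it contains all other vertices. *)
Lemma faces_meet n (i r r' : 'I_n.+2) : r != i -> r' != i -> r' != r ->
  exists (l : nat) (e e' : ordmap l n), [/\ monotone e, monotone e',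
    ocomp (dface r) e = ocomp (dface r') e' &
    forall j, j != r -> j != r' -> exists a : 'I_l.+1, dface r (e a) = j].
Proof.
case: n i r r' => [|n] i r r' ri r'i r'r.
  (* An interval has two vertices only, so i, r and r' cannot be distinct. *)
  have : [|| r == i, r' == i | r' == r].
    by case: i r r' {ri r'i r'r} => [[|[|?]] ?] [[|[|?]] ?] [[|[|?]] ?].
  by rewrite (negPf ri) (negPf r'i) (negPf r'r).
have [t tE] := dface_onto r'r.
have [e' e'm E] : exists2 e' : ordmap n n.+1, monotone e' & ocomp (dface r) (dface t) = ocomp (dface r') e'.
  apply: dface_factor => [a b ab|a]; rewrite !ffunE.
    by have := dface_mono r (dface_mono t ab); rewrite !ffunE.
  apply/eqP => H; have := dface_neq t a; rewrite -tE !ffunE in H *.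
  by rewrite (lift_inj H) eqxx.
exists n, (dface t), e'; split=> //; first exact: dface_mono.
move=> j jr jr'; have [b bE] := dface_onto jr.
have bt : b != t by apply: contraNneq jr' => bt; rewrite -bE bt tE.
by have [a aE] := dface_onto bt; exists a; rewrite aE.
Qed.

(* The retraction of [n+1] onto the face opposite to r which sends r to i; not monotone in
   general, which is harmless for pulling forms back. *)
Lemma face_retraction n (i r : 'I_n.+2) : r != i ->
  exists q : 'I_n.+2 -> 'I_n.+1, forall j, dface r (q j) = if j == r then i else j.
Proof.
move=> ri; have H j : exists a : 'I_n.+1, dface r a = if j == r then i else j.
  by apply: dface_onto; case: (eqVneq j r) => // _; rewrite eq_sym.
by exists (fun j => sval (cid (H j))) => j; apply: (svalP (cid (H j))).
Qed.

End Faces.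

Section LinearHorn.
Context (K : fieldType) (V W : lmodType K) (f : V -> W) (f_lin : linear f).
Hypothesis f_surj : forall y, exists x, f x = y.
Context (n : nat) (i : 'I_n.+2).
Notation Om n := (Omega K n).
Context (x : 'I_n.+2 -> tens V (Om n)) (y : tens W (Om n.+1)).
Hypothesis x_compat : forall r r' l (e e' : ordmap l n), r != i -> r' != i ->
  monotone e -> monotone e' -> ocomp (dface r) e = ocomp (dface r') e' ->
  tpull e (x r) = tpull e' (x r').
Hypothesis xy : forall r, r != i -> tmap f (@idfun (Om n)) (x r) = tpull (dface r) y.

Let fI m := tmap f (@idfun (Om m)).
Let fI_lin m : linear (@fI m) := tmap_linear f_lin (@linear_id K (Om m)).

(** A preimage of y is corrected face by face: the error on the face opposite to r is pulled back
    along a retraction onto that face and added. The error lies in the kernel of f, so the image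
    stays y, and the faces already treated are not disturbed. *)
Lemma linear_horn_filler : exists z : tens V (Om n.+1),
  (forall r, r != i -> tpull (dface r) z = x r) /\ fI z = y.
Proof.
suff gen (rs : seq 'I_n.+2) : exists z : tens V (Om n.+1),
    (forall r, r \in rs -> r != i -> tpull (dface r) z = x r) /\ fI z = y.
  by case: (gen (enum 'I_n.+2)) => z [zx zy]; exists z; split=> // r; apply: zx; rewrite mem_enum.
elim: rs => [|r rs [z [zx zy]]].
  by case: (tmap_surj f_lin f_surj y) => z zy; exists z; split.
have [ri|ri] := eqVneq r i.
  exists z; split=> // r'; rewrite inE => /predU1P[-> |]; last exact: zx.
  by rewrite ri eqxx.
have [q qE] := face_retraction ri.
pose u := x r - tpull (dface r) z.
have fu : fI u = 0.
  by rewrite /u (linB (@fI_lin n)) /fI (xy ri) tmap_tpull // -/(fI z) zy subrr.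
exists (z + tpull q u); split; last first.
  rewrite (linD (@fI_lin n.+1)) zy /fI tmap_tpull // -/(fI u) fu.
  by rewrite (lin0 (tpull_linear _)) addr0.
move=> r'; rewrite (linD (tpull_linear _)) -tpull_comp.
have [-> _ _|r'r] := eqVneq r' r.
  rewrite (eq_tpull (e := id)) ?tpull_id; first by rewrite addrC subrK.
  move=> a /=; have := qE (dface r a); rewrite (negPf (dface_neq r a)).
  by rewrite !ffunE => /lift_inj.
rewrite inE (negPf r'r) /= => r'rs r'i; rewrite (zx _ r'rs r'i).
(* The retraction sends r to i, which differs from r', so it maps the face opposite to r' into the
   intersection of both faces. There the error vanishes, because z already agrees with [x r'] and
   the data are compatible. *)
suff -> : tpull (q \o dface r') u = 0 by rewrite addr0.
have [l [e [e' [em e'm ee' onto]]]] := faces_meet ri r'i r'r.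
have eu : tpull e u = 0.
  rewrite /u (linB (tpull_linear e)) (x_compat ri r'i em e'm ee') -(zx r') // -!tpull_comp.
  apply/eqP; rewrite subr_eq0; apply/eqP; apply: eq_tpull => a /=.
  by have := congr1 (fun h : ordmap _ _ => h a) ee'; rewrite !ffunE.
have H a : exists b : 'I_l.+1, dface r (e b) = dface r (q (dface r' a)).
  by rewrite qE; case: eqVneq => [_|ar]; apply: onto => //; rewrite ?dface_neq // eq_sym.
pose c a := sval (cid (H a)).
have cE : q \o dface r' =1 e \o c.
  move=> a /=; have := svalP (cid (H a)); rewrite -/(c a) [LHS]ffunE [RHS]ffunE.
  by move/lift_inj.
by rewrite (eq_tpull _ cE) tpull_comp eu (lin0 (tpull_linear _)).
Qed.

End LinearHorn.

(** * The simplicial set [gamma] and its maps *)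

Section Gamma.
Context (K : fieldType) (charK : [pchar K] =i pred0).
Context (s : forall n, Omega K n -> Omega K n) (s_gauge : gauge s).
Notation Om n := (Omega K n).

Let s_linear n : linear (@s n).
Proof. by move=> c x y; case: s_gauge => [[sl _ _ _] _]; apply: sl. Qed.

Let s_pull m n (f : ordmap m n) (x : Om n) : monotone f -> form_pull f (s x) = s (form_pull f x).
Proof. by case: s_gauge => [[_ _ sp _] _]; apply: sp. Qed.

Let pull_lin m n (f : 'I_m.+1 -> 'I_n.+1) : linear (form_pull f : Om n -> Om m) :=
  dga_morph_linear (form_pull_morphism K f).

Lemma MC_tmap (g h : brvect K) (gax : Linf_axioms g) (hax : Linf_axioms h) (f : g -> h) m n
    (phi : Om n -> Om m) : dga_morphism phi -> linear f ->
  (forall (i : int) (x : g), of_degree i x -> of_degree i (f x)) ->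
  (forall t : seq g, (0 < size t)%N -> f (br t) = br [seq f x | x <- t]) ->
  forall a : tensor_Linf g (Om n), MC a -> MC (tmap f phi a : tensor_Linf h (Om m)).
Proof.
move=> phi_m fL fd fb a [a1 [N0 H]].
have tE := tmap_tbr gax hax (Omega_cdga K n) (Omega_cdga K m) phi_m fL fd fb.
have tL := tmap_linear fL (dga_morph_linear phi_m).
split; first exact: (tmap_deg gax hax (Omega_cdga K n) (Omega_cdga K m) phi_m fL fd).
exists N0 => M /H; move/(congr1 (tmap f phi)); rewrite (linD tL) (lin0 tL) [X in _ + X](lin_sum tL).
move=> E; apply: etrans _ E; congr (_ + _); first by rewrite [RHS]tE.
by apply: eq_bigr => l _; rewrite (linZ tL) [X in _ = _ *: X]tE map_nseq.
Qed.

Lemma gamma_simplicial (g : Linf K) : simplicial (gamma s g).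
Proof.
have gax := Linf_ax g; have idL := @linear_id K (gsort g).
split=> [m n f a fm [aMC sa]|n a _|l m n f e a _ _ _].
- split.
    apply: (MC_tmap (f := @idfun g) gax gax (form_pull_morphism K f)) aMC => // t _.
    by rewrite map_id.
  rewrite /= (tmap_comp idL (pull_lin f) idL (@s_linear m)).
  rewrite (eq_tmap (f' := idfun) (g' := fun w => form_pull f (s w))) //; last first.
    by move=> w; rewrite /= s_pull.
  rewrite -(tmap_comp idL (@s_linear n) idL (pull_lin f)) [X in tmap _ _ X]sa.
  exact: (lin0 (tmap_linear idL (pull_lin f))).
- rewrite /= -[RHS]tpull_id; apply: eq_tmap => // w; apply: eq_form_pull => i.
  by rewrite ffunE.
- rewrite /= -[RHS]tpull_comp; apply: eq_tmap => // w; apply: eq_form_pull => i.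
  by rewrite ffunE.
Qed.

Lemma idfun_morphism n : dga_morphism (@idfun (Om n)).
Proof. by []. Qed.

Lemma gamma_map_simplicial (g h : Linf K) (f : g -> h) : Linf_morphism f ->
  simplicial_map (X := gamma s g) (Y := gamma s h) (@gamma_map K s g h f).
Proof.
case=> fL fd fb; split=> [n a [aMC sa]|m n e a _ _]; last exact: tmap_tpull.
split; first exact: (MC_tmap (Linf_ax g) (Linf_ax h) (idfun_morphism n) fL fd fb aMC).
have iL V := @linear_id K V.
rewrite /= /gamma_map (tmap_comp fL (iL _) (iL _) (@s_linear n)).
rewrite -(tmap_comp (iL _) (@s_linear n) fL (iL _)) [X in tmap _ _ X]sa.
exact: (lin0 (tmap_linear fL (iL _))).
Qed.

End Gamma.

Theorem theorem5p8 (K : fieldType) (charK : [pchar K] =i pred0)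
    (s : forall n : nat, Omega K n -> Omega K n) (s_gauge : gauge s)
    (g h : Linf K) (g_nilp : nilpotent g) (h_nilp : nilpotent h)
    (f : g -> h) (f_morph : Linf_morphism f)
    (f_surj : forall y : h, exists x : g, f x = y) :
  kan_fibration (X := gamma s g) (Y := gamma s h) (@gamma_map K s g h f).
Proof.
split; [exact: gamma_simplicial|exact: gamma_simplicial|exact: gamma_map_simplicial|].
have gax := Linf_ax g; have hax := Linf_ax h; case: (f_morph) => fL fd fb.
(* One bound serves both algebras; it is at least 2 because nilpotency gives no vanishing of the
   unary bracket. *)
have [N [N2 gN hN]] : exists N, [/\ (2 <= N)%N,
    forall i, (N <= i)%N -> forall x : g, Fil i x -> x = 0 &
    forall i, (N <= i)%N -> forall x : h, Fil i x -> x = 0].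
  case: g_nilp => N1 H1; case: h_nilp => N3 H3; exists (2 + (N1 + N3))%N; split=> // i Ni.
    by apply: H1; apply: leq_trans Ni; rewrite addnCA leq_addr.
  by apply: H3; apply: leq_trans Ni; rewrite addnA leq_addl.
case=> // n i _ x [x_mem x_op] y [yMC sy] xy.
have iL V := @linear_id K V.
have xD r : r != i -> in_horn i (dface r) := @dface_in_horn n i r.
have [||z [zx zy]] := linear_horn_filler fL f_surj (i := i) (x := fun r => x n (dface r)) (y := y).
- move=> r r' l e e' ri r'i em e'm ee'.
  have H1 := x_op _ _ _ e (xD r ri) em; have H2 := x_op _ _ _ e' (xD r' r'i) e'm.
  by apply: etrans (esym H1) _; rewrite ee'.
- by move=> r ri; apply: esym; apply: xy; apply: xD.
have OG m := Omega_graded K m.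
have gG : graded g by case: gax. have hG : graded h by case: hax.
(* The linear filler need not be homogeneous. Its component of degree 1 has the same prescribed
   faces and image, as those are of degree 1. *)
pose b := gpr (1 : int) (z : gtens g (Omega K n.+1)).
have b1 : of_degree 1 b by apply: of_degree_gpr; apply: gtens_graded.
have bx r : r != i -> tpull (dface r) b = x n (dface r).
  move=> ri; have [[x1 _] _] := x_mem _ _ (xD r ri).
  rewrite /tpull (tmap_gpr gG gG _ (form_pull_morphism K (dface r)) (iL _)) //.
  by rewrite -/(tpull (dface r) z) zx // x1.
have fb_y : tmap f idfun b = y.
  have [y1 _] := yMC; rewrite (tmap_gpr gG hG _ (idfun_morphism K _) fL fd).
  by rewrite [tmap f idfun z]zy y1.
have br_id (t : seq g) : (0 < size t)%N -> idfun (br t) = br [seq idfun v | v <- t].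
  by rewrite map_id.
(* The vertex i belongs to the horn, so the value of b there comes from a Maurer-Cartan element on
   the point. A second vertex r exists because the dimension is positive, and the face opposite to r
   contains i. *)
have bi : curvature N (tens_vertex i b) = 0.
  have [r ri] : exists r, r != i.
    by exists (if i == ord0 then ord_max else ord0); case: (eqVneq i ord0) => [->|]; rewrite 1?eq_sym.
  have v_horn : in_horn i (vertex_in i).
    by split; [apply: monotone_vertex_in|exists r => // a; rewrite ffunE eq_sym].
  have [vm vr] : monotone (vertex_in i) /\ forall a, vertex_in i a != r.
    by split; [apply: monotone_vertex_in|move=> a; rewrite ffunE eq_sym].
  have [e em vE] := dface_factor vm vr.
  have [xMC _] := x_mem _ _ v_horn.
  have E : tens_vertex i b = tmap (@idfun g) (form_pull (to_point n.+1)) (x 0%N (vertex_in i)).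
    rewrite vE (x_op _ _ _ e (xD r ri) em) -(bx r ri).
    rewrite -[RHS]/(tpull (to_point n.+1) (tpull e (tpull (dface r) b))) -!tpull_comp.
    apply: eq_tmap => // w; apply: eq_form_pull => a /=.
    have := congr1 (fun k : ordmap _ _ => k (to_point n.+1 a)) vE.
    by rewrite ffunE => ->; rewrite !ffunE.
  have := MC_tmap (f := @idfun g) gax gax (form_pull_morphism K (to_point n.+1)) (iL _)
    (fun _ _ hx => hx) br_id xMC.
  by rewrite -E => /(MC_curv gax N2 gN)[].
have [a [a1 ca sa aE]] := solution_exists charK s_gauge gax N2 gN b1 bi.
have aMC : MC (a : tensor_Linf g (Omega K n.+1)) by apply/(MC_curv gax N2 gN).
(* The face contains the vertex i, so both sides solve the equation whose datum is the prescribed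
   face, and uniqueness applies. *)
have a_face r : r != i -> tpull (dface r) a = x n (dface r).
  move=> ri; have [j jE] : exists j : 'I_n.+1, dface r j = i by apply: dface_onto; rewrite eq_sym.
  have [xMC sx] := x_mem _ _ (xD r ri); case/(MC_curv gax N2 gN): xMC => x1 cx.
  have S1 := gamma_solution charK s_gauge gax j x1 cx sx.
  have S2 : is_solution s N j (x n (dface r)) (tpull (dface r) a).
    rewrite -(bx r ri).
    apply: (solution_natural s_gauge gax gax (iL _) (fun _ _ hx => hx) br_id (@dface_mono n r)).
    by rewrite jE.
  exact: (solution_unique s_gauge gax N2 gN S2 S1).
exists a; split=> //.
(* Every simplex of the horn factors through one of its faces, where the agreement is known. *)
- move=> m e [em [r ri er]]; have [e' e'm ->] := dface_factor em er.
  rewrite (x_op _ _ _ e' (xD r ri) e'm) -(a_face r ri) /= -[RHS]/(tpull e' (tpull _ a)).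
  rewrite -tpull_comp; apply: eq_tmap => // w; apply: eq_form_pull => k.
  by rewrite ffunE.
- case/(MC_curv hax N2 hN): yMC => y1 cy.
  have S1 := gamma_solution charK s_gauge hax i y1 cy sy.
  (* The naturality lemma combines f with a simplicial operator, so the identity operator is
     inserted to apply f alone. *)
  have idm : monotone ([ffun k => k] : ordmap n.+1 n.+1) by move=> k l; rewrite !ffunE.
  have pid (w : Omega K n.+1) : form_pull ([ffun k => k] : ordmap n.+1 n.+1) w = idfun w.
    by rewrite -[RHS]form_pull_id; apply: eq_form_pull => k; rewrite ffunE.
  have tid u : tmap f (form_pull ([ffun k => k] : ordmap n.+1 n.+1)) u = tmap f idfun u.
    exact: eq_tmap.
  have S2 : is_solution s N i y (tmap f idfun a).
    rewrite -fb_y -!tid.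
    apply: (solution_natural s_gauge gax hax fL fd fb idm).
    by rewrite ffunE.
  exact: (solution_unique s_gauge hax N2 hN S2 S1).
Qed.
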